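(* Let $\mu=a\omega_1+b\omega_2$, $a,b\in\mathbb N$, and $\lambda=\nu_i+d_1\lambda_1+d_2\lambda_2\in P^+_G(\mu)$ with $0\le i\le a$, $d_1,d_2\in\mathbb N$. Let $j\colon V^K_\mu\to W^G_\lambda$ be the $K$-intertwiner with $v_\mu\mapsto w$ ($W^G_\lambda$, $w$ as in the context) and define the matrix spherical function $Q^\mu_\lambda\colon G\to\mathrm{End}(V^K_\mu)$ by $Q^\mu_\lambda(g)=j^\ast\circ\pi_{W^G_\lambda}(g)\circ j$. Then for all $\mathbf t=(t_1,t_2)\in\mathbb R^2$ $$Q^\mu_\lambda(a_{\mathbf t})=\bigl(\psi_1(a_{\mathbf t})\bigr)^{d_1}\bigl(\psi_2(a_{\mathbf t})\bigr)^{d_2}\,Q^\mu_{\nu_i}(a_{\mathbf t}),$$ and, with $A=\{a_{\mathbf t}\mid\mathbf t\in\mathbb R^2\}$, $Q^\mu_\lambda|_A=\sum_{\lambda'\preccurlyeq\lambda;\ \lambda'\in P^+_G(\mu)}a_{\lambda'}\,\Phi^\mu_{\lambda'}|_A$ for certain constants $a_{\lambda'}$.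
   Context: $\mathbb N=\{0,1,2,\dots\}$, $m>2$ an integer, $G=\mathrm{SU}(m+2)$, $K=\mathrm S(\mathrm U(2)\times\mathrm U(m))\subset G$ embedded block-diagonally with $\mathrm U(2)$ in the upper left block. $\omega_i(\mathrm{diag}(t_1,\dots,t_{m+2}))=t_1\cdots t_i$, $1\le i\le m+1$ (characters of the diagonal torus, written additively). $(\pi^G_\lambda,V^G_\lambda)$, $(\pi^K_\mu,V^K_\mu)$ are irreducible unitary representations of highest weight $\lambda\in\bigoplus_i\mathbb N\omega_i$, resp. $\mu=a\omega_1+b\omega_2$. Partial order: $\lambda'\preccurlyeq\lambda$ iff $\lambda-\lambda'\in\bigoplus_{i=1}^{m+1}\mathbb N\alpha_i$, $\alpha_i$ the standard simple roots. $\lambda_1=\omega_1+\omega_{m+1}$, $\lambda_2=\omega_2+\omega_m$, $\nu_i=(a-i)\omega_1+(i+b)\omega_2+i\omega_{m+1}$. $P^+_G(\mu)$ is the set of dominant weights $\lambda$ such that $V^K_\mu$ occurs (then exactly once) in $V^G_\lambda|_K$; every such $\lambda$ is uniquely $\nu_i+d_1\lambda_1+d_2\lambda_2$. For $\lambda\in P^+_G(\mu)$, $\Phi^\mu_\lambda(g)=j_\lambda^\ast\circ\pi^G_\lambda(g)\circ j_\lambda$ with $j_\lambda\colon V^K_\mu\to V^G_\lambda$ a unitary $K$-intertwiner. A matrix spherical function is a regular $\Phi\colon G\to\mathrm{End}(V^K_\mu)$ with $\Phi(k_1gk_2)=\pi^K_\mu(k_1)\Phi(g)\pi^K_\mu(k_2)$.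 $a_{\mathbf t}\in G$ acts on $\mathbb C^{m+2}$ by $e_1\mapsto\cos t_1e_1+i\sin t_1e_{m+2}$, $e_{m+2}\mapsto i\sin t_1e_1+\cos t_1e_{m+2}$, $e_2\mapsto\cos t_2e_2+i\sin t_2e_{m+1}$, $e_{m+1}\mapsto i\sin t_2e_2+\cos t_2e_{m+1}$, fixing $e_3,\dots,e_m$. $\psi_1(a_{\mathbf t})=\cos^2t_1+\cos^2t_2$, $\psi_2(a_{\mathbf t})=\cos^2t_1\cos^2t_2$. $V^G_{\omega_l}=\Lambda^l\mathbb C^{m+2}$ with standard inner product; $V^G_{N\omega_1}$ is realised as homogeneous polynomials of degree $N$ in $x_1,\dots,x_{m+2}$, with $\|x_1^N\|=1$. Put $v_1=e_1\otimes e_2\wedge e_3\wedge\cdots\wedge e_{m+2}-e_2\otimes e_1\wedge e_3\wedge\cdots\wedge e_{m+2}\in V^G_{\omega_1}\otimes V^G_{\omega_{m+1}}$, $v_2=e_1\wedge e_2\otimes e_3\wedge\cdots\wedge e_{m+2}\in V^G_{\omega_2}\otimes V^G_{\omega_m}$, $v_0=e_1\wedge e_2\otimes e_1\wedge e_3\wedge\cdots\wedge e_{m+2}\in V^G_{\omega_2}\otimes V^G_{\omega_{m+1}}$; $U^G_{\nu_i}=V^G_{(a-i)\omega_1}\otimes(V^G_{\omega_2}\otimes V^G_{\omega_{m+1}})^{\otimes i}\otimes(V^G_{\omega_2})^{\otimes b}$, $u=x_1^{a-i}\otimes v_0^{\otimes i}\otimes(e_1\wedge e_2)^{\otimes b}$;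 $W^G_\lambda=(V^G_{\omega_1}\otimes V^G_{\omega_{m+1}})^{\otimes d_1}\otimes(V^G_{\omega_2}\otimes V^G_{\omega_m})^{\otimes d_2}\otimes U^G_{\nu_i}$, $w=v_1^{\otimes d_1}\otimes v_2^{\otimes d_2}\otimes u$. Both $u$ and $w$ are $K$-highest weight vectors of weight $\mu$. The highest weight vector $v_\mu\in V^K_\mu$ is normalised by $\|v_\mu\|=\|u\|=1$. $Q^\mu_{\nu_i}$ (the case $d_1=d_2=0$) is given on $A$ by $Q^\mu_{\nu_i}(a_{\mathbf t})F_1^k\cdot v_\mu=q^\mu_{\nu_i,\sigma_k}(a_{\mathbf t})F_1^k\cdot v_\mu$, $0\le k\le a$, $F_1=E_{2,1}$, with $$q^\mu_{\nu_i,\sigma_k}(a_{\mathbf t})=(\cos t_1)^{a+b-k}\sum_{p=0}^{\min(i,k)}\frac{(-i)_p(-k)_p}{p!\,(-a)_p}(\cos^2t_2-\cos^2t_1)^p(\cos t_2)^{b+2i+k-2p}.$$ *)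

(* Defs.v *)
From mathcomp Require Import all_boot all_order all_algebra.
From mathcomp Require Import sesquilinear spectral.
(* The notations of mpoly are incompatible with those of MathComp-Analysis. *)
From mathcomp Require Import -(notations) mpoly.
From mathcomp.real_closed Require Import complex mxtens.
From mathcomp Require Import all_classical all_reals all_analysis.

Set Implicit Arguments.
Unset Strict Implicit.
Unset Printing Implicit Defensive.

Import Order.TTheory GRing.Theory Num.Theory numFieldNormedType.Exports.

Local Open Scope classical_set_scope.
Local Open Scope complex_scope.
Local Open Scope sesquilinear_scope.
Local Open Scope ring_scope.

(* R[i] packed as a structure, so that the topology that MathComp-Analysis puts
   on every numClosedFieldType is found for it (and for matrices over it). *)
Definition cplx (R : realType) : numClosedFieldType := R[i].

Section Groups.
Variables (R : realType) (m : nat).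
Local Notation C := (cplx R).

Definition SU : set 'M[C]_m.+2 := [set g | g \is unitarymx /\ \det g = 1].

Definition SU2Um : set 'M[C]_m.+2 :=
  [set k | exists k1 : 'M[C]_2, exists k2 : 'M[C]_m,
    [/\ k1 \is unitarymx, k2 \is unitarymx, \det k1 * \det k2 = 1 &
        k = (block_mx k1 0 0 k2 : 'M[C]_(2 + m))]].

(* The vector e_k, with k counted from 1 to m+2. *)
Definition evec (k : nat) : 'cV[C]_m.+2 := delta_mx (inord k.-1) 0.

Definition aelt (t1 t2 : R) : 'M[C]_m.+2 :=
  \matrix_(k, l)
    (if l == inord 0 then (cos t1)%:C *: evec 1 + ('i%C * (sin t1)%:C) *: evec m.+2
     else if l == inord m.+1 then
       ('i%C * (sin t1)%:C) *: evec 1 + (cos t1)%:C *: evec m.+2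
     else if l == inord 1 then
       (cos t2)%:C *: evec 2 + ('i%C * (sin t2)%:C) *: evec m.+1
     else if l == inord m then
       ('i%C * (sin t2)%:C) *: evec 2 + (cos t2)%:C *: evec m.+1
     else evec l.+1) k 0.

Definition psi1 (t1 t2 : R) : C := (cos t1 ^+ 2 + cos t2 ^+ 2)%:C.
Definition psi2 (t1 t2 : R) : C := (cos t1 ^+ 2 * cos t2 ^+ 2)%:C.

End Groups.

Section Weights.
Variable m : nat.

(* Weights of the diagonal torus of SU(m+2), in the basis omega_1 .. omega_(m+1):
   the entry of index k is the coefficient of omega_(k+1). *)
Definition weight := 'rV[int]_m.+1.

(* omega i = 0 for i = 0 and for i > m+1. *)
Definition omega (i : nat) : weight := \row_k (k.+1 == i)%:Z.

(* The character t_i / t_(i+1): since omega_i(t) = t_1 ... t_i and the product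
   of all the t_k is 1, it is 2 omega_i - omega_(i-1) - omega_(i+1). *)
Definition alpha (i : nat) : weight := omega i *+ 2 - omega i.-1 - omega i.+1.

Definition dominant (l : weight) : Prop := forall k, 0 <= l 0 k.

(* The order attached to the simple roots alpha_i with 1 <= i <= m+1 and P i. *)
Definition preceq_on (P : pred nat) (l' l : weight) : Prop :=
  exists c : nat -> nat, l - l' = \sum_(1 <= i < m.+2 | P i) alpha i *+ c i.

Definition preceq : weight -> weight -> Prop := preceq_on predT.

(* alpha_2 is the only simple root of SU(m+2) that is not a root of
   S(U(2) x U(m)). *)
Definition preceqK : weight -> weight -> Prop := preceq_on (predC1 2%N).

Definition character (R : realType) (l : weight) (t : 'rV[cplx R]_m.+2) :
  cplx R := \prod_(k < m.+1) (\prod_(p < m.+2 | (p <= k)%N) t 0 p) ^ l 0 k.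

Definition mu (a b : nat) : weight := omega 1 *+ a + omega 2 *+ b.
Definition lambda1 : weight := omega 1 + omega m.+1.
Definition lambda2 : weight := omega 2 + omega m.
Definition nu (a b i : nat) : weight :=
  omega 1 *+ (a - i) + omega 2 *+ (i + b) + omega m.+1 *+ i.

End Weights.

Section Representations.
Variables (R : realType) (m : nat).
Local Notation C := (cplx R).
Implicit Type H : set 'M[C]_m.+2.

(* A finite-dimensional Hilbert space, in coordinates with respect to an
   orthonormal basis, with an operator for each matrix; only the matrices of
   the group under consideration (SU or SU2Um) matter. *)
Record rep := Rep { rdim : nat; ract : 'M[C]_m.+2 -> 'M[C]_rdim }.

Definition unitary_rep H (V : rep) : Prop :=
  [/\ ract V 1%:M = 1%:M,
      forall g h, H g -> H h -> ract V (g *m h) = ract V g *m ract V h,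
      forall g, H g -> ract V g \is unitarymx &
      {within H, continuous (ract V)}].

Definition irreducible H (V : rep) : Prop :=
  (0 < rdim V)%N /\
  forall W : {vspace 'cV[C]_(rdim V)},
    (forall g v, H g -> v \in W -> ract V g *m v \in W) ->
    W = 0%VS \/ W = fullv.

Definition weight_vector (V : rep) (l : weight m) (v : 'cV[C]_(rdim V)) : Prop :=
  forall t : 'rV[C]_m.+2, SU (diag_mx t) ->
    ract V (diag_mx t) *m v = character l t *: v.

Definition is_weight (V : rep) (l : weight m) : Prop :=
  exists2 v : 'cV[C]_(rdim V), v != 0 & weight_vector l v.

Definition highest_weight (le : weight m -> weight m -> Prop) (V : rep)
  (l : weight m) : Prop :=
  is_weight V l /\ forall l', is_weight V l' -> le l' l.

Definition irrepG (V : rep) (l : weight m) : Prop :=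
  [/\ unitary_rep (@SU R m) V, irreducible (@SU R m) V &
      highest_weight (@preceq m) V l].

Definition irrepK (V : rep) (l : weight m) : Prop :=
  [/\ unitary_rep (@SU2Um R m) V, irreducible (@SU2Um R m) V &
      highest_weight (@preceqK m) V l].

Definition K_intertwiner (V W : rep) (j : 'M[C]_(rdim W, rdim V)) : Prop :=
  forall k, SU2Um k -> j *m ract V k = ract W k *m j.

Definition unitary_K_intertwiner (V W : rep) (j : 'M[C]_(rdim W, rdim V)) : Prop :=
  K_intertwiner j /\ j^t* *m j = 1%:M.

Definition Pplus (VK : rep) (VG : weight m -> rep) (l : weight m) : Prop :=
  dominant l /\
  exists2 j : 'M[C]_(rdim (VG l), rdim VK), K_intertwiner j & j != 0.

Definition compression (V W : rep) (j : 'M[C]_(rdim W, rdim V))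
  (g : 'M[C]_m.+2) : 'M[C]_(rdim V) := j^t* *m ract W g *m j.

Definition rtens (V W : rep) : rep := Rep (fun g => ract V g *t ract W g).

Definition vtens (V W : rep) (v : 'cV[C]_(rdim V)) (w : 'cV[C]_(rdim W)) :
  'cV[C]_(rdim (rtens V W)) := v *t w.

Fixpoint rpow (V : rep) (k : nat) : rep :=
  if k is k'.+1 then rtens V (rpow V k') else Rep (fun=> 1%:M : 'M[C]_1).

Fixpoint vpow (V : rep) (v : 'cV[C]_(rdim V)) (k : nat) :
  'cV[C]_(rdim (rpow V k)) :=
  match k return 'cV[C]_(rdim (rpow V k)) with
  | 0 => 1%:M
  | k'.+1 => vtens v (vpow v k')
  end.

(* Exterior powers, in the basis e_S = e_(s_1) /\ ... /\ e_(s_l) indexed by the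
   sets S = {s_1 < ... < s_l}. *)
Definition lset (l : nat) := {S : {set 'I_m.+2} | #|S| == l}.

Definition lset_nth (l : nat) (S : 'I_#|{: lset l}|) (p : nat) : 'I_m.+2 :=
  nth ord0 (enum (sval (enum_val S))) p.

Definition wedge (l : nat) (v : 'I_l -> 'cV[C]_m.+2) : 'cV[C]_#|{: lset l}| :=
  \col_S \det (\matrix_(p < l, q < l) v q (lset_nth S p) 0).

Definition Lam (l : nat) : rep :=
  Rep (fun g => \matrix_(S, T)
         wedge (fun q : 'I_l => col (lset_nth T q) g) S 0).

(* Homogeneous polynomials of degree N. The matrix g acts by the substitution
   x_i |-> \sum_j g_ji x_j. The invariant inner product with ||x_1^N|| = 1 makes
   the monomials orthogonal with ||x^al||^2 = al! / N!, so the vectors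
   x^al / ||x^al|| form an orthonormal basis. *)
Definition monomial (N : nat) :=
  {al : bmultinom m.+2 N.+1 | mdeg al == N}.

Definition exponent (N : nat) (k : 'I_#|{: monomial N}|) : multinom m.+2 :=
  bmnm (sval (enum_val k)).

Definition monomial_norm (N : nat) (al : multinom m.+2) : R :=
  Num.sqrt ((\prod_(p < m.+2) (al p)`!)%:R / (N`!)%:R).

Definition substitution (g : 'M[C]_m.+2) (p : mpoly m.+2 C) : mpoly m.+2 C :=
  comp_mpoly [tuple \sum_(j < m.+2) g j i *: mpolyX C (mnm1 j) | i < m.+2] p.

Definition symvec (N : nat) (p : mpoly m.+2 C) : 'cV[C]_#|{: monomial N}| :=
  \col_k ((monomial_norm N (exponent k))%:C * mcoeff (exponent k) p).

Definition Sym (N : nat) : rep :=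
  Rep (fun g => \matrix_(k, l)
         symvec N (substitution g
           ((monomial_norm N (exponent l))%:C^-1 *: mpolyX C (exponent l))) k 0).

(* e_1 /\ e_2, e_2 /\ ... /\ e_(m+2), e_1 /\ e_3 /\ ... /\ e_(m+2) and
   e_3 /\ ... /\ e_(m+2) *)
Definition e12 : 'cV[C]_(rdim (Lam 2)) := wedge (fun q : 'I_2 => evec R m q.+1).
Definition e2_last : 'cV[C]_(rdim (Lam m.+1)) :=
  wedge (fun q : 'I_m.+1 => evec R m q.+2).
Definition e13_last : 'cV[C]_(rdim (Lam m.+1)) :=
  wedge (fun q : 'I_m.+1 => evec R m (if q == ord0 then 1 else q.+2)).
Definition e3_last : 'cV[C]_(rdim (Lam m)) :=
  wedge (fun q : 'I_m => evec R m q.+3).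

Definition v1 : 'cV[C]_(rdim (rtens (Lam 1) (Lam m.+1))) :=
  vtens (V := Lam 1) (wedge (fun _ : 'I_1 => evec R m 1)) e2_last
  - vtens (V := Lam 1) (wedge (fun _ : 'I_1 => evec R m 2)) e13_last.
Definition v2 : 'cV[C]_(rdim (rtens (Lam 2) (Lam m))) := vtens e12 e3_last.
Definition v0 : 'cV[C]_(rdim (rtens (Lam 2) (Lam m.+1))) := vtens e12 e13_last.

Definition Urep (a b i : nat) : rep :=
  rtens (Sym (a - i))
    (rtens (rpow (rtens (Lam 2) (Lam m.+1)) i) (rpow (Lam 2) b)).

Definition uvec (a b i : nat) : 'cV[C]_(rdim (Urep a b i)) :=
  vtens (V := Sym (a - i)) (symvec (a - i) (mpolyX C (mnm1 ord0) ^+ (a - i)))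
    (vtens (vpow v0 i) (vpow e12 b)).

Definition Wrep (a b i d1 d2 : nat) : rep :=
  rtens (rpow (rtens (Lam 1) (Lam m.+1)) d1)
    (rtens (rpow (rtens (Lam 2) (Lam m)) d2) (Urep a b i)).

Definition wvec (a b i d1 d2 : nat) : 'cV[C]_(rdim (Wrep a b i d1 d2)) :=
  vtens (vpow v1 d1) (vtens (vpow v2 d2) (uvec a b i)).

End Representations.

(* Main.v *)
From mathcomp Require Import perm.
Require Import Defs.
From mathcomp Require Import all_boot all_order all_algebra.
From mathcomp Require Import sesquilinear spectral.
From mathcomp Require Import -(notations) mpoly.
From mathcomp.real_closed Require Import complex mxtens.
From mathcomp Require Import all_classical all_reals all_analysis.
From mathcomp Require Import ring lra zify.

Import Order.TTheory GRing.Theory Num.Theory numFieldNormedType.Exports.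

Local Open Scope classical_set_scope.
Local Open Scope sesquilinear_scope.
Local Open Scope ring_scope.

Set Implicit Arguments.
Unset Strict Implicit.
Unset Printing Implicit Defensive.

(* First formula: V_mu^K is irreducible and v_1, v_2 are K-invariant, so
   j x = v_1^d1 (x) v_2^d2 (x) j_nu x for every x, and the compression factors through
   <v_1, g v_1> and <v_2, g v_2>. For g in SU(m+2) the cofactors are the conjugate
   entries, whence <v_1, g v_1> = sum_(k,l<=2) |g_kl|^2, and <v_2, g v_2> = |det A|^2 for
   the upper left 2x2 block A. Both equal their value at 1 when g is in K, which by the
   equality case of Cauchy-Schwarz gives the invariance, and they are psi_1, psi_2 at a_t.

   Expansion: the span of the G-orbit of w is a unitary representation whose weights
   are below lambda. Decompose it into irreducible pieces. Each piece met by j has a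
   dominant highest weight l below lambda, is equivalent to V_l^G, and its part of the
   compression is a multiple of Phi_l because Hom_K(V_mu^K, V_l^G) is one-dimensional.

   Since representations are only assumed continuous, the Lie algebra acts through
   generators of one-parameter groups: p(exp X) = exp(dpi X), with dpi linear by the
   Trotter formula. Multiplicity one is the infinitesimal form of sphericity: for a
   suitable x in SU(m+2), every matrix is the sum of one in x b x^-1 (b upper triangular)
   and one whose adjoint acts by a scalar on the image of v_mu. *)

(** * Adjoints, unitary diagonalisation and skew-Hermitian matrices *)

Section Adjoint.
Variable C : numClosedFieldType.

(** Since mu involves only omega_1 and omega_2, the image of v_mu is an eigenvector of all of gl_m
    and of a Borel subalgebra of gl_2. The subalgebra they form is so large that, together with a
    Borel subalgebra of gl_(m+2) in general position, it spans everything; the element x is the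
    unitary factor of an explicit unipotent matrix representing such a position. The given family
    has an irreducible representation for every dominant weight, so highest weight theory enters
    only as a uniqueness statement: the submodule of a direct sum generated by a pair of highest
    weight vectors is the graph of an intertwiner. The orbit of w is decomposed rather than the
    whole of W because on powers of linear forms both the action and the inner product of the
    symmetric power are explicit. Limits are taken along the times 2^-k. Squaring leads from one
    scale to the previous one, so the dyadic values form a chain of square roots, from which a
    generator is recovered by a logarithm at one small scale. *)

Lemma ctmxM m n p (A : 'M[C]_(m, n)) (B : 'M[C]_(n, p)) :
  (A *m B)^t* = B^t* *m A^t*.
Proof. by rewrite trmx_mul map_mxM. Qed.

Lemma ctmxD m n (A B : 'M[C]_(m, n)) : (A + B)^t* = A^t* + B^t*.
Proof. by rewrite raddfD /= map_mxD. Qed.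

Lemma ctmxN m n (A : 'M[C]_(m, n)) : (- A)^t* = - A^t*.
Proof. by rewrite raddfN /= map_mxN. Qed.

Lemma ctmxZ m n c (A : 'M[C]_(m, n)) : (c *: A)^t* = c^* *: A^t*.
Proof. by rewrite linearZ /= map_mxZ. Qed.

Lemma ctmx1 n : (1%:M : 'M[C]_n)^t* = 1%:M.
Proof. by rewrite trmx1 map_mx1. Qed.

Lemma ctmx0 m n : (0 : 'M[C]_(m, n))^t* = 0.
Proof. by rewrite trmx0 map_mx0. Qed.

Lemma unitaryP n (A : 'M[C]_n) : A \is unitarymx ->
  A *m A^t* = 1%:M /\ A^t* *m A = 1%:M.
Proof. by move=> /unitarymxP h; split=> //; exact: mulmx1C h. Qed.

(** The diagonal entries of A^* A are sums of squared moduli. Many vanishing statements below are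
    reduced by it to a norm computation. *)
Lemma ker_adj m n (A : 'M[C]_(m, n)) : A^t* *m A = 0 -> A = 0.
Proof.
move=> h; apply/matrixP => i j; rewrite mxE.
have /matrixP/(_ j j) := h; rewrite !mxE.
under eq_bigr => k _ do rewrite !mxE mulrC -normCK.
move/eqP; rewrite psumr_eq0 => [/allP /(_ i)|k _]; last exact: exprn_ge0.
by rewrite mem_index_enum /= expf_eq0 /= normr_eq0 => /(_ isT)/eqP.
Qed.

(** Every normal matrix has this form with [P] unitary, and functions act on [d] alone. *)
Definition dconj n (P : 'M[C]_n) (d : 'rV[C]_n) : 'M[C]_n :=
  P^t* *m diag_mx d *m P.

(** The function [h] is arbitrary. With [T] the identity, this says that applying [h] to a normal
    matrix gives a result independent of the diagonalisation. *)
Lemma dconj_intertw m n (P : 'M[C]_n) (Q : 'M[C]_m) (T : 'M[C]_(m, n)) d e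
  (h : C -> C) : P \is unitarymx -> Q \is unitarymx ->
  T *m dconj P d = dconj Q e *m T ->
  T *m dconj P (map_mx h d) = dconj Q (map_mx h e) *m T.
Proof.
move=> /unitaryP[P1 P2] /unitaryP[Q1 Q2] hT.
(* [T] read in the two eigenbases: the hypothesis becomes S_ij d_j = e_i S_ij. *)
pose S := Q *m T *m P^t*.
have hS : S *m diag_mx d = diag_mx e *m S.
  have : Q *m (T *m dconj P d) *m P^t* = Q *m (dconj Q e *m T) *m P^t* by rewrite hT.
  rewrite /dconj !mulmxA Q1 mul1mx -!mulmxA P1 mulmx1 => h1.
  by rewrite /S !mulmxA; rewrite !mulmxA in h1.
have hS' : S *m diag_mx (map_mx h d) = diag_mx (map_mx h e) *m S.
  apply/matrixP => i j; move/matrixP/(_ i j): hS.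
  rewrite !mul_mx_diag !mul_diag_mx ![(\matrix_(_, _) _) _ _]mxE => hij.
  have [->|S0] := eqVneq (S i j) 0; first by rewrite mul0r mulr0.
  rewrite mulrC ![map_mx h _ _ _]mxE; congr (_ * _); congr (h _).
  by apply: (mulfI S0); rewrite hij mulrC.
have TE : T = Q^t* *m S *m P by rewrite /S !mulmxA Q2 mul1mx -mulmxA P2 mulmx1.
clearbody S; rewrite /dconj [in LHS]TE [in RHS]TE.
rewrite !mulmxA -[_ *m P *m P^t*]mulmxA P1 mulmx1 -[_ *m Q *m Q^t*]mulmxA Q1 mulmx1.
by rewrite -[Q^t* *m S *m _]mulmxA hS' !mulmxA.
Qed.

Lemma adj_dconj n (P : 'M[C]_n) d : (dconj P d)^t* = dconj P (map_mx Num.conj d).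
Proof. by rewrite /dconj !ctmxM trmxCK mulmxA tr_diag_mx map_diag_mx. Qed.

Lemma dconjM n (P : 'M[C]_n) d e : P \is unitarymx ->
  dconj P d *m dconj P e = dconj P (\row_j (d 0 j * e 0 j)).
Proof.
move=> /unitaryP[P1 P2]; rewrite /dconj !mulmxA -[_ *m P *m P^t*]mulmxA P1 mulmx1.
rewrite -[P^t* *m _ *m _]mulmxA mulmx_diag.
by congr (_ *m diag_mx _ *m _); apply/rowP => j; rewrite !mxE.
Qed.

Lemma dconj1 n (P : 'M[C]_n) (d : 'rV[C]_n) : P \is unitarymx ->
  (forall j, d 0 j = 1) -> dconj P d = 1%:M.
Proof.
move=> /unitaryP[P1 P2] h; rewrite /dconj (_ : diag_mx d = 1%:M) ?mulmx1 //.
by apply/matrixP => i j; rewrite !mxE h.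
Qed.

Lemma dconjZ n (P : 'M[C]_n) d (t : C) : t *: dconj P d = dconj P (t *: d).
Proof.
rewrite /dconj scalemxAl scalemxAr; congr (_ *m _ *m _).
by apply/matrixP => i j; rewrite !mxE mulrnAr.
Qed.

Lemma diag_mxN n (d : 'rV[C]_n) : diag_mx (- d) = - diag_mx d.
Proof. by apply/matrixP => i j; rewrite !mxE mulNrn. Qed.

Lemma dconjN n (P : 'M[C]_n) d : - dconj P d = dconj P (- d).
Proof. by rewrite -scaleN1r dconjZ scaleN1r. Qed.

Lemma dconj_inj n (P : 'M[C]_n) d e : P \is unitarymx -> dconj P d = dconj P e -> d = e.
Proof.
move=> /unitaryP[P1 P2] h.
have {}h : P *m dconj P d *m P^t* = P *m dconj P e *m P^t* by rewrite h.
move: h; rewrite /dconj !mulmxA P1 !mul1mx -!mulmxA P1 !mulmx1 => h.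
by apply/rowP => j; move/matrixP/(_ j j): h; rewrite !mxE eqxx !mulr1n.
Qed.

Lemma normal_dconj n (P : 'M[C]_n) d : P \is unitarymx -> dconj P d \is normalmx.
Proof.
move=> UP; apply/normalmxP; rewrite adj_dconj !dconjM //; congr dconj.
by apply/rowP => j; rewrite !mxE mulrC.
Qed.

Lemma normal_spec n (X : 'M[C]_n) : X \is normalmx ->
  X = dconj (spectralmx X) (spectral_diag X).
Proof.
by move=> nX; have /orthomx_spectralP := nX; rewrite invmx_unitary ?spectral_unitarymx.
Qed.

Definition skew n (X : 'M[C]_n) := X^t* = - X.

Lemma skew_normal n (X : 'M[C]_n) : skew X -> X \is normalmx.
Proof. by move=> sX; apply/normalmxP; rewrite sX mulmxN mulNmx. Qed.

Lemma skewZ n (X : 'M[C]_n) t : t^* = t -> skew X -> skew (t *: X).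
Proof. by rewrite /skew ctmxZ => -> ->; rewrite scalerN. Qed.

Lemma skewD n (X Y : 'M[C]_n) : skew X -> skew Y -> skew (X + Y).
Proof. by rewrite /skew ctmxD => -> ->; rewrite opprD. Qed.

Lemma skewN n (X : 'M[C]_n) : skew X -> skew (- X).
Proof. by rewrite /skew ctmxN => ->. Qed.

Lemma skew_conj n (g X : 'M[C]_n) : skew X -> skew (g *m X *m g^t*).
Proof. by rewrite /skew !ctmxM trmxCK mulmxA => ->; rewrite mulmxN mulNmx. Qed.

Lemma skew0 n : skew (0 : 'M[C]_n).
Proof. by rewrite /skew ctmx0 oppr0. Qed.

Definition im (x : C) := x^* = - x.

Lemma imZ t x : t^* = t -> im x -> im (t * x).
Proof. by rewrite /im rmorphM /= => -> ->; rewrite mulrN. Qed.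

Lemma imN x : im x -> im (- x).
Proof. by rewrite /im rmorphN /= => ->. Qed.

Lemma im0 : im 0.
Proof. by rewrite /im rmorph0 oppr0. Qed.

Lemma imD x y : im x -> im y -> im (x + y).
Proof. by rewrite /im rmorphD /= => -> ->; rewrite opprD. Qed.

Lemma skew_dconj n (P : 'M[C]_n) (d : 'rV[C]_n) :
  (forall j, im (d 0 j)) -> skew (dconj P d).
Proof.
move=> hd; rewrite /skew adj_dconj dconjN; congr dconj.
by apply/rowP => j; rewrite !mxE hd.
Qed.

Lemma half_real k : ((2 ^- k : C))^* = 2 ^- k.
Proof. by rewrite rmorphV ?unitfE ?expf_neq0 ?pnatr_eq0 // rmorphXn rmorph_nat. Qed.
End Adjoint.

(** * Functional calculus and one-parameter groups *)

Section Exponential.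
Variable C : numClosedFieldType.

(* [e] plays the role of the exponential on the imaginary axis. Only these properties are
   used, which keeps the whole argument over an abstract [numClosedFieldType]; [is_expi_ei]
   is the instance over the complex numbers. *)
Record is_expi (e : C -> C) : Prop := IsExpi {
  expiD : forall x y, im x -> im y -> e (x + y) = e x * e y;
  expi_neq0 : forall x, e x != 0;
  conj_expi : forall x, im x -> (e x)^* = e (- x);
  expi_log : forall z, `|z| = 1 -> exists2 x, im x & e x = z;
  expi_log_pos : forall z, `|z| = 1 -> 0 < 'Re z -> exists x,
    [/\ im x, e x = z & forall k, 0 < 'Re (e (2 ^- k * x))];
  half_cvg : (fun k => 2 ^- k : C) @ \oo --> (0 : C);
  expi_cont : forall (u : nat -> C) (x : C), (forall k, im (u k)) -> im x ->
    u @ \oo --> x -> (fun k => e (u k)) @ \oo --> e x;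
  dyadic_dense : forall t : C, 0 <= t ->
    exists p : nat -> nat, (fun k => 2 ^- k * (p k)%:R) @ \oo --> t;
  expi_lim : forall x, im x ->
    (fun k => 2 ^+ k * (e (2 ^- k * x) - 1)) @ \oo --> x }.

Variables (e : C -> C) (He : is_expi e).

Lemma expi0 : e 0 = 1.
Proof.
have im0 := im0 C.
by have := expiD He im0 im0; rewrite addr0 -[LHS]mulr1 => /(mulfI (expi_neq0 He _)).
Qed.

Lemma expiNK x : im x -> e x * e (- x) = 1.
Proof. by move=> ix; rewrite -expiD ?subrr ?expi0 //; exact: imN. Qed.

Lemma expi_sum (I : Type) (r : seq I) (P : pred I) (F : I -> C) :
  (forall k, im (F k)) ->
  e (\sum_(k <- r | P k) F k) = \prod_(k <- r | P k) e (F k) /\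
  im (\sum_(k <- r | P k) F k).
Proof.
move=> hF; elim: r => [|k r [IH1 IH2]].
  by rewrite !big_nil expi0; split=> //; exact: im0.
rewrite !big_cons; case: (P k) => //; rewrite expiD // IH1; split=> //.
exact: imD.
Qed.

(** Functional calculus on one chosen diagonalisation, meaningful for normal [X]; [expmE] computes
    it on any other diagonalisation. *)
Definition expm n (X : 'M[C]_n) : 'M[C]_n :=
  dconj (spectralmx X) (map_mx e (spectral_diag X)).

(* Read in diagonalising bases, T intertwines X and Y iff each nonzero entry T_ij joins
   equal eigenvalues, a condition that every function of the eigenvalues preserves. *)
Lemma expm_intertw m n (X : 'M[C]_n) (Y : 'M[C]_m) (T : 'M[C]_(m, n)) :
  X \is normalmx -> Y \is normalmx ->
  T *m X = Y *m T -> T *m expm X = expm Y *m T.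
Proof.
move=> nX nY hT; apply: dconj_intertw; rewrite ?spectral_unitarymx //.
by rewrite -!normal_spec.
Qed.

Lemma expmE n (P : 'M[C]_n) d : P \is unitarymx ->
  expm (dconj P d) = dconj P (map_mx e d).
Proof.
move=> UP; set X := dconj _ _.
have nX : X \is normalmx by exact: normal_dconj.
have := @dconj_intertw _ _ _ P (spectralmx X) 1%:M d (spectral_diag X) e UP (spectral_unitarymx X).
by rewrite !mul1mx !mulmx1 -normal_spec // => /(_ erefl) ->.
Qed.

Lemma skew_spec n (X : 'M[C]_n) : skew X -> exists P d,
  [/\ P \is unitarymx, X = dconj P d & forall j, im (d 0 j)].
Proof.
move=> sX; exists (spectralmx X), (spectral_diag X).
have UP := spectral_unitarymx X; have XE := normal_spec (skew_normal sX).
split=> // j.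
have : map_mx Num.conj (spectral_diag X) = - spectral_diag X.
  by apply: (dconj_inj UP); rewrite -adj_dconj -dconjN -XE.
by move/rowP/(_ j); rewrite !mxE.
Qed.

Lemma expm_add n (X : 'M[C]_n) s t : s^* = s -> t^* = t -> skew X ->
  expm ((s + t) *: X) = expm (s *: X) *m expm (t *: X).
Proof.
move=> hs ht /skew_spec[P [d [UP -> hd]]]; rewrite !dconjZ !expmE // dconjM //.
by congr dconj; apply/rowP => j; rewrite !mxE mulrDl (expiD He) //; exact: imZ.
Qed.

Lemma expm0 n : expm (0 : 'M[C]_n) = 1%:M.
Proof.
have U : (1%:M : 'M[C]_n) \is unitarymx by apply/unitarymxP; rewrite ctmx1 mulmx1.
have -> : (0 : 'M[C]_n) = dconj 1%:M 0 by rewrite -[X in dconj _ X](scale0r 0) -dconjZ scale0r.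
by rewrite expmE // dconj1 // => j; rewrite !mxE expi0.
Qed.

Lemma expm_half n (X : 'M[C]_n) k : skew X ->
  expm (2 ^- k *: X) = expm (2 ^- k.+1 *: X) *m expm (2 ^- k.+1 *: X).
Proof.
move=> sX; rewrite -expm_add ?half_real //; congr expm; congr (_ *: _).
by rewrite exprS invfM -mulrDl -[X in X + _]div1r -[X in _ + X]div1r -splitr mul1r.
Qed.

Lemma expm_pow n (X : 'M[C]_n) k : skew X -> expm X = expm (2 ^- k *: X) ^+ (2 ^ k).
Proof.
move=> sX; elim: k => [|k IH]; first by rewrite expr0 invr1 scale1r expr1.
by rewrite IH expm_half // expnS exprM expr2 -mulmxE.
Qed.

Lemma expm_unitary n (X : 'M[C]_n) : skew X -> expm X \is unitarymx.
Proof.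
move=> /skew_spec[P [d [UP -> hd]]]; rewrite expmE //.
apply/unitarymxP; rewrite adj_dconj dconjM // dconj1 // => j.
by rewrite !mxE (conj_expi He) // expiNK.
Qed.

Lemma expm_conj n (g X : 'M[C]_n) : skew X -> g \is unitarymx ->
  g *m expm X *m g^t* = expm (g *m X *m g^t*).
Proof.
move=> sX /unitaryP[g1 g2].
rewrite (@expm_intertw _ _ X (g *m X *m g^t*) g).
- by rewrite -mulmxA g1 mulmx1.
- exact: skew_normal.
- by apply: skew_normal; exact: skew_conj.
- by rewrite -!mulmxA g2 mulmx1.
Qed.

Lemma det_expm n (X : 'M[C]_n) : skew X -> \tr X = 0 -> \det (expm X) = 1.
Proof.
move=> /skew_spec[P [d [UP -> hd]]]; have [U1 U2] := unitaryP UP.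
rewrite expmE // /dconj mxtrace_mulC mulmxA U1 mul1mx mxtrace_diag => tr0.
rewrite !det_mulmx mulrC mulrA -det_mulmx U1 det1 mul1r det_diag.
under eq_bigr do rewrite mxE.
have [<- _] := expi_sum (index_enum _) predT hd.
by rewrite tr0 expi0.
Qed.

Lemma unitary_spec n (U : 'M[C]_n) : U \is unitarymx ->
  exists P d, [/\ P \is unitarymx, U = dconj P d & forall j, `|d 0 j| = 1].
Proof.
move=> UU; have [U1 U2] := unitaryP UU.
have nU : U \is normalmx by apply/normalmxP; rewrite U1 U2.
have := normal_spec nU; have := spectral_unitarymx U.
move: (spectralmx U) (spectral_diag U) => P d UP UE; exists P, d; split=> // j.
have h : \row_j (d 0 j * (map_mx Num.conj d) 0 j) = const_mx 1.
  apply: (dconj_inj UP); rewrite -dconjM // -adj_dconj -UE U1 dconj1 // => k.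
  by rewrite mxE.
move/rowP/(_ j): h; rewrite !mxE -normCK => /eqP.
by rewrite sqrp_eq1 // => /eqP.
Qed.

(** Logarithms of the eigenvalues, chosen one by one, have a sum [s] with e(s) = 1. Subtracting [s]
    from a single logarithm makes the trace zero and leaves the exponential unchanged. *)
Lemma SU_is_expm n (g : 'M[C]_n) : g \is unitarymx -> \det g = 1 ->
  exists X, [/\ skew X, \tr X = 0 & g = expm X].
Proof.
(* The correction is made at index 0, so the empty matrix is treated apart. *)
case: n g => [|n] g.
  move=> _ _; exists 0; split; [exact: skew0|by rewrite mxtrace0|].
  by apply/matrixP => -[].
move=> /unitary_spec[P [z [UP -> hz]]]; have [P1 P2] := unitaryP UP.
rewrite /dconj !det_mulmx mulrC mulrA -det_mulmx P1 det1 mul1r det_diag => dz.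
pose d j := projT1 (cid2 (expi_log He (hz j))).
have [dim dE] : (forall j, im (d j)) /\ forall j, e (d j) = z 0 j.
  by split=> j; rewrite /d; case: (cid2 _).
have [hs1 hs2] := expi_sum (index_enum _) predT dim.
set s := \sum_(k <- _ | _) _ in hs1 hs2.
have es : e s = 1.
  by rewrite /s hs1 -[RHS]dz; apply: eq_bigr => j _; rewrite dE.
pose d' := \row_j d j - s *: delta_mx 0 0 : 'rV[C]_n.+1.
have hd' j : im (d' 0 j).
  rewrite !mxE; apply: imD => //; apply: imN.
  by rewrite eqxx /=; case: (j == 0); rewrite ?mulr1 ?mulr0 //; exact: im0.
exists (dconj P d'); split; first exact: skew_dconj.
  rewrite /dconj mxtrace_mulC mulmxA P1 mul1mx mxtrace_diag.
  under eq_bigr do rewrite !mxE; rewrite big_split /= sumrN -mulr_sumr.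
  suff -> : \sum_(k < n.+1) ((0 == 0 :> 'I_1) && (k == 0))%:R = 1 :> C.
    by rewrite mulr1 subrr.
  by rewrite (bigD1 ord0) //= big1 ?addr0 // => k /negbTE ->.
rewrite expmE //; congr dconj; apply/rowP => j; rewrite !mxE -dE.
rewrite eqxx /=; case: (j == 0); rewrite ?mulr0 ?subr0 // mulr1 (expiD He) //; last exact: imN.
have := expiNK hs2; rewrite es mul1r => ->; by rewrite mulr1.
Qed.

End Exponential.

(** * Entrywise limits and powers of unitary matrices *)

Section Limits.
Variable C : numClosedFieldType.

(** Entrywise convergence; the link with the topology on matrices is made in [mcv_cvg] and
    [within_mcv]. *)
Variant mcv m n (A : nat -> 'M[C]_(m, n)) (L : 'M[C]_(m, n)) : Prop :=
  Mcv of forall i j, (fun k => A k i j) @ \oo --> L i j.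

Lemma mcv_ext m n (A B : nat -> 'M[C]_(m, n)) L : A =1 B -> mcv A L -> mcv B L.
Proof. by move=> /funext ->. Qed.

Lemma mcv_cst m n (L : 'M[C]_(m, n)) : mcv (fun=> L) L.
Proof. by split=> i j; exact: cvg_cst. Qed.

Lemma mcvD m n (A B : nat -> 'M[C]_(m, n)) L M :
  mcv A L -> mcv B M -> mcv (fun k => A k + B k) (L + M).
Proof.
move=> [hA] [hB]; split=> i j; under eq_fun do rewrite mxE; rewrite mxE.
by apply: cvgD; [exact: hA|exact: hB].
Qed.

Lemma mcvZ m n (u : nat -> C) (A : nat -> 'M[C]_(m, n)) (a : C) L :
  u @ \oo --> a -> mcv A L -> mcv (fun k => u k *: A k) (a *: L).
Proof.
move=> hu [hA]; split=> i j; under eq_fun do rewrite mxE; rewrite mxE.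
by apply: cvgM => //; exact: hA.
Qed.

Lemma mcvN m n (A : nat -> 'M[C]_(m, n)) L : mcv A L -> mcv (fun k => - A k) (- L).
Proof.
move=> [hA]; split=> i j; under eq_fun do rewrite mxE; rewrite mxE.
by apply: cvgN; exact: hA.
Qed.

Lemma cvg_bigsum (I : Type) (r : seq I) (F : I -> nat -> C) (l : I -> C) :
  (forall i, F i @ \oo --> l i) ->
  (fun k => \sum_(i <- r) F i k) @ \oo --> \sum_(i <- r) l i.
Proof.
move=> h; elim: r => [|i r IH].
  by under eq_fun do rewrite big_nil; rewrite big_nil; exact: cvg_cst.
by under eq_fun do rewrite big_cons; rewrite big_cons; exact: cvgD.
Qed.

Lemma cvg_bigprod (I : Type) (r : seq I) (F : I -> nat -> C) (l : I -> C) :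
  (forall i, F i @ \oo --> l i) ->
  (fun k => \prod_(i <- r) F i k) @ \oo --> \prod_(i <- r) l i.
Proof.
move=> h; elim: r => [|i r IH].
  by under eq_fun do rewrite big_nil; rewrite big_nil; exact: cvg_cst.
by under eq_fun do rewrite big_cons; rewrite big_cons; exact: cvgM.
Qed.

Lemma mcvM m n p (A : nat -> 'M[C]_(m, n)) (B : nat -> 'M[C]_(n, p)) L M :
  mcv A L -> mcv B M -> mcv (fun k => A k *m B k) (L *m M).
Proof.
move=> [hA] [hB]; split=> i j; under eq_fun do rewrite mxE; rewrite mxE.
by apply: cvg_bigsum => k; apply: cvgM; [exact: hA|exact: hB].
Qed.

Lemma mcv_uniq m n (A : nat -> 'M[C]_(m, n)) L M : mcv A L -> mcv A M -> L = M.
Proof.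
move=> [hL] [hM]; apply/matrixP => i j.
exact: norm_cvg_unique (hL i j) (hM i j).
Qed.

Lemma cvg_conj (u : nat -> C) (a : C) : u @ \oo --> a -> (fun k => (u k)^*) @ \oo --> a^*.
Proof.
move=> /cvgrPdist_lt h; apply/cvgrPdist_lt => eps e0; near=> k.
rewrite -rmorphB norm_conjC; near: k; exact: h.
Unshelve. all: by end_near.
Qed.

Lemma mcv_adj m n (A : nat -> 'M[C]_(m, n)) L : mcv A L -> mcv (fun k => (A k)^t*) (L^t*).
Proof.
move=> [hA]; split=> i j; under eq_fun do rewrite !mxE; rewrite !mxE.
by apply: cvg_conj; exact: hA.
Qed.

Lemma unitary_bound n (U : 'M[C]_n) i j : U \is unitarymx -> `|U i j| <= 1.
Proof.
move=> /unitarymxP/matrixP/(_ i i); rewrite !mxE eqxx mulr1n => h.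
rewrite -(@expr_le1 _ 2) // -h (bigD1 j) //= !mxE -normCK lerDl.
by apply: sumr_ge0 => k _; rewrite !mxE -normCK exprn_ge0.
Qed.

Lemma cvg_norm0 (u : nat -> C) : u @ \oo --> (0 : C) -> (fun k => `|u k|) @ \oo --> (0 : C).
Proof.
move=> /cvgrPdist_lt h; apply/cvgrPdist_lt => eps e0; near=> k.
rewrite sub0r normrN normr_id -normrN -sub0r; near: k; exact: h.
Unshelve. all: by end_near.
Qed.

Definition abs_sum m n (B : 'M[C]_(m, n)) : C := \sum_i \sum_j `|B i j|.

Lemma abs_sum_ge0 m n (B : 'M[C]_(m, n)) : 0 <= abs_sum B.
Proof. by apply: sumr_ge0 => i _; apply: sumr_ge0. Qed.

Lemma sandwich_bound n (A B D : 'M[C]_n) i j : A \is unitarymx -> D \is unitarymx ->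
  `|(A *m B *m D) i j| <= abs_sum B.
Proof.
move=> UA UD; rewrite mxE; apply: le_trans (ler_norm_sum _ _ _) _.
under eq_bigr do rewrite normrM.
apply: (@le_trans _ _ (\sum_l \sum_k `|B k l|)); last by rewrite exchange_big.
apply: ler_sum => l _; rewrite -[leRHS]mulr1; apply: ler_pM => //; last exact: unitary_bound.
rewrite mxE; apply: le_trans (ler_norm_sum _ _ _) _; apply: ler_sum => k _.
rewrite normrM -[leRHS]mul1r; apply: ler_pM => //; exact: unitary_bound.
Qed.

Lemma unitary_expr n (U : 'M[C]_n) k : U \is unitarymx -> U ^+ k \is unitarymx.
Proof.
move=> hU; elim: k => [|k IH].
  by rewrite expr0; apply/unitarymxP; rewrite ctmx1 mulmx1.
by rewrite exprS -mulmxE mul_unitarymx.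
Qed.

Lemma unitary1 n : (1%:M : 'M[C]_n) \is unitarymx.
Proof. by apply/unitarymxP; rewrite ctmx1 mulmx1. Qed.

(** Telescoping: U^(N+1) - V^(N+1) = U^N (U - V) + (U^N - V^N) V. The unitary factor [D] is there to
    absorb the last [V] in the induction, and unitary factors do not enlarge the bound [abs_sum]. *)
Lemma pow_diff_bound n (U V : 'M[C]_n) N (D : 'M[C]_n) i j :
  U \is unitarymx -> V \is unitarymx -> D \is unitarymx ->
  `|((U ^+ N - V ^+ N) *m D) i j| <= N%:R * abs_sum (U - V).
Proof.
move=> hU hV; elim: N D => [|N IH] D hD.
  by rewrite !expr0 subrr mul0mx mxE normr0 mul0r.
have -> : (U ^+ N.+1 - V ^+ N.+1) *m D =
   U ^+ N *m (U - V) *m D + (U ^+ N - V ^+ N) *m (V *m D).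
  rewrite !exprSr -!mulmxE mulmxBr !mulmxBl !mulmxA addrA subrK //.
rewrite mxE -[N.+1]addn1 natrD mulrDl mul1r addrC.
apply: le_trans (ler_normD _ _) _; apply: lerD.
  by apply: IH; rewrite mul_unitarymx.
by apply: sandwich_bound => //; exact: unitary_expr.
Qed.

(** Taking 2^k-th powers multiplies the one-step error by at most 2^k, so an error that is o(2^-k)
    disappears in the limit. *)
Lemma trotter n (U V : nat -> 'M[C]_n) :
  (forall k, U k \is unitarymx) -> (forall k, V k \is unitarymx) ->
  mcv (fun k => 2 ^+ k *: (U k - V k)) 0 ->
  mcv (fun k => U k ^+ (2 ^ k) - V k ^+ (2 ^ k)) 0.
Proof.
move=> hU hV [h]; split=> i j.
have h0 : (fun k => (2 ^ k)%:R * abs_sum (U k - V k)) @ \oo --> (0 : C).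
  have -> : (fun k => (2 ^ k)%:R * abs_sum (U k - V k)) =
     (fun k => \sum_i \sum_j `|(2 ^+ k *: (U k - V k)) i j|).
    apply/funext => k; rewrite /abs_sum mulr_sumr; apply: eq_bigr => a _.
    rewrite mulr_sumr; apply: eq_bigr => b _.
    by rewrite [in RHS]mxE normrM normrX normr_nat natrX.
  have E : \sum_(i < n) \sum_(j < n) (0 : C) = 0 by rewrite big1 // => a _; rewrite big1.
  rewrite -[X in _ --> X]E; apply: cvg_bigsum => a; apply: cvg_bigsum => b.
  have h0 : (0 : 'M[C]_n) a b = 0 by rewrite mxE.
  by apply: cvg_norm0; have := h a b; rewrite h0.
rewrite mxE; apply/cvgrPdist_lt => eps e0.
move/cvgrPdist_lt: h0 => /(_ eps e0) h0; near=> k.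
have : `|0 - (2 ^ k)%:R * abs_sum (U k - V k)| < eps by near: k; exact: h0.
rewrite !sub0r !normrN => hk; apply: le_lt_trans hk.
have := pow_diff_bound (2 ^ k) i j (hU k) (hV k) (unitary1 n).
rewrite mulmx1 => /le_trans; apply.
by rewrite ger0_norm // mulr_ge0 // abs_sum_ge0.
Unshelve. all: by end_near.
Qed.

End Limits.

(** * Generators of one-parameter groups *)

Section OneParameter.
Variables (C : numClosedFieldType) (e : C -> C) (He : is_expi e).
Notation expm := (expm e).

(** The derivative at 0 of the one-parameter group of [X], taken along the times 2^-k and computed
    on the eigenvalues by [expi_lim]. *)
Lemma expm_lim n (X : 'M[C]_n) : skew X ->
  mcv (fun k => 2 ^+ k *: (expm (2 ^- k *: X) - 1%:M)) X.
Proof.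
move=> /skew_spec[P [d [UP XE hd]]].
have h : (fun k => 2 ^+ k *: (expm (2 ^- k *: X) - 1%:M)) =
   (fun k => P^t* *m diag_mx (\row_j (2 ^+ k * (e (2 ^- k * d 0 j) - 1))) *m P).
  apply/funext => k; rewrite XE dconjZ expmE //.
  have <- : dconj P (const_mx 1) = 1%:M by rewrite dconj1 // => j; rewrite mxE.
  rewrite dconjN /dconj -mulmxDl -mulmxDr scalemxAl scalemxAr; congr (_ *m _ *m _).
  apply/matrixP => i j; rewrite !mxE; case: eqP => _; rewrite ?mulr1n //.
  by rewrite !mulr0n addr0 mulr0.
rewrite h [X in mcv _ X]XE; apply: mcvM; last exact: mcv_cst.
apply: mcvM; first exact: mcv_cst.
split=> i j; under eq_fun do rewrite !mxE; rewrite mxE.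
case: eqP => [->|_] /=; last by under eq_fun do rewrite mulr0n; exact: cvg_cst.
by under eq_fun do rewrite mulr1n; exact: (expi_lim He (hd j)).
Qed.

Lemma expm_lim1 n (X : 'M[C]_n) : skew X -> mcv (fun k => expm (2 ^- k *: X)) 1%:M.
Proof.
move=> sX; have h := mcvD (mcvZ (half_cvg He) (expm_lim sX)) (mcv_cst 1%:M).
rewrite scale0r add0r in h; apply: mcv_ext h => k.
by rewrite scalerA mulVf ?scale1r ?subrK // expf_neq0 // pnatr_eq0.
Qed.

Lemma skew_half n (X : 'M[C]_n) k : skew X -> skew (2 ^- k *: X).
Proof. by apply: skewZ; exact: half_real. Qed.

(** The converse of [expm_intertw]: the relation at the times 2^-k passes to the derivatives at
    0. *)
Lemma expm_intertw_inv m n (X : 'M[C]_n) (Y : 'M[C]_m) (T : 'M[C]_(m, n)) :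
  skew X -> skew Y ->
  (forall k, T *m expm (2 ^- k *: X) = expm (2 ^- k *: Y) *m T) -> T *m X = Y *m T.
Proof.
move=> sX sY h.
have h1 := mcvM (mcv_cst T) (expm_lim sX).
have h2 := mcvM (expm_lim sY) (mcv_cst T).
apply: mcv_uniq h1 _; apply: mcv_ext h2 => k.
by rewrite -scalemxAl -scalemxAr mulmxBr mulmxBl mulmx1 mul1mx h.
Qed.

Lemma expm_inj n (X Y : 'M[C]_n) : skew X -> skew Y ->
  (forall k, expm (2 ^- k *: X) = expm (2 ^- k *: Y)) -> X = Y.
Proof.
move=> sX sY h; have := @expm_intertw_inv _ _ X Y 1%:M sX sY.
by rewrite mul1mx mulmx1; apply => k; rewrite mul1mx mulmx1.
Qed.

(** The Lie-Trotter product formula: the two products below differ by o(2^-k) in one step, and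
    [trotter] applies. *)
Lemma expm_sum n (X Y : 'M[C]_n) : skew X -> skew Y ->
  mcv (fun k => (expm (2 ^- k *: X) *m expm (2 ^- k *: Y)) ^+ (2 ^ k)) (expm (X + Y)).
Proof.
move=> sX sY; have sXY := skewD sX sY.
have U (Z : 'M[C]_n) k : skew Z -> expm (2 ^- k *: Z) \is unitarymx.
  by move=> sZ; apply: expm_unitary => //; exact: skew_half.
have UXY k : expm (2 ^- k *: X) *m expm (2 ^- k *: Y) \is unitarymx.
  by rewrite mul_unitarymx ?U.
have h := trotter UXY (fun k => U _ k sXY).
have {}h : mcv (fun k => (expm (2 ^- k *: X) *m expm (2 ^- k *: Y)) ^+ (2 ^ k)
   - expm (2 ^- k *: (X + Y)) ^+ (2 ^ k)) 0.
  apply: h.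
  (* With U, V, W the exponentials of X, Y, X + Y at time 2^-k, UV - W = (U - 1) V + (V - 1) - (W -
     1), and 2^k times this tends to X + Y - (X + Y). *)
  have := mcvD (mcvD (mcvM (expm_lim sX) (expm_lim1 sY)) (expm_lim sY)) (mcvN (expm_lim sXY)).
  rewrite mulmx1 subrr; apply: mcv_ext => k.
  rewrite -scalemxAl -!scalerN -!scalerDr mulmxBl mul1mx; congr (_ *: _).
  by rewrite addrA subrK opprB addrA subrK.
have := mcvD h (mcv_cst (expm (X + Y))); rewrite add0r; apply: mcv_ext => k.
by rewrite -expm_pow // subrK.
Qed.

(** d_j - 1 is a diagonal entry of P (U - 1) P^* for U = [dconj P d], so |d_j - 1| < 1; on the unit
    circle |z - 1|^2 = 2 - 2 Re z, whence Re d_j > 1/2. *)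
Lemma near1_pos n (P : 'M[C]_n) (d : 'rV[C]_n) j : P \is unitarymx -> `|d 0 j| = 1 ->
  abs_sum (dconj P d - 1%:M) < 1 -> 0 < 'Re (d 0 j).
Proof.
move=> UP d1 h; have [P1 P2] := unitaryP UP.
have hd : `|d 0 j - 1| < 1.
  apply: le_lt_trans h.
  have -> : d 0 j - 1 = (P *m (dconj P d - 1%:M) *m P^t*) j j.
    rewrite mulmxBr mulmxBl mulmx1 P1 /dconj !mulmxA P1 mul1mx -mulmxA P1 mulmx1.
    by rewrite !mxE eqxx !mulr1n.
  by apply: sandwich_bound; rewrite ?trmxC_unitary.
have : `|d 0 j - 1| ^+ 2 < 1 by rewrite expr_lt1.
rewrite normCK rmorphB rmorph1 mulrBr !mulrBl mul1r mulr1 -normCK d1 expr1n => h2.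
have h3 : d 0 j + (d 0 j)^* = 'Re (d 0 j) *+ 2.
  by rewrite [in LHS](Crect (d 0 j)) rmorphD rmorphM /= conjCi !(conj_Creal (Creal_Re _)) !(conj_Creal (Creal_Im _)) mulNr addrACA subrr addr0 mulr2n.
have h4 : 1 < 'Re (d 0 j) *+ 2.
  rewrite -h3 -subr_gt0; move: h2; rewrite -subr_gt0; congr (0 < _); ring.
by rewrite -(pmulrn_lgt0 _ (ltn0Sn 1)) (lt_trans ltr01).
Qed.

(** Squaring is injective on the open right half plane. Its inverse there is a function, to which
    the functional calculus of [dconj_intertw] applies with [T] the identity. *)
Lemma sqrt_uniq n (P Q : 'M[C]_n) (a b : 'rV[C]_n) : P \is unitarymx -> Q \is unitarymx ->
  (forall j, 0 < 'Re (a 0 j)) -> (forall j, 0 < 'Re (b 0 j)) ->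
  dconj P a *m dconj P a = dconj Q b *m dconj Q b -> dconj P a = dconj Q b.
Proof.
move=> UP UQ ha hb; rewrite !dconjM // => h.
(* The square root with positive real part, with default value 0 where there is none. *)
pose s (w : C) := xget 0 [set z | z ^+ 2 = w /\ 0 < 'Re z].
have hs z : 0 < 'Re z -> s (z * z) = z.
  move=> hz; rewrite /s; case: xgetP => [y _ [/eqP + hy]|/(_ z)[]]; last by split.
  rewrite -[z * z]expr2 eqf_sqr => /orP[/eqP //|/eqP yE].
  by move: hy; rewrite yE raddfN oppr_gt0 => /(lt_trans hz); rewrite ltxx.
have := @dconj_intertw _ _ _ P Q 1%:M _ _ s UP UQ.
move=> /(_ (\row_j (a 0 j * a 0 j)) (\row_j (b 0 j * b 0 j))).
rewrite !mul1mx !mulmx1 => /(_ h).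
have E (c : 'rV[C]_n) : (forall j, 0 < 'Re (c 0 j)) -> map_mx s (\row_j (c 0 j * c 0 j)) = c.
  by move=> hc; apply/rowP => j; rewrite !mxE hs.
by rewrite !E.
Qed.

(* Near 1 a unitary matrix has spectrum in the right half plane and only one square root
   with that property, so the logarithm of one [A k] determines all the later ones. *)
Lemma generator_exists n (A : nat -> 'M[C]_n) : (forall k, A k \is unitarymx) ->
  (forall k, A k = A k.+1 *m A k.+1) -> mcv A 1%:M ->
  exists2 Y, skew Y & forall k, A k = expm (2 ^- k *: Y).
Proof.
move=> UA AA A1.
have [k0 hk0] : exists k0, forall k, (k0 <= k)%N -> abs_sum (A k - 1%:M) < 1.
  have : (fun k => abs_sum (A k - 1%:M)) @ \oo --> (0 : C).
    have E : \sum_(i < n) \sum_(j < n) (0 : C) = 0 by rewrite big1 // => a _; rewrite big1.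
    rewrite -[X in _ --> X]E; apply: cvg_bigsum => a; apply: cvg_bigsum => b.
    have [h] := mcvD A1 (mcv_cst (- 1%:M)).
    have h0 : (1%:M - 1%:M : 'M[C]_n) a b = 0 by rewrite subrr mxE.
    by apply: cvg_norm0; have := h a b; rewrite h0.
  move=> /cvgrPdist_lt/(_ 1 ltr01)[k0 _ hk0]; exists k0 => k hk.
  have := hk0 k hk; rewrite /= sub0r normrN; apply: le_lt_trans.
  by rewrite ger0_norm // abs_sum_ge0.
have spec k : (k0 <= k)%N -> exists P a, [/\ P \is unitarymx, A k = dconj P a,
    forall j, `|a 0 j| = 1 & forall j, 0 < 'Re (a 0 j)].
  move=> hk; have [P [a [UP AE ha]]] := unitary_spec (UA k).
  by exists P, a; split=> // j; apply: (near1_pos UP) => //; rewrite -AE hk0.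
have [P [a [UP AE ha hpos]]] := spec k0 (leqnn _).
(* These logarithms keep their exponentials in the right half plane under all halvings, as
   [sqrt_uniq] requires at every later scale. *)
pose x j := projT1 (cid (expi_log_pos He (ha j) (hpos j))).
have hx j : [/\ im (x j), e (x j) = a 0 j & forall k, 0 < 'Re (e (2 ^- k * x j))].
  by rewrite /x; case: (cid _).
pose Z := dconj P (\row_j x j).
have sZ : skew Z by apply: skew_dconj => j; rewrite mxE; have [] := hx j.
have hZ k : expm (2 ^- k *: Z) = dconj P (\row_j e (2 ^- k * x j)).
  by rewrite dconjZ expmE //; congr dconj; apply/rowP => j; rewrite !mxE.
have h1 k : A (k0 + k)%N = expm (2 ^- k *: Z).
  elim: k => [|k IH].
    rewrite addn0 AE hZ; congr dconj; apply/rowP => j; rewrite mxE expr0 invr1 mul1r.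
    by have [_ ->] := hx j.
  have [Q [b [UQ BE hb hbpos]]] := spec (k0 + k.+1)%N (leq_addr _ _).
  rewrite hZ BE; apply: sqrt_uniq => //.
    by move=> j; rewrite mxE; have [] := hx j.
  by rewrite -BE addnS -AA IH -hZ -expm_half.
(* [Z] is a logarithm of [A k0], which is the value at time 2^-k0. *)
exists (2 ^+ k0 *: Z).
  by apply: skewZ sZ; rewrite rmorphXn rmorph_nat.
have h2 k : (k0 <= k)%N -> A k = expm (2 ^- k *: (2 ^+ k0 *: Z)).
  move=> hk; have E : 2 ^- k * 2 ^+ k0 = 2 ^- (k - k0) :> C.
    have h2 : 2 ^+ k0 != 0 :> C by rewrite expf_neq0 // pnatr_eq0.
    by rewrite -{1}(subnKC hk) exprD invfM mulrC mulrA (mulfV h2) mul1r.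
  by rewrite scalerA E -h1 subnKC.
have sY : skew (2 ^+ k0 *: Z) by apply: skewZ sZ; rewrite rmorphXn rmorph_nat.
(* The finitely many indices before [k0] are recovered by squaring, going downwards. *)
suff h3 l k : (k0 <= k + l)%N -> A k = expm (2 ^- k *: (2 ^+ k0 *: Z)).
  by move=> k; apply: (h3 k0); rewrite leq_addl.
elim: l k => [|l IH] k; first by rewrite addn0; exact: h2.
by rewrite addnS -addSn => /IH hk; rewrite AA hk -expm_half.
Qed.

End OneParameter.

(** * Infinitesimal representations *)

Opaque expm.

Section Rep.
Variables (C : numClosedFieldType) (e : C -> C) (He : is_expi e).
Notation expm := (expm e).
Variable n : nat.

(** Continuity is sequential and along [H]. The record is derived from [unitary_rep] in [urep_SU]
    and [urep_SU2Um]. *)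
Record urep (H : 'M[C]_n.+1 -> Prop) N (p : 'M[C]_n.+1 -> 'M[C]_N) : Prop := UnitaryRep {
  ur1 : p 1%:M = 1%:M;
  urM : forall g h, H g -> H h -> p (g *m h) = p g *m p h;
  urU : forall g, H g -> p g \is unitarymx;
  urC : forall (g : nat -> 'M[C]_n.+1) h, (forall k, H (g k)) -> H h ->
    mcv g h -> mcv (fun k => p (g k)) (p h) }.

Definition inSU (g : 'M[C]_n.+1) : Prop := g \is unitarymx /\ \det g = 1.

Lemma inSU1 : inSU 1%:M.
Proof. by split; rewrite ?det1 // unitary1. Qed.

Lemma inSUM g h : inSU g -> inSU h -> inSU (g *m h).
Proof. by move=> [g1 g2] [h1 h2]; split; rewrite ?mul_unitarymx // det_mulmx g2 h2 mulr1. Qed.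

Lemma inSUct g : inSU g -> inSU (g^t*).
Proof.
by move=> [g1 g2]; split; rewrite ?trmxC_unitary // det_map_mx det_tr g2 rmorph1.
Qed.

Lemma inSUX g k : inSU g -> inSU (g ^+ k).
Proof.
move=> hg; elim: k => [|k IH]; first by rewrite expr0; exact: inSU1.
by rewrite exprS; exact: inSUM.
Qed.

Definition su (X : 'M[C]_n.+1) : Prop := skew X /\ \tr X = 0.

Lemma suZ X t : t^* = t -> su X -> su (t *: X).
Proof. by move=> ht [h1 h2]; split; [exact: skewZ|rewrite mxtraceZ h2 mulr0]. Qed.

Lemma suD X Y : su X -> su Y -> su (X + Y).
Proof. by move=> [h1 h2] [h3 h4]; split; [exact: skewD|rewrite mxtraceD h2 h4 addr0]. Qed.

Lemma suN X : su X -> su (- X).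
Proof. by move=> [h1 h2]; split; [exact: skewN|rewrite raddfN /= h2 oppr0]. Qed.

Lemma su_conj g X : inSU g -> su X -> su (g *m X *m g^t*).
Proof.
move=> [/unitaryP[_ g1] _] [h1 h2]; split; first exact: skew_conj.
by rewrite mxtrace_mulC mulmxA g1 mul1mx.
Qed.

Lemma su_exp X : su X -> inSU (expm X).
Proof. by move=> [h1 h2]; split; [exact: expm_unitary|exact: det_expm]. Qed.

Lemma su_half X k : su X -> su (2 ^- k *: X).
Proof. by apply: suZ; exact: half_real. Qed.

Section Gen.
Variables (N : nat) (p : 'M[C]_n.+1 -> 'M[C]_N).

(** The values of [p] at the times 2^-k are unitary, successive square roots of each other, and tend
    to 1, which is the situation of [generator_exists]. *)
Lemma rep_gen H X : urep H p -> H 1%:M -> skew X -> (forall k, H (expm (2 ^- k *: X))) ->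
  exists2 Y, skew Y & forall k, p (expm (2 ^- k *: X)) = expm (2 ^- k *: Y).
Proof.
move=> hp H1 sX hX; apply: (generator_exists He).
- by move=> k; apply: (urU hp).
- by move=> k; rewrite (expm_half He) // (urM hp).
- by rewrite -(ur1 hp); apply: (urC hp) => //; exact: expm_lim1.
Qed.

Hypothesis hp : urep inSU p.

(* Junk value 0 outside su. *)
Definition dpi X : 'M[C]_N :=
  xget 0 [set Y | skew Y /\ forall k, p (expm (2 ^- k *: X)) = expm (2 ^- k *: Y)].

Lemma dpiP X : su X ->
  skew (dpi X) /\ forall k, p (expm (2 ^- k *: X)) = expm (2 ^- k *: dpi X).
Proof.
move=> hX; have [h1 _] := hX.
have [|Y sY hY] := rep_gen hp inSU1 h1.
  by move=> k; apply: su_exp; exact: su_half.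
by rewrite /dpi; case: xgetP => [Z _ //|/(_ Y)[]].
Qed.

Lemma dpi_uniq X Y : su X -> skew Y ->
  (forall k, p (expm (2 ^- k *: X)) = expm (2 ^- k *: Y)) -> dpi X = Y.
Proof.
move=> /dpiP[h1 h2] sY hY; apply: (expm_inj He) => // k.
by rewrite -h2 hY.
Qed.

Lemma skew_dpi X : su X -> skew (dpi X).
Proof. by case/dpiP. Qed.

Lemma pexp X : su X -> p (expm X) = expm (dpi X).
Proof. by case/dpiP => _ /(_ 0%N); rewrite expr0 invr1 !scale1r. Qed.

Lemma halfD k l : 2 ^- k * 2 ^- l = 2 ^- (l + k) :> C.
Proof. by rewrite exprD invfM mulrC. Qed.

Lemma dpi_half X k : su X -> dpi (2 ^- k *: X) = 2 ^- k *: dpi X.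
Proof.
move=> hX; have [h1 h2] := dpiP hX; apply: dpi_uniq; first exact: su_half.
  exact: skew_half.
by move=> l; rewrite !scalerA halfD h2.
Qed.

Lemma repX g k : inSU g -> p (g ^+ k) = p g ^+ k.
Proof.
move=> hg; elim: k => [|k IH]; first by rewrite !expr0 (ur1 hp).
by rewrite !exprS (urM hp) ?IH //; exact: inSUX.
Qed.

(** Continuity of [p] carries the product formula [expm_sum] in the group to the same formula
    between the generators. *)
Lemma pexpD X Y : su X -> su Y -> p (expm (X + Y)) = expm (dpi X + dpi Y).
Proof.
move=> hX hY; have [sX dX] := dpiP hX; have [sY dY] := dpiP hY.
have [sX' _] := hX; have [sY' _] := hY.
apply: mcv_uniq (expm_sum He sX sY).
have hg k : inSU (expm (2 ^- k *: X) *m expm (2 ^- k *: Y)).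
  by apply: inSUM; apply: su_exp; exact: su_half.
have := urC hp (fun k => inSUX (2 ^ k) (hg k)) (su_exp (suD hX hY)) (expm_sum He sX' sY').
apply: mcv_ext => k; rewrite (repX _ (hg k)); congr (_ ^+ _).
by rewrite (urM hp (su_exp (su_half k hX)) (su_exp (su_half k hY))) dX dY.
Qed.

Lemma dpiD X Y : su X -> su Y -> dpi (X + Y) = dpi X + dpi Y.
Proof.
move=> hX hY; apply: dpi_uniq; first exact: suD.
  by apply: skewD; exact: skew_dpi.
by move=> k; rewrite !scalerDr pexpD ?dpi_half //; exact: su_half.
Qed.

Lemma su0 : su 0.
Proof. by split; [exact: skew0|rewrite mxtrace0]. Qed.

Lemma dpi0 : dpi 0 = 0.
Proof. by apply: (addrI (dpi 0)); rewrite -dpiD ?addr0 //; exact: su0. Qed.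

Lemma dpiN X : su X -> dpi (- X) = - dpi X.
Proof.
move=> hX; have := dpiD hX (suN hX); rewrite subrr dpi0.
by move/eqP; rewrite eq_sym addrC addr_eq0 => /eqP.
Qed.

Lemma expm_cont N' (X : 'M[C]_N') (u : nat -> C) (t : C) : skew X -> (forall k, (u k)^* = u k) ->
  t^* = t -> u @ \oo --> t -> mcv (fun k => expm (u k *: X)) (expm (t *: X)).
Proof.
move=> /skew_spec[P [d [UP XE hd]]] hu ht h.
rewrite XE dconjZ expmE // /dconj.
have E k : expm (u k *: dconj P d) = P^t* *m diag_mx (map_mx e (u k *: d)) *m P.
  by rewrite dconjZ expmE.
apply: (@mcv_ext _ _ _ (fun k => P^t* *m diag_mx (map_mx e (u k *: d)) *m P)).
  by move=> k; rewrite E.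
apply: mcvM; last exact: mcv_cst.
apply: mcvM; first exact: mcv_cst.
split=> i j; under eq_fun do rewrite !mxE; rewrite !mxE.
case: eqP => [->|_] /=; last by under eq_fun do rewrite mulr0n; exact: cvg_cst.
under eq_fun do rewrite mulr1n; rewrite mulr1n; apply: (expi_cont He).
- by move=> k; apply: imZ.
- exact: imZ.
- by apply: cvgM => //; exact: cvg_cst.
Qed.

Lemma dyad_real k q : (2 ^- k * q%:R : C)^* = 2 ^- k * q%:R.
Proof. by rewrite rmorphM /= half_real rmorph_nat. Qed.

Lemma expm_nat N' (X : 'M[C]_N') q : skew X -> expm (q%:R *: X) = expm X ^+ q.
Proof.
move=> sX; elim: q => [|q IH]; first by rewrite scale0r expr0 (expm0 He).
by rewrite -addn1 natrD (expm_add He) ?rmorph_nat // scale1r IH addn1 exprSr.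
Qed.

(** A dyadic multiple is a power of a repeated square root, for which the claim is multiplicativity;
    a general [t] is a limit of dyadic numbers, and [p] is continuous. *)
Lemma dpiZ_ge0 X t : su X -> 0 <= t -> dpi (t *: X) = t *: dpi X.
Proof.
move=> hX t0; have ht : t^* = t by apply: conj_Creal; exact: ger0_real.
have sX := skew_dpi hX; have [sX' _] := hX.
have main s : 0 <= s -> p (expm (s *: X)) = expm (s *: dpi X).
  move=> s0; have hs : s^* = s by apply: conj_Creal; exact: ger0_real.
  have [q hq] := dyadic_dense He s0.
  apply: mcv_uniq (expm_cont sX (fun k => dyad_real k (q k)) hs hq).
  have hg k : inSU (expm ((2 ^- k * (q k)%:R) *: X)).
    by apply: su_exp; apply: suZ hX; exact: dyad_real.
  have := urC hp hg (su_exp (suZ hs hX)) (expm_cont sX' (fun k => dyad_real k (q k)) hs hq).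
  apply: mcv_ext => k; rewrite -!scalerA scalerA mulrC -scalerA.
  rewrite expm_nat; last exact: skew_half.
  rewrite repX; last by apply: su_exp; exact: su_half.
  by rewrite scalerA mulrC -scalerA expm_nat ?(dpiP hX).2 //; exact: skew_half.
apply: dpi_uniq; [exact: suZ|exact: skewZ|].
move=> k; rewrite !scalerA main // mulr_ge0 // invr_ge0 exprn_ge0 //.
Qed.

Lemma dpiZ X t : su X -> t^* = t -> dpi (t *: X) = t *: dpi X.
Proof.
move=> hX ht; have /orP[t0|t0] : t \is Num.real by rewrite CrealE ht.
  exact: dpiZ_ge0.
have := @dpiZ_ge0 X (- t) hX; rewrite oppr_ge0 => /(_ t0).
by rewrite !scaleNr dpiN; [move/oppr_inj|exact: suZ].
Qed.

Lemma rep_ct g : inSU g -> p (g^t*) = (p g)^t*.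
Proof.
move=> hg; have [_ h1] := unitaryP (urU hp hg); have [Ug _] := hg.
have [h2 _] := unitaryP Ug.
have h3 : p g *m p (g^t*) = 1%:M by rewrite -(urM hp) ?h2 ?(ur1 hp) //; exact: inSUct.
by rewrite -[LHS]mul1mx -h1 -mulmxA h3 mulmx1.
Qed.

Lemma dpi_conj g X : inSU g -> su X -> p g *m dpi X *m (p g)^t* = dpi (g *m X *m g^t*).
Proof.
move=> hg hX; have [sX dX] := dpiP hX; have [sX' _] := hX.
apply/esym/dpi_uniq; [exact: su_conj|exact: skew_conj|move=> k].
have Ug := urU hp hg; have [Ug' _] := hg.
have hE : inSU (expm (2 ^- k *: X)) by apply: su_exp; exact: su_half.
have E N' (a b c : 'M[C]_N') : 2 ^- k *: (a *m b *m c) = a *m (2 ^- k *: b) *m c.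
  by rewrite -scalemxAr -scalemxAl.
rewrite !E -(expm_conj e) //; last exact: skew_half.
rewrite -(expm_conj e) //; last exact: skew_half.
rewrite -dX -rep_ct // (urM hp); [|exact: inSUM|exact: inSUct].
by rewrite (urM hp).
Qed.

Definition trace0 (Z : 'M[C]_n.+1) := Z - (\tr Z / n.+1%:R)%:M.

Lemma tr_trace0 Z : \tr (trace0 Z) = 0.
Proof.
by rewrite raddfB /= mxtrace_scalar -[X in _ - X]mulr_natr divfK ?subrr // pnatr_eq0.
Qed.

(* Z = skpart Z + i hmpart Z modulo scalars, with both parts in su. *)
Definition skpart (Z : 'M[C]_n.+1) := 2^-1 *: (trace0 Z - (trace0 Z)^t*).
Definition hmpart (Z : 'M[C]_n.+1) := - ('i / 2) *: (trace0 Z + (trace0 Z)^t*).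

(** The lock serves [dpiC], the complex-linear extension of the differential from su(n+1) to all
    matrices, with scalar matrices acting by 0. Thus each [delta_mx k l] acts, including the
    diagonal ones. *)
Fact dpiC_key : unit. Proof. exact: tt. Qed.
Definition dpiC := locked_with dpiC_key
  (fun Z => dpi (skpart Z) + 'i *: dpi (hmpart Z) : 'M[C]_N).

Lemma dpiCE Z : dpiC Z = dpi (skpart Z) + 'i *: dpi (hmpart Z).
Proof. by rewrite /dpiC unlock. Qed.

Lemma tr_ct k (Z : 'M[C]_k) : \tr (Z^t*) = (\tr Z)^*.
Proof.
by rewrite /mxtrace rmorph_sum; apply: eq_bigr => i _; rewrite !mxE.
Qed.

Lemma inv2_real : (2^-1 : C)^* = 2^-1.
Proof. by rewrite rmorphV ?unitfE ?pnatr_eq0 // rmorph_nat. Qed.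

Lemma su_skpart Z : su (skpart Z).
Proof.
split.
  by rewrite /skew ctmxZ ctmxD ctmxN trmxCK inv2_real -[RHS]scalerN (opprB (trace0 Z)).
by rewrite linearZ raddfB /= tr_ct tr_trace0 rmorph0 subrr mulr0.
Qed.

Lemma su_hmpart Z : su (hmpart Z).
Proof.
split; last by rewrite linearZ raddfD /= tr_ct tr_trace0 rmorph0 addr0 mulr0.
rewrite /skew ctmxZ ctmxD trmxCK addrC -[RHS]scaleNr; congr (_ *: _).
by rewrite rmorphN rmorphM /= conjCi inv2_real mulNr.
Qed.

Lemma trace0D Z W : trace0 (Z + W) = trace0 Z + trace0 W.
Proof. by rewrite /trace0 raddfD /= mulrDl raddfD /= opprD addrACA. Qed.

Lemma trace0Z c Z : trace0 (c *: Z) = c *: trace0 Z.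
Proof. by rewrite /trace0 linearZ /= -mulrA -scale_scalar_mx scalerBr. Qed.

Lemma dpiCD Z W : dpiC (Z + W) = dpiC Z + dpiC W.
Proof.
rewrite !dpiCE (_ : skpart (Z + W) = skpart Z + skpart W); last first.
  by rewrite /skpart trace0D ctmxD opprD addrACA scalerDr.
rewrite (_ : hmpart (Z + W) = hmpart Z + hmpart W); last first.
  by rewrite /hmpart trace0D ctmxD addrACA scalerDr.
rewrite !dpiD ?scalerDr 1?addrACA //; solve [exact: su_skpart|exact: su_hmpart].
Qed.

Lemma dpiC_real t Z : t^* = t -> dpiC (t *: Z) = t *: dpiC Z.
Proof.
move=> ht; rewrite !dpiCE (_ : skpart (t *: Z) = t *: skpart Z); last first.
  by rewrite /skpart trace0Z ctmxZ ht -scalerBr !scalerA mulrC.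
rewrite (_ : hmpart (t *: Z) = t *: hmpart Z); last first.
  by rewrite /hmpart trace0Z ctmxZ ht -scalerDr !scalerA mulrC.
rewrite (dpiZ (su_skpart _) ht) (dpiZ (su_hmpart _) ht) scalerDr.
by rewrite !scalerA [t * 'i]mulrC.
Qed.

Lemma dpiC_i Z : dpiC ('i *: Z) = 'i *: dpiC Z.
Proof.
rewrite !dpiCE (_ : skpart ('i *: Z) = - hmpart Z); last first.
  rewrite /skpart /hmpart trace0Z ctmxZ conjCi -scaleNr opprK scaleNr opprK -scalerDr.
  by rewrite scalerA mulrC.
rewrite (_ : hmpart ('i *: Z) = skpart Z); last first.
  rewrite /skpart /hmpart trace0Z ctmxZ conjCi [X in _ + X]scaleNr -scalerBr scalerA.
  congr (_ *: _).
  by rewrite mulNr mulrAC -expr2 sqrCi mulN1r opprK.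
rewrite dpiN; last exact: su_hmpart.
by rewrite scalerDr scalerA -expr2 sqrCi scaleN1r addrC.
Qed.

Lemma dpiCZ c Z : dpiC (c *: Z) = c *: dpiC Z.
Proof.
rewrite (Crect c) !scalerDl dpiCD; congr (_ + _).
  by rewrite dpiC_real // conj_Creal // Creal_Re.
by rewrite -!scalerA dpiC_i dpiC_real // conj_Creal // Creal_Im.
Qed.

Lemma dpiC0 : dpiC 0 = 0.
Proof. by rewrite -(scale0r 0) dpiCZ scale0r. Qed.

Lemma dpiCN Z : dpiC (- Z) = - dpiC Z.
Proof. by rewrite -scaleN1r dpiCZ scaleN1r. Qed.

Lemma dpiC_sum (I : Type) (r : seq I) (P : pred I) (F : I -> 'M[C]_n.+1) :
  dpiC (\sum_(i <- r | P i) F i) = \sum_(i <- r | P i) dpiC (F i).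
Proof. exact: (big_morph dpiC dpiCD dpiC0). Qed.

Lemma dpiC_delta Z : dpiC Z = \sum_i \sum_j Z i j *: dpiC (delta_mx i j).
Proof.
rewrite {1}(matrix_sum_delta Z) dpiC_sum; apply: eq_bigr => i _.
by rewrite dpiC_sum; apply: eq_bigr => j _; rewrite dpiCZ.
Qed.

Lemma dpiC_scalar c : dpiC c%:M = 0.
Proof.
have h : trace0 c%:M = 0.
  by rewrite /trace0 mxtrace_scalar -[c *+ _]mulr_natr mulfK ?subrr // pnatr_eq0.
rewrite !dpiCE /skpart /hmpart h ctmx0 subrr addr0 !scaler0 dpi0 scaler0 addr0 //.
Qed.

(** The infinitesimal form of unitarity. In particular raising and lowering operators are adjoint to
    each other. *)
Lemma dpiC_ct Z : (dpiC Z)^t* = dpiC (Z^t*).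
Proof.
have h : trace0 (Z^t*) = (trace0 Z)^t*.
  rewrite /trace0 ctmxD ctmxN tr_ct tr_scalar_mx map_scalar_mx /=.
  by congr (_ - _%:M); rewrite rmorphM /= fmorphV rmorph_nat.
rewrite !dpiCE (_ : skpart (Z^t*) = - skpart Z); last first.
  by rewrite /skpart h trmxCK -scalerN (opprB (trace0 Z)).
rewrite (_ : hmpart (Z^t*) = hmpart Z); last by rewrite /hmpart h trmxCK addrC.
rewrite ctmxD ctmxZ conjCi dpiN; last exact: su_skpart.
have [s1 s2] := (skew_dpi (su_skpart Z), skew_dpi (su_hmpart Z)).
by rewrite s1 s2 scaleNr scalerN opprK.
Qed.

Lemma half_dbl (V : lmodType C) (v : V) : 2^-1 *: (v + v) = v.
Proof. by rewrite -[v + v]mulr2n -[v *+ 2]scaler_nat scalerA mulVf ?scale1r // pnatr_eq0. Qed.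

Lemma dpiC_su X : su X -> dpiC X = dpi X.
Proof.
move=> [sX tX]; have h : trace0 X = X by rewrite /trace0 tX mul0r raddf0 subr0.
rewrite !dpiCE /skpart /hmpart h sX subrr scaler0 dpi0 scaler0 addr0 opprK.
by rewrite half_dbl.
Qed.

Lemma dpiC_rect Z : exists X Y c, [/\ su X, su Y & Z = X + 'i *: Y + c%:M].
Proof.
exists (skpart Z), (hmpart Z), (\tr Z / n.+1%:R); split.
- exact: su_skpart.
- exact: su_hmpart.
have h : 'i * - ('i / 2) = 2^-1 :> C by rewrite mulrN mulrA -expr2 sqrCi mulN1r opprK.
by rewrite scalerA h -scalerDr addrACA addNr addr0 half_dbl subrK.
Qed.

Lemma dpiC_rectE X Y c : su X -> su Y ->
  dpiC (X + 'i *: Y + c%:M) = dpi X + 'i *: dpi Y.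
Proof.
by move=> hX hY; rewrite 2!dpiCD dpiCZ dpiC_scalar addr0 (dpiC_su hX) (dpiC_su hY).
Qed.

Opaque dpi skpart hmpart trace0.

Lemma dpiC_conj g Z : inSU g -> p g *m dpiC Z *m (p g)^t* = dpiC (g *m Z *m g^t*).
Proof.
move=> hg; have [[Ug _] _] := (hg, I); have [g1 g2] := unitaryP Ug.
have [X [Y [c [hX hY ->]]]] := dpiC_rect Z.
have -> : g *m (X + 'i *: Y + c%:M) *m g^t* =
    g *m X *m g^t* + 'i *: (g *m Y *m g^t*) + c%:M.
  rewrite 2!mulmxDr 2!mulmxDl -scalemxAr -scalemxAl; congr (_ + _).
  by rewrite mul_mx_scalar -scalemxAl g1 scalemx1.
rewrite !dpiC_rectE -?dpi_conj // ?mulmxDr ?mulmxDl -?scalemxAr -?scalemxAl //.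
- exact: su_conj.
- exact: su_conj.
Qed.

Lemma dpiC_cont (Z : nat -> 'M[C]_n.+1) W : mcv Z W -> mcv (fun k => dpiC (Z k)) (dpiC W).
Proof.
move=> [hZ]; split=> a b; under eq_fun do rewrite dpiC_delta summxE.
rewrite dpiC_delta summxE; apply: cvg_bigsum => i.
under eq_fun do rewrite summxE; rewrite summxE; apply: cvg_bigsum => j.
under eq_fun do rewrite mxE; rewrite mxE; apply: cvgM; [exact: hZ|exact: cvg_cst].
Qed.

Lemma comm_sub1 k (A B : 'M[C]_k) : (A - 1%:M) *m B - B *m (A - 1%:M) = A *m B - B *m A.
Proof. by rewrite mulmxBl mulmxBr mul1mx mulmx1 opprB addrA subrK. Qed.

(** Both sides are limits of the same sequence. With g = exp(2^-k X), the product of 2^k (g Z g^* -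
    Z) with g on the right is 2^k ((g - 1) Z - Z (g - 1)), and [dpiC_conj] transports the first form
    to the representation. *)
Lemma dpiC_bracket_su X Z : su X ->
  dpiC (X *m Z - Z *m X) = dpiC X *m dpiC Z - dpiC Z *m dpiC X.
Proof.
move=> hX; rewrite (dpiC_su hX); have [sX dX] := dpiP hX; have [sX' _] := hX.
pose g k := expm (2 ^- k *: X).
have hg k : inSU (g k) by apply: su_exp; exact: su_half.
have lim1 : mcv (fun k => (2 ^+ k *: (p (g k) - 1%:M)) *m dpiC Z - dpiC Z *m (2 ^+ k *: (p (g k) - 1%:M)))
    (dpi X *m dpiC Z - dpiC Z *m dpi X).
  have h0 : mcv (fun k => 2 ^+ k *: (p (g k) - 1%:M)) (dpi X).
    by apply: mcv_ext (expm_lim He sX) => k; rewrite /g dX.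
  by apply: mcvD; [|apply: mcvN]; apply: mcvM => //; exact: mcv_cst.
have lim2 : mcv (fun k => dpiC (2 ^+ k *: (g k *m Z *m (g k)^t* - Z)) *m p (g k))
    (dpiC (X *m Z - Z *m X)).
  rewrite -[X in mcv _ X]mulmx1; apply: mcvM; last by apply: mcv_ext (expm_lim1 He sX) => k; rewrite /g dX.
  apply: dpiC_cont; have h0 := expm_lim He sX'.
  have h1 := mcvM (mcvD (mcvM h0 (mcv_cst Z)) (mcvN (mcvM (mcv_cst Z) h0)))
               (mcv_adj (expm_lim1 He sX')).
  rewrite ctmx1 mulmx1 in h1; apply: mcv_ext h1 => k; rewrite -/(g k).
  have [[Ug _] _] := (hg k, I); have [g1 g2] := unitaryP Ug.
  rewrite -scalemxAl -scalemxAr -scalerBr -scalemxAl; congr (_ *: _).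
  rewrite comm_sub1 mulmxBl.
  by rewrite -[Z *m g k *m _]mulmxA g1 mulmx1.
apply: mcv_uniq lim2 _; apply: mcv_ext lim1 => k.
have [p1 p2] := unitaryP (urU hp (hg k)).
rewrite dpiCZ dpiCD dpiCN -dpiC_conj // -scalemxAl -scalemxAl -scalemxAr -scalerBr.
congr (_ *: _); rewrite comm_sub1 mulmxBl.
by rewrite -[_ *m (p (g k))^t* *m _]mulmxA p2 mulmx1.
Qed.

Lemma bracket_lin k (A B D : 'M[C]_k) c :
  (A + c *: B) *m D - D *m (A + c *: B) = (A *m D - D *m A) + c *: (B *m D - D *m B).
Proof. by rewrite mulmxDr mulmxDl opprD addrACA -scalemxAl -scalemxAr -scalerBr. Qed.

Lemma commutator_act k l (A B S : 'M[C]_k) (x : 'M[C]_(k, l)) :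
  S = A *m B - B *m A -> A *m (B *m x) = B *m (A *m x) + S *m x.
Proof. by move=> ->; rewrite mulmxBl !mulmxA addrC subrK. Qed.

(** Both sides are complex linear in [X] and vanish on scalar matrices. *)
Lemma dpiC_bracket X Z :
  dpiC (X *m Z - Z *m X) = dpiC X *m dpiC Z - dpiC Z *m dpiC X.
Proof.
have [A [B [c [hA hB ->]]]] := dpiC_rect X.
rewrite dpiC_rectE // -(dpiC_su hA) -(dpiC_su hB) bracket_lin.
have -> : (A + 'i *: B + c%:M) *m Z - Z *m (A + 'i *: B + c%:M) =
   (A *m Z - Z *m A) + 'i *: (B *m Z - Z *m B).
  by rewrite -bracket_lin mulmxDr mulmxDl scalar_mxC opprD addrACA subrr addr0.
etransitivity; first exact: dpiCD.
congr (_ + _); first exact: dpiC_bracket_su.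
etransitivity; first exact: dpiCZ.
congr (_ *: _); exact: dpiC_bracket_su.
Qed.

End Gen.
Section Intertwiner.
Variables (N N' : nat) (p : 'M[C]_n.+1 -> 'M[C]_N) (q : 'M[C]_n.+1 -> 'M[C]_N').
Hypotheses (hp : urep inSU p) (hq : urep inSU q).

(** [SU_is_expm] writes a group element as an exponential, and [expm_intertw] passes the relation
    from generators to exponentials. *)
Lemma intertw_dpi (T : 'M[C]_(N', N)) :
  (forall Z, T *m dpiC p Z = dpiC q Z *m T) -> forall g, inSU g -> T *m p g = q g *m T.
Proof.
move=> hT g [Ug dg]; have [X [sX tX ->]] := SU_is_expm He Ug dg.
have hX : su X by [].
rewrite (pexp hp hX) (pexp hq hX); apply: expm_intertw.
- by apply: skew_normal; exact: skew_dpi.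
- by apply: skew_normal; exact: skew_dpi.
by rewrite -!dpiC_su.
Qed.
End Intertwiner.
End Rep.

(** * Subspaces as predicates, orthonormal bases and projections *)

Section Subspaces.
Variable C : numClosedFieldType.

(** Predicates allow the inductively defined spans [reach] and [orbit_span] to be used directly as
    subspaces. *)
Definition subsp N (P : 'cV[C]_N -> Prop) : Prop :=
  P 0 /\ forall c x y, P x -> P y -> P (c *: x + y).

Lemma subspD N (P : 'cV[C]_N -> Prop) x y : subsp P -> P x -> P y -> P (x + y).
Proof. by move=> [_ h] hx hy; rewrite -[x]scale1r; exact: h. Qed.

Lemma subspZ N (P : 'cV[C]_N -> Prop) c x : subsp P -> P x -> P (c *: x).
Proof. by move=> [h0 h] hx; rewrite -[_ *: _]addr0; exact: h. Qed.

Lemma subspB N (P : 'cV[C]_N -> Prop) x y : subsp P -> P x -> P y -> P (x - y).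
Proof. by move=> hP hx hy; rewrite -scaleN1r addrC; apply: hP.2. Qed.

Lemma mulmx_ext m N (A B : 'M[C]_(m, N)) : (forall x : 'cV[C]_N, A *m x = B *m x) -> A = B.
Proof.
move=> h; apply/matrixP => i j.
have /matrixP/(_ i 0) := h (delta_mx j 0).
by rewrite -!colE !mxE.
Qed.

(** Take an orthonormal family in [P] of maximal length. If some [x] in [P] were not in its span,
    the normalised residual of [x] could be appended. *)
Lemma orthonormal_basis N (P : 'cV[C]_N -> Prop) : subsp P -> exists r (B : 'M[C]_(N, r)),
  B^t* *m B = 1%:M /\ forall x, P x <-> x = B *m (B^t* *m x).
Proof.
move=> hP.
pose Q r := `[< exists B : 'M[C]_(N, r), B^t* *m B = 1%:M /\ forall x, P (B *m x) >].
have Q0 : exists r, Q r.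
  exists 0%N; apply/asboolP; exists 0; split; first by apply/matrixP => -[].
  by move=> x; rewrite mul0mx; exact: hP.1.
have Qb r : Q r -> (r <= N)%N.
  by move=> /asboolP[B [h _]]; exact: mulmx1_min h.
have [r /asboolP[B [B1 BP]] max_r] := ex_maxnP Q0 Qb.
exists r, B; split=> // x; split=> [Px|->]; last exact: BP.
apply/eqP; rewrite -subr_eq0; apply/eqP; set y := x - _.
have Py : P y by apply: subspB.
have By : B^t* *m y = 0 by rewrite mulmxBr !mulmxA B1 mul1mx subrr.
apply: contrapT => /eqP y0.
pose c := (y^t* *m y) 0 0.
have cE : y^t* *m y = c%:M by rewrite [LHS]mx11_scalar.
have c0 : 0 < c.
  rewrite lt_def; apply/andP; split.
    by apply: contra_neq y0 => c0; apply: ker_adj; rewrite cE c0 raddf0.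
  by rewrite /c mxE; apply: sumr_ge0 => k _; rewrite !mxE mulrC -normCK exprn_ge0.
(* The factor that normalises the residual [y], whose squared norm is [c]. *)
pose s := (sqrtC c)^-1.
have sr : s^* = s.
  by rewrite fmorphV; congr (_^-1); apply: conj_Creal; rewrite ger0_real // sqrtC_ge0 ltW.
have /max_r : Q (r + 1)%N.
  apply/asboolP; exists (row_mx B (s *: y)); split.
    rewrite tr_row_mx map_col_mx mul_col_row B1 -scalemxAr By scaler0.
    have -> : (s *: y)^t* *m B = 0.
      by rewrite ctmxZ -scalemxAl -[B]trmxCK -ctmxM By ctmx0 scaler0.
    have -> : (s *: y)^t* *m (s *: y) = 1%:M.
      rewrite ctmxZ sr -scalemxAl -scalemxAr cE scalerA scale_scalar_mx; congr (_%:M).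
      by rewrite -invfM -expr2 sqrtCK mulVf // gt_eqF.
    by rewrite -scalar_mx_block.
  move=> z; rewrite -[z]vsubmxK mul_row_col; apply: subspD => //.
  by rewrite [dsubmx z]mx11_scalar mul_mx_scalar; do 2!apply: subspZ => //.
by rewrite addn1 ltnn.
Qed.

Lemma proj_onto N (P : 'cV[C]_N -> Prop) : subsp P -> exists E : 'M[C]_N,
  [/\ E^t* = E, forall x, P x <-> E *m x = x & forall x, P (E *m x)].
Proof.
move=> /orthonormal_basis[r [B [B1 BP]]]; exists (B *m B^t*).
have PE x : P x <-> B *m B^t* *m x = x by rewrite BP mulmxA; split.
split=> //; first by rewrite ctmxM trmxCK.
by move=> x; apply/PE; rewrite !mulmxA -[B *m _ *m B]mulmxA B1 mulmx1.
Qed.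

End Subspaces.

(** * Irreducible representations and highest weights *)

Section Irr.
Variables (C : numClosedFieldType) (e : C -> C) (He : is_expi e).
Variable n : nat.
Implicit Type H : 'M[C]_n.+1 -> Prop.

Definition irr H N (p : 'M[C]_n.+1 -> 'M[C]_N) : Prop :=
  (0 < N)%N /\ forall P : 'cV[C]_N -> Prop, subsp P ->
    (forall g v, H g -> P v -> P (p g *m v)) ->
    (forall v, P v -> v = 0) \/ (forall v, P v).

Lemma irr_ind H N (p : 'M[C]_n.+1 -> 'M[C]_N) (P : 'cV[C]_N -> Prop) v :
  irr H p -> subsp P -> (forall g v, H g -> P v -> P (p g *m v)) ->
  P v -> v != 0 -> forall x, P x.
Proof.
move=> [_ h] sP hP Pv v0; case: (h P sP hP) => // h0.
by rewrite (h0 v Pv) eqxx in v0.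
Qed.

(** An eigenspace of [T] is stable under the group and nonzero, hence everything. *)
Lemma schur H N (p : 'M[C]_n.+1 -> 'M[C]_N) (T : 'M[C]_N) : irr H p ->
  (forall g, H g -> T *m p g = p g *m T) -> exists c, T = c%:M.
Proof.
(* [eigenvalue] refers to row vectors, hence the transpose. *)
move=> hp hT; have [a /eigenvalueP[v va v0]] := eigenvalue_closed (T^T) hp.1.
exists a; apply: mulmx_ext => x; rewrite mul_scalar_mx.
apply: (irr_ind (P := fun x => T *m x = a *: x) (v := v^T) hp).
- split=> [|c y z hy hz]; first by rewrite mulmx0 scaler0.
  by rewrite mulmxDr -scalemxAr hy hz scalerDr !scalerA mulrC.
- by move=> g y hg hy; rewrite mulmxA hT // -mulmxA hy -scalemxAr.
- by rewrite -[T]trmxK -trmx_mul va linearZ.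
- by rewrite -trmx0 (inj_eq trmx_inj).
Qed.

Lemma intertw_ct H N N' (p : 'M[C]_n.+1 -> 'M[C]_N) (q : 'M[C]_n.+1 -> 'M[C]_N')
  (T : 'M[C]_(N', N)) : urep H p -> urep H q ->
  (forall g, H g -> T *m p g = q g *m T) -> forall g, H g -> T^t* *m q g = p g *m T^t*.
Proof.
move=> hp hq hT g hg.
have [p1 _] := unitaryP (urU hp hg); have [_ q2] := unitaryP (urU hq hg).
have : (T *m p g)^t* = (q g *m T)^t* by rewrite hT.
rewrite !ctmxM => /(congr1 (fun A => p g *m A *m q g)).
by rewrite !mulmxA p1 mul1mx -[RHS]mulmxA q2 mulmx1.
Qed.

(** T^* T commutes with the irreducible [p], so it is a scalar, nonzero by [ker_adj]. *)
Lemma schur_isometry H N N' (p : 'M[C]_n.+1 -> 'M[C]_N) (q : 'M[C]_n.+1 -> 'M[C]_N')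
  (T : 'M[C]_(N', N)) : urep H p -> urep H q -> irr H p ->
  (forall g, H g -> T *m p g = q g *m T) -> T != 0 ->
  exists2 c, c != 0 & T^t* *m T = c%:M.
Proof.
move=> hp hq ip hT T0.
have [|c hc] := schur (T := T^t* *m T) ip.
  by move=> g hg; rewrite -mulmxA hT // mulmxA (intertw_ct hp hq hT) // mulmxA.
exists c => //; apply: contra_neq T0 => c0; apply: ker_adj.
by rewrite hc c0 raddf0.
Qed.

Section Reach.
Variables (N : nat) (p : 'M[C]_n.+1 -> 'M[C]_N).
Hypothesis hp : urep (@inSU C n) p.
Notation d := (dpiC e p).

(** Let E be the orthogonal projection onto [P]. Stability says E d(Z) E = d(Z) E for all Z; its
    adjoint for Z^* shows that E commutes with every d(Z), hence with the group. *)
Lemma dpiC_stable (P : 'cV[C]_N -> Prop) : subsp P ->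
  (forall Z v, P v -> P (d Z *m v)) -> forall g v, inSU g -> P v -> P (p g *m v).
Proof.
move=> sP hP g v hg; have [E [EE PE PEx]] := proj_onto sP.
have h1 Z : E *m d Z *m E = d Z *m E.
  by apply: mulmx_ext => x; rewrite -!mulmxA; apply/PE; exact: hP.
have h2 Z : E *m d Z = d Z *m E.
  rewrite -h1; have := congr1 (fun A => A^t*) (h1 (Z^t*)).
  by rewrite !ctmxM EE (dpiC_ct He hp) trmxCK mulmxA => ->.
have h3 := intertw_dpi He hp hp h2.
by move=> /PE hv; apply/PE; rewrite mulmxA h3 // -mulmxA hv.
Qed.

Lemma irr_dpiC (P : 'cV[C]_N -> Prop) v : irr (@inSU C n) p -> subsp P ->
  (forall Z v, P v -> P (d Z *m v)) -> P v -> v != 0 -> forall x, P x.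
Proof. by move=> ip sP hP; apply: (irr_ind ip sP); exact: dpiC_stable. Qed.

Inductive reach (S : 'M[C]_n.+1 -> Prop) (u : 'cV[C]_N) : 'cV[C]_N -> Prop :=
| reach_base : reach S u u
| reach_lin c x y : reach S u x -> reach S u y -> reach S u (c *: x + y)
| reach_act Y x : S Y -> reach S u x -> reach S u (d Y *m x).

Lemma reach_subsp S u : subsp (reach S u).
Proof.
split; last by move=> c x y; exact: reach_lin.
rewrite -[0](addNr u) -scaleN1r; apply: reach_lin; exact: reach_base.
Qed.

(* Words in S span: commuting T to the right produces only shorter words, and T acts on u
   by scalars. *)
Lemma reach_all S T u : irr (@inSU C n) p -> u != 0 ->
  (forall Z, exists Y X, [/\ S Y, T X & Z = Y + X]) ->
  (forall X, T X -> exists c, d X *m u = c *: u) -> forall w, reach S u w.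
Proof.
move=> ip u0 ST Tu.
have hT w : reach S u w -> forall X, T X -> reach S u (d X *m w).
  elim=> [X /Tu[c ->]|c x y _ IHx _ IHy X hX|Y x hY hx IH X hX].
  - by apply: subspZ; [exact: reach_subsp|exact: reach_base].
  - by rewrite mulmxDr -scalemxAr; apply: reach_lin; [exact: IHx|exact: IHy].
  have [Y' [X' [hY' hX' E]]] := ST (X *m Y - Y *m X).
  have -> : d X *m (d Y *m x) = d Y *m (d X *m x) + (d Y' *m x + d X' *m x).
    by rewrite (commutator_act _ (dpiC_bracket He hp X Y)) E (dpiCD He hp) mulmxDl.
  apply: subspD; [exact: reach_subsp|by apply: reach_act => //; exact: IH|].
  by apply: subspD; [exact: reach_subsp|exact: reach_act|exact: IH].
apply: (irr_dpiC ip (reach_subsp S u) _ (reach_base S u) u0) => Z w hw.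
have [Y [X [hY hX ->]]] := ST Z; rewrite (dpiCD He hp) mulmxDl.
by apply: subspD; [exact: reach_subsp|exact: reach_act|exact: hT].
Qed.

End Reach.

Section HighestWeight.
Variables (N N' : nat) (p : 'M[C]_n.+1 -> 'M[C]_N) (q : 'M[C]_n.+1 -> 'M[C]_N').
Hypotheses (hp : urep (@inSU C n) p) (hq : urep (@inSU C n) q).
Hypotheses (ip : irr (@inSU C n) p) (iq : irr (@inSU C n) q).

Definition hvec N0 (p0 : 'M[C]_n.+1 -> 'M[C]_N0) (d : 'I_n.+1 -> C) (v : 'cV[C]_N0) :=
  (forall k l : 'I_n.+1, (k < l)%N -> dpiC e p0 (delta_mx k l) *m v = 0) /\
  (forall k, dpiC e p0 (delta_mx k k) *m v = d k *: v).

Definition upper (X : 'M[C]_n.+1) := forall k l : 'I_n.+1, (l < k)%N -> X k l = 0.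
Definition strict_lower (X : 'M[C]_n.+1) := forall k l : 'I_n.+1, (k <= l)%N -> X k l = 0.

Lemma upper_act N0 (F : 'I_n.+1 -> 'I_n.+1 -> 'M[C]_N0) d (v : 'cV[C]_N0) X :
  (forall k l : 'I_n.+1, (k < l)%N -> F k l *m v = 0) -> (forall k, F k k *m v = d k *: v) ->
  upper X -> (\sum_k \sum_l X k l *: F k l) *m v = (\sum_k X k k * d k) *: v.
Proof.
move=> h1 h2 hX; rewrite mulmx_suml scaler_suml.
apply: eq_bigr => k _; rewrite mulmx_suml (bigD1 k) //= -scalemxAl h2 scalerA.
rewrite big1 ?addr0 // => l lk; rewrite -scalemxAl.
have [kl|lk'] := ltnP k l; first by rewrite h1 // scaler0.
by rewrite hX ?scale0r // ltn_neqAle lk' andbT.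
Qed.

Lemma hvec_upper N0 (p0 : 'M[C]_n.+1 -> 'M[C]_N0) d v X : urep (@inSU C n) p0 ->
  hvec p0 d v -> upper X -> dpiC e p0 X *m v = (\sum_k X k k * d k) *: v.
Proof. by move=> hp0 [h1 h2] hX; rewrite (dpiC_delta He hp0); apply: upper_act. Qed.

(* The graph of the intertwiner that maps v to w. *)
Inductive reach2 (v : 'cV[C]_N) (w : 'cV[C]_N') : 'cV[C]_N -> 'cV[C]_N' -> Prop :=
| reach2_base : reach2 v w v w
| reach2_lin c x y x' y' : reach2 v w x x' -> reach2 v w y y' ->
    reach2 v w (c *: x + y) (c *: x' + y')
| reach2_act Y x x' : strict_lower Y -> reach2 v w x x' ->
    reach2 v w (dpiC e p Y *m x) (dpiC e q Y *m x').

(** Y^* is strictly upper triangular and kills [v]; thus [v] is orthogonal to everything obtained by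
    lowering. *)
Lemma hvec_strict_lower N0 (p0 : 'M[C]_n.+1 -> 'M[C]_N0) d v Y : urep (@inSU C n) p0 ->
  hvec p0 d v -> strict_lower Y -> v^t* *m dpiC e p0 Y = 0.
Proof.
move=> hp0 hv hY; have hY' : upper (Y^t*).
  by move=> k l lk; rewrite !mxE hY ?rmorph0 // ltnW.
have := hvec_upper hp0 hv hY'; rewrite big1 ?scale0r; last first.
  by move=> k _; rewrite !mxE hY // rmorph0 mul0r.
by move/(congr1 (fun A => A^t*)); rewrite ctmxM (dpiC_ct He hp0) trmxCK ctmx0.
Qed.

Lemma strict_lower_upper (Z : 'M[C]_n.+1) : exists Y X, [/\ strict_lower Y, upper X & Z = Y + X].
Proof.
exists (\matrix_(k, l) if (k <= l)%N then 0 else Z k l),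
       (\matrix_(k, l) if (k <= l)%N then Z k l else 0); split.
- by move=> k l kl; rewrite mxE kl.
- by move=> k l kl; rewrite mxE leqNgt kl.
- by apply/matrixP => k l; rewrite !mxE; case: ifP; rewrite ?add0r ?addr0.
Qed.

(** The submodule G of the direct sum generated by (v, w) is the graph of a linear map. Since
    lowering leads to vectors orthogonal to [v] and [w], every (x, x') in G satisfies <v, x> = <w,
    x'>. This excludes (0, w), and irreducibility then gives that G meets the second summand in 0
    and projects onto the first. *)
Theorem highest_weight_intertwiner d v w : v^t* *m v = 1%:M -> w^t* *m w = 1%:M ->
  hvec p d v -> hvec q d w ->
  exists2 T : 'M[C]_(N', N), T != 0 & forall g, inSU g -> T *m p g = q g *m T.
Proof.
move=> v1 w1 hv hw; pose G := reach2 v w.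
have G0 : G 0 0.
  have -> : (0 : 'cV[C]_N) = (-1) *: v + v by rewrite scaleN1r addNr.
  have -> : (0 : 'cV[C]_N') = (-1) *: w + w by rewrite scaleN1r addNr.
  by apply: reach2_lin; exact: reach2_base.
have GD x y x' y' : G x x' -> G y y' -> G (x + y) (x' + y').
  by move=> h1 h2; rewrite -[x]scale1r -[x']scale1r; exact: reach2_lin.
have GB x y x' y' : G x x' -> G y y' -> G (x - y) (x' - y').
  by move=> h1 h2; have := reach2_lin (-1) h2 h1; rewrite !scaleN1r addrC [- y' + _]addrC.
have GZ c x x' : G x x' -> G (c *: x) (c *: x').
  by move=> h1; rewrite -[c *: x]addr0 -[c *: x']addr0; exact: reach2_lin.
have Gv x x' : G x x' -> v^t* *m x = w^t* *m x'.
  elim=> [|c x1 y1 x2 y2 _ IH1 _ IH2|Y x1 x2 hY _ _]; first by rewrite v1 w1.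
    by rewrite !mulmxDr -!scalemxAr IH1 IH2.
  by rewrite !mulmxA (hvec_strict_lower hp hv hY) (hvec_strict_lower hq hw hY) !mul0mx.
(* The diagonal and raising operators also preserve G: commuting them past a lowering operator
   leaves terms acting on a shorter word. *)
have GX x x' : G x x' -> forall X, upper X -> G (dpiC e p X *m x) (dpiC e q X *m x').
  elim=> [X hX|c x1 y1 x2 y2 _ IH1 _ IH2 X hX|Y x1 x2 hY hx IH X hX].
  - by rewrite (hvec_upper hp hv hX) (hvec_upper hq hw hX); apply: GZ; exact: reach2_base.
  - by rewrite !mulmxDr -!scalemxAr; apply: reach2_lin; [exact: IH1|exact: IH2].
  have [Y' [X' [hY' hX' E]]] := strict_lower_upper (X *m Y - Y *m X).
  have F N0 (p0 : 'M[C]_n.+1 -> 'M[C]_N0) z : urep (@inSU C n) p0 ->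
      dpiC e p0 X *m (dpiC e p0 Y *m z) = dpiC e p0 Y *m (dpiC e p0 X *m z)
       + (dpiC e p0 Y' *m z + dpiC e p0 X' *m z).
    by move=> hp0; rewrite (commutator_act _ (dpiC_bracket He hp0 X Y)) E (dpiCD He hp0) mulmxDl.
  rewrite (F _ _ _ _ hp) (F _ _ _ _ hq); apply: (GD); first by apply: reach2_act => //; exact: IH.
  by apply: (GD); [exact: reach2_act|exact: IH].
have Gd Z x x' : G x x' -> G (dpiC e p Z *m x) (dpiC e q Z *m x').
  move=> h; have [Y [X [hY hX ->]]] := strict_lower_upper Z.
  rewrite (dpiCD He hp) (dpiCD He hq) !mulmxDl.
  by apply: (GD); [exact: reach2_act|exact: GX].
have v0 : v != 0.
  apply/eqP => v0; move/matrixP/(_ 0 0)/eqP: v1; rewrite v0 mulmx0 !mxE eqxx mulr1n.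
  by rewrite eq_sym oner_eq0.
have w0 : w != 0.
  apply/eqP => w0; move/matrixP/(_ 0 0)/eqP: w1; rewrite w0 mulmx0 !mxE eqxx mulr1n.
  by rewrite eq_sym oner_eq0.
(* The y with (0, y) in G form an invariant subspace; a nonzero one would contain [w], against <v,
   0> = <w, w> = 1. *)
have Ginj y : G 0 y -> y = 0.
  move=> hy; apply: contrapT => /eqP y0.
  have : G 0 w.
    apply: (irr_dpiC hq (P := fun y => G 0 y) iq _ _ hy y0).
      split=> // c a b ha hb; have -> : (0 : 'cV[C]_N) = c *: 0 + 0 by rewrite scaler0 addr0.
      exact: reach2_lin.
    by move=> Z z hz; have := Gd Z _ _ hz; rewrite mulmx0.
  move/Gv; rewrite mulmx0 w1 => /matrixP/(_ 0 0)/eqP; rewrite !mxE eqxx mulr1n.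
  by rewrite eq_sym oner_eq0.
have Gall x : exists y, G x y.
  apply: (irr_dpiC hp (P := fun x => exists y, G x y) ip _ _ _ v0).
  - split; first by exists 0.
    by move=> c a b [a' ha] [b' hb]; exists (c *: a' + b'); exact: reach2_lin.
  - by move=> Z a [a' ha]; exists (dpiC e q Z *m a'); exact: Gd.
  - by exists w; exact: reach2_base.
pose f x := projT1 (cid (Gall x)).
have hf x : G x (f x) by rewrite /f; case: cid.
pose T : 'M[C]_(N', N) := \matrix_(i, j) f (delta_mx j 0) i 0.
have GT x : G x (T *m x).
  have -> : T *m x = \sum_j x j 0 *: f (delta_mx j 0).
    apply/colP => i; rewrite mxE summxE; apply: eq_bigr => j _.
    by rewrite !mxE mulrC.
  have {1}-> : x = \sum_j x j 0 *: delta_mx j 0.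
    rewrite {1}(matrix_sum_delta x); apply: eq_bigr => j _; by rewrite big_ord1.
  elim/big_ind2: _ => //; last by move=> j _; exact: (GZ).
  by move=> ? ? ? ? h1 h2; exact: (GD _ _ _ _ h1 h2).
have Guniq x y : G x y -> y = T *m x.
  by move=> h; apply/eqP; rewrite -subr_eq0; apply/eqP/Ginj; rewrite -(subrr x); exact: GB.
exists T.
  by apply: contra_neq w0 => T0; rewrite (Guniq v w (reach2_base v w)) T0 mul0mx.
apply: (intertw_dpi He hp hq) => Z; apply: mulmx_ext => x.
by rewrite -!mulmxA; apply/esym/Guniq; exact: Gd.
Qed.

End HighestWeight.

End Irr.

(** * Multiplicity one *)

Section Flag.
Variables (C : numClosedFieldType) (m : nat) (hm : (1 < m)%N).
Local Notation M := 'M[C]_m.+2.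
Local Notation E k l := (delta_mx k l : M).
Let i0 : 'I_m.+2 := ord0.
Let i1 : 'I_m.+2 := Ordinal (isT : (1 < m.+2)%N).
Let ia : 'I_m.+2 := Ordinal (leqW (leqnn m.+1) : (m < m.+2)%N).
Let ib : 'I_m.+2 := ord_max.

(* The adjoints of the matrices in sl_2 + gl_m that act by scalars on v_mu, apart from the
   trace conditions. *)
Definition qlow (X : M) : Prop :=
  (forall k l : 'I_m.+2, (k < 2)%N != (l < 2)%N -> X k l = 0) /\
  (forall k l : 'I_m.+2, k = 0%N :> nat -> l = 1%N :> nat -> X k l = 0).

(* 1 + Nf represents a flag in general position with respect to C^2 + C^m. *)
Let Nf : M := E ib i0 + E ia i1 + E ib i1.

Lemma flagD (x y : 'I_m.+2) : (x == y) = (x == y :> nat). Proof. by []. Qed.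

Lemma Nf2 : Nf *m Nf = 0.
Proof.
rewrite /Nf !mulmxDl !mulmxDr !mul_delta_mx_cond !flagD /=.
by rewrite (ltn_eqF hm) (ltn_eqF (leqW hm)) (ltn_eqF (ltnW hm)) /= !mulr0n !addr0.
Qed.

(** Conjugation by the inverse of 1 + Nf, which is 1 - Nf because [Nf] squares to zero. *)
Let G (Y : M) := (1%:M - Nf) *m Y *m (1%:M + Nf).

(** Membership in the sum of the upper triangular matrices and the conjugate of [qlow]; general
    position means that every matrix satisfies [D]. *)
Let D (Z : M) := exists2 Y, qlow Y & upper (Z - G Y).

Lemma G_lin c Y Y' : G (c *: Y + Y') = c *: G Y + G Y'.
Proof. by rewrite /G [X in X *m _]mulmxDr mulmxDl -scalemxAr -scalemxAl. Qed.

Lemma flag_comb c Z W : D Z -> D W -> D (c *: Z + W).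
Proof.
move=> [Y [q1 q2] hY] [Y' [q1' q2'] hY']; exists (c *: Y + Y').
  split=> k l h; first by rewrite !mxE q1 // q1' // mulr0 addr0.
  by move=> h'; rewrite !mxE q2 // q2' // mulr0 addr0.
move=> k l kl; have := hY k l kl; have := hY' k l kl; rewrite G_lin => h1 h2.
have -> : c *: Z + W - (c *: G Y + G Y') = c *: (Z - G Y) + (W - G Y').
  by rewrite scalerBr opprD addrACA.
by rewrite mxE [in X in X + _]mxE h1 h2 mulr0 addr0.
Qed.

Lemma flag_upper Z : upper Z -> D Z.
Proof.
move=> hZ; exists 0; first by split=> *; rewrite mxE.
by rewrite /G mulmx0 mul0mx subr0.
Qed.

Lemma flag_q Y : qlow Y -> D (G Y).
Proof. by move=> hY; exists Y => // k l _; rewrite subrr mxE. Qed.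

Lemma flag_D Z W : D Z -> D W -> D (Z + W).
Proof. by move=> h1 h2; rewrite -[Z]scale1r; exact: flag_comb. Qed.

Lemma flag_B Z W : D Z -> D W -> D (Z - W).
Proof. by move=> h1 h2; rewrite addrC -scaleN1r; exact: flag_comb. Qed.

Lemma flag_upE (k l : 'I_m.+2) : (k <= l)%N -> D (E k l).
Proof.
move=> kl; apply: flag_upper => x y yx; rewrite mxE.
by case: andP => // -[/eqP xk /eqP yl]; move: yx; rewrite xk yl ltnNge kl.
Qed.

Lemma flag_qE (k l : 'I_m.+2) : (k < 2)%N = (l < 2)%N -> ~~ ((k == 0%N :> nat) && (l == 1%N :> nat)) ->
  qlow (E k l).
Proof.
move=> h1 h2; split=> x y; rewrite mxE.
  by move=> h; case: andP => // -[/eqP xk /eqP yl]; move: h; rewrite xk yl h1 eqxx.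
move=> x0 y1; case: andP => // -[/eqP xk /eqP yl]; move: h2.
by rewrite -xk -yl x0 y1.
Qed.

Lemma Nf_mul0 (k l : 'I_m.+2) : (1 < k)%N -> Nf *m E k l = 0.
Proof.
move=> hk; rewrite /Nf !mulmxDl !mul_delta_mx_cond !flagD /=.
by rewrite (ltn_eqF (ltnW hk)) (ltn_eqF hk) !mulr0n !addr0.
Qed.

Lemma mul_Nf0 (k l : 'I_m.+2) : (l < m)%N -> E k l *m Nf = 0.
Proof.
move=> hl; rewrite /Nf !mulmxDr !mul_delta_mx_cond !flagD /=.
by rewrite (ltn_eqF hl) (ltn_eqF (leqW hl)) !mulr0n !addr0.
Qed.

Lemma flag_conj_right (k l : 'I_m.+2) : (1 < k)%N -> G (E k l) = E k l + E k l *m Nf.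
Proof. by move=> hk; rewrite /G mulmxBl Nf_mul0 // subr0 mul1mx mulmxDr mulmx1. Qed.

Lemma flag_conj_left (k l : 'I_m.+2) : (l < m)%N -> G (E k l) = E k l - Nf *m E k l.
Proof. by move=> hl; rewrite /G -mulmxA mulmxDr mul_Nf0 // addr0 mulmx1 mulmxBl mul1mx. Qed.

Lemma flag_b0 : D (E ib i0).
Proof.
have -> : E ib i0 = E i0 i0 - G (E i0 i0).
  rewrite (flag_conj_left _ (ltnW hm : (i0 < m)%N)) opprB [RHS]addrC subrK /Nf !mulmxDl.
  by rewrite !mul_delta_mx_cond !flagD /= !mulr0n mulr1n !addr0.
by apply: flag_B; [exact: flag_upE|apply: flag_q; exact: flag_qE].
Qed.

(** E_kb Nf = E_k0 + E_k1, and E_kb itself is both upper triangular and in [qlow]. *)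
Lemma flag_col (k : 'I_m.+2) : (1 < k)%N -> D (E k i0 + E k i1).
Proof.
move=> hk; have -> : E k i0 + E k i1 = G (E k ib) - E k ib.
  rewrite flag_conj_right // [RHS]addrC addKr /Nf !mulmxDr !mul_delta_mx_cond !flagD /=.
  by rewrite eqxx (gtn_eqF (ltnSn m)) !mulr0n !mulr1n addr0.
apply: flag_B; last by apply: flag_upE; rewrite -ltnS.
apply: flag_q; apply: flag_qE; last by rewrite negb_and (gtn_eqF (ltnW hk)).
by rewrite ltnNge hk /= [RHS]ltnNge (leqW hm : (1 < ib)%N).
Qed.

(** For k at most m, E_ka is upper triangular and E_ka Nf = E_k1. The remaining row is the last one,
    where [flag_b0] separates the sum given by [flag_col]. *)
Lemma flag_k1 (k : 'I_m.+2) : (1 < k)%N -> D (E k i1).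
Proof.
move=> hk; have [km|mk] := leqP k m; last first.
  have -> : k = ib by apply: val_inj => /=; apply/eqP; rewrite eqn_leq mk -ltnS ltn_ord.
  have -> : E ib i1 = (E ib i0 + E ib i1) - E ib i0 by rewrite addrC addKr.
  by apply: flag_B; [apply: flag_col; exact: leqW|exact: flag_b0].
have -> : E k i1 = G (E k ia) - E k ia.
  rewrite flag_conj_right // [RHS]addrC addKr /Nf !mulmxDr !mul_delta_mx_cond !flagD /=.
  by rewrite eqxx (ltn_eqF (ltnSn m)) !mulr0n !mulr1n addr0 add0r.
apply: flag_B; last exact: flag_upE.
apply: flag_q; apply: flag_qE; last by rewrite negb_and (gtn_eqF (ltnW hk)).
by rewrite /= ltnNge hk ltnNge hm.
Qed.

(** Only entries below the diagonal are in question. Those in gl_m lie in [qlow], up to a correction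
    E_k1 when l = m; those in columns 0 and 1 below the first two rows come from [flag_col] and
    [flag_k1]. For E_10, conjugation produces E_10 - E_a0 - E_b0, whose correction terms have then
    been reached. *)
Lemma flag_E (k l : 'I_m.+2) : D (E k l).
Proof.
have [kl|lk] := leqP k l; first exact: flag_upE.
have [l2|l2] := ltnP l 2; last first.
  have k2 : (1 < k)%N by apply: leq_trans lk; exact: ltnW.
  have hq : qlow (E k l).
    apply: flag_qE; last by rewrite negb_and (gtn_eqF (ltnW k2)).
    by rewrite ltnNge k2 ltnNge l2.
  have [lm|ml] := ltnP l m.
    have -> : E k l = G (E k l) by rewrite flag_conj_right // mul_Nf0 // addr0.
    exact: flag_q.
  have lE : l = ia.
    apply: val_inj => /=; apply/eqP; rewrite eqn_leq ml andbT -ltnS.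
    by apply: leq_trans lk _; rewrite -ltnS.
  have -> : E k l = G (E k l) - E k i1.
    rewrite flag_conj_right // lE /Nf !mulmxDr !mul_delta_mx_cond !flagD /=.
    by rewrite eqxx (ltn_eqF (ltnSn m)) !mulr0n !mulr1n addr0 add0r addrK.
  by apply: flag_B; [exact: flag_q|exact: flag_k1].
have [k2|k2] := ltnP 1 k.
  case: (posnP l) => [l0|l0].
    have -> : l = i0 by exact: val_inj.
    have -> : E k i0 = (E k i0 + E k i1) - E k i1 by rewrite addrK.
    by apply: flag_B; [exact: flag_col|exact: flag_k1].
  have -> : l = i1 by apply: val_inj => /=; apply/eqP; rewrite eqn_leq -ltnS l2.
  exact: flag_k1.
have -> : k = i1.
  by apply: val_inj => /=; apply/eqP; rewrite eqn_leq k2; exact: leq_trans lk.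
have -> : l = i0.
  by apply: val_inj => /=; apply/eqP; rewrite -leqn0 -ltnS (leq_trans lk).
have -> : E i1 i0 = G (E i1 i0) + (E ia i0 + E ib i0).
  rewrite flag_conj_left; last exact: ltnW.
  rewrite /Nf !mulmxDl !mul_delta_mx_cond !flagD /= !mulr0n !mulr1n add0r.
  by rewrite subrK.
apply: flag_D; first by apply: flag_q; exact: flag_qE.
apply: flag_D; last exact: flag_b0.
have -> : E ia i0 = (E ia i0 + E ia i1) - E ia i1 by rewrite addrK.
by apply: flag_B; [exact: flag_col|exact: flag_k1].
Qed.

Lemma flag_all Z : D Z.
Proof.
rewrite (matrix_sum_delta Z).
elim/big_ind: _ => [||k _]; [|exact: flag_D|].
  by apply: flag_upper => k l _; rewrite mxE.
elim/big_ind: _ => [||l _]; [|exact: flag_D|].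
  by apply: flag_upper => ? ? _; rewrite mxE.
rewrite -[_ *: _]addr0; apply: flag_comb; first exact: flag_E.
by apply: flag_upper => ? ? _; rewrite mxE.
Qed.

Lemma upperM (A B : M) : upper A -> upper B -> upper (A *m B).
Proof.
move=> hA hB k l lk; rewrite mxE big1 // => p _.
have [pk|kp] := ltnP p k; first by rewrite hA // mul0r.
by rewrite [B _ _]hB ?mulr0 // (leq_trans lk).
Qed.

(** Induction on the column: once the entries of A to the left of (k, l) vanish, the entry of AB
    there is A_kl B_ll. *)
Lemma upper_cancel (A B : M) : upper B -> (forall k, B k k != 0) -> upper (A *m B) -> upper A.
Proof.
move=> hB B0 hAB k l; have [N] := ubnP (nat_of_ord l); elim: N l => // N IH l.
rewrite ltnS => lN lk; have := hAB k l lk; rewrite mxE (bigD1 l) //= big1 ?addr0.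
  by move/eqP; rewrite mulf_eq0 (negbTE (B0 l)) orbF => /eqP.
move=> p pl; have [lp|] := ltnP l p; first by rewrite hB // mulr0.
rewrite leq_eqVlt => /orP[/eqP/val_inj pE|lp]; first by rewrite pE eqxx in pl.
by rewrite IH ?mul0r //; [exact: leq_trans lN|exact: ltn_trans lk].
Qed.

Lemma det_ct k (A : 'M[C]_k) : \det (A^t*) = (\det A)^*.
Proof. by rewrite det_map_mx det_tr. Qed.

(** Gram-Schmidt orthonormalises rows, so it is applied to the transpose of [f]: a lower triangular
    factor there is an upper triangular one for [f]. *)
Lemma qr_decomposition (f : M) : f \in unitmx -> exists x, [/\ x \is unitarymx, \det x = 1,
  upper (x^t* *m f) & forall k, (x^t* *m f) k k != 0].
Proof.
move=> fU; pose S := schmidt f^T.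
have US : S \is unitarymx by exact: schmidt_unitarymx.
have [S1 S2] := unitaryP US.
have L (i k : 'I_m.+2) : (i < k)%N -> (f^T *m S^t*) i k = 0.
  move=> ik; have /sub_sumsmxP[u hu] := row_schmidt_sub f^T i.
  have -> : (f^T *m S^t*) i k = (row i f^T *m S^t*) 0 k.
    by rewrite -row_mul [RHS]mxE.
  rewrite hu mulmx_suml summxE big1 // => l li.
  have /submxP[c ->] : (u l *m <<row l S>> <= row l S)%MS.
    by rewrite (submx_trans (submxMl _ _)) ?genmxE.
  rewrite -[row l (schmidt _)]/(row l S) -mulmxA -row_mul S1 !mxE big1 // => z _.
  by rewrite !mxE; case: eqP => [lk|_]; [move: li; rewrite lk leqNgt ik|rewrite mulr0].
pose x0 := S^T.
have Ux0 : x0 \is unitarymx by rewrite trmx_unitary.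
have ux0 : upper (x0^t* *m f).
  move=> k l lk; have := L l k lk; rewrite -[f^T *m _]trmxK mxE trmx_mul trmxK.
  by rewrite /x0 !map_trmx trmxK.
have [d0 dn] : \det x0 != 0 /\ `|\det x0| = 1.
  have : \det x0 * (\det x0)^* = 1.
    have [h _] := unitaryP Ux0; move: (congr1 determinant h).
    by rewrite det_mulmx det_ct det1.
  rewrite -normCK => /eqP h; have h1 : `|\det x0| = 1 by apply/eqP; rewrite -(@sqrp_eq1 _ `|_|).
  by split=> //; rewrite -normr_eq0 h1 oner_eq0.
(* One column is rescaled by a phase to make the determinant 1; triangularity is not affected. *)
pose dl : 'rV[C]_m.+2 := \row_k if k == ord0 then (\det x0)^-1 else 1.
have Udl : diag_mx dl \is unitarymx.
  apply/unitarymxP; rewrite tr_diag_mx map_diag_mx mulmx_diag.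
  apply/matrixP => k l; rewrite !mxE -normCK; congr (_ *+ _).
  by case: eqP => _; rewrite ?normr1 ?expr1n // normfV dn invr1 expr1n.
exists (x0 *m diag_mx dl); set x := x0 *m _.
have Ux : x \is unitarymx by rewrite mul_unitarymx.
have dx : \det x = 1.
  rewrite det_mulmx det_diag (bigD1 ord0) //= mxE eqxx big1 ?mulr1 ?mulfV //.
  by move=> k /negbTE k0; rewrite mxE k0.
have ux : upper (x^t* *m f).
  move=> k l lk; rewrite ctmxM -mulmxA tr_diag_mx map_diag_mx mul_diag_mx mxE.
  by rewrite ux0 // mulr0.
split=> // k; apply/eqP => xk.
have : \det (x^t* *m f) != 0.
  rewrite det_mulmx mulf_neq0 //; last by rewrite -unitfE -unitmxE.
  by rewrite det_ct dx rmorph1 oner_eq0.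
rewrite -det_tr det_trig.
  by rewrite (bigD1 k) //= mxE xk mul0r eqxx.
by apply/is_trig_mxP => i j ij; rewrite mxE ux.
Qed.

(** A flag is unchanged when its matrix is multiplied on the right by an upper triangular one, so
    the unitary factor of 1 + Nf represents the same flag. *)
Theorem generic_flag : exists x, inSU x /\
  forall Z, exists Y X, [/\ qlow Y, upper (x^t* *m X *m x) & Z = Y + X].
Proof.
have h1 : (1%:M - Nf) *m (1%:M + Nf) = 1%:M.
  by rewrite mulmxBl mul1mx mulmxDr mulmx1 Nf2 addr0 addrK.
have h2 : (1%:M + Nf) *m (1%:M - Nf) = 1%:M by exact: mulmx1C.
have [fU _] := mulmx1_unit h2.
have [x [Ux dx ux xk]] := qr_decomposition fU; exists x; split=> // Z.
have [x1 x2] := unitaryP Ux.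
have [Y qY uY] := flag_all ((1%:M - Nf) *m Z *m (1%:M + Nf)).
exists Y, (Z - Y); split=> //; last by rewrite addrC subrK.
apply: (upper_cancel ux xk).
have -> : x^t* *m (Z - Y) *m x *m (x^t* *m (1%:M + Nf)) =
   x^t* *m (1%:M + Nf) *m ((1%:M - Nf) *m (Z - Y) *m (1%:M + Nf)).
  rewrite !mulmxA -[_ *m x *m x^t*]mulmxA x1 mulmx1.
  by rewrite -[x^t* *m (1%:M + Nf) *m _]mulmxA h2 mulmx1.
apply: upperM => //; move: uY; rewrite /G -mulmxBl -mulmxBr; exact.
Qed.

End Flag.

(** * Weight vectors under the infinitesimal action *)

Section WeightVectors.
Variables (C : numClosedFieldType) (e : C -> C) (He : is_expi e).
Notation expm := (expm e).
Variable n : nat.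
Local Notation M := 'M[C]_n.+1.
Local Notation E k l := (delta_mx k l : M).

Definition weightvec N (p : M -> 'M[C]_N) (chi : 'rV[C]_n.+1 -> C) (v : 'cV[C]_N) :=
  forall t, inSU (diag_mx t) -> p (diag_mx t) *m v = chi t *: v.

Lemma ct_delta (k l : 'I_n.+1) : (E k l)^t* = E l k.
Proof. by rewrite trmx_delta map_delta_mx. Qed.

Lemma norm_ge0 N (v : 'cV[C]_N) : 0 <= (v^t* *m v) 0 0.
Proof. by rewrite mxE; apply: sumr_ge0 => k _; rewrite !mxE mulrC -normCK exprn_ge0. Qed.

Lemma norm_gt0 N (v : 'cV[C]_N) : v != 0 -> 0 < (v^t* *m v) 0 0.
Proof.
move=> v0; rewrite lt_def norm_ge0 andbT; apply: contra_neq v0 => h; apply: ker_adj.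
by rewrite [LHS]mx11_scalar h raddf0.
Qed.

Section OneRep.
Variables (N : nat) (p : M -> 'M[C]_N).
Hypothesis hp : urep (@inSU C n) p.
Notation d := (dpiC e p).

(** Conjugation by the torus element t multiplies E_kl by t_k / t_l, and the inverse of t_l is its
    conjugate. *)
Lemma wvec_delta chi v (k l : 'I_n.+1) : weightvec p chi v ->
  weightvec p (fun t => t 0 k * (t 0 l)^* * chi t) (d (E k l) *m v).
Proof.
move=> hv t ht; have Ug := urU hp ht; have [_ g2] := unitaryP Ug.
have := dpiC_conj He hp (E k l) ht.
have -> : diag_mx t *m E k l *m (diag_mx t)^t* = (t 0 k * (t 0 l)^*) *: E k l.
  rewrite tr_diag_mx map_diag_mx mul_diag_mx mul_mx_diag.
  apply/matrixP => a b; rewrite !mxE.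
  case: andP => [[/eqP -> /eqP ->]|_]; rewrite ?mulr1 // !mulr0 mul0r //.
rewrite (dpiCZ He hp) => /(congr1 (fun A => A *m p (diag_mx t) *m v)).
rewrite -[_ *m (p (diag_mx t))^t* *m _]mulmxA g2 mulmx1 => h.
rewrite mulmxA h -!scalemxAl -mulmxA hv // -scalemxAr scalerA //.
Qed.

Lemma expm_diag N' (x : 'rV[C]_N') : expm (diag_mx x) = diag_mx (map_mx e x).
Proof.
have h (y : 'rV[C]_N') : dconj 1%:M y = diag_mx y by rewrite /dconj ctmx1 mul1mx mulmx1.
by rewrite -h (expmE _ _ (unitary1 _ _)) h.
Qed.

(** The vector [v] is regarded as an intertwiner from the one-dimensional generator [c%:M], so that
    [expm_intertw_inv] yields the eigenvalue. *)
Lemma wvec_dpi chi v (x : 'rV[C]_n.+1) c : weightvec p chi v ->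
  (forall k, im (x 0 k)) -> \sum_k x 0 k = 0 -> im c ->
  (forall k, chi (map_mx e (2 ^- k *: x)) = e (2 ^- k * c)) ->
  dpi e p (diag_mx x) *m v = c *: v.
Proof.
move=> hv hx x0 hc hchi.
have hX : su (diag_mx x).
  split; last by rewrite mxtrace_diag.
  rewrite /skew tr_diag_mx map_diag_mx -diag_mxN; congr diag_mx.
  by apply/rowP => k; rewrite !mxE; exact: hx.
have [sX dX] := dpiP He hp hX.
have sc : skew (c%:M : 'M[C]_1) by rewrite /skew tr_scalar_mx map_scalar_mx /= hc raddfN.
have := expm_intertw_inv He (T := v) sc sX.
rewrite mul_mx_scalar => -> // k.
have cE (z : C) : (z%:M : 'M[C]_1) = diag_mx (const_mx z) by rewrite diag_const_mx.
rewrite scale_scalar_mx cE expm_diag map_const_mx -cE mul_mx_scalar -dX.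
rewrite -hchi; have Eq : 2 ^- k *: diag_mx x = diag_mx (2 ^- k *: x) by rewrite linearZ.
have hS : inSU (diag_mx (map_mx e (2 ^- k *: x))).
  by rewrite -expm_diag -Eq; apply: su_exp => //; exact: su_half.
by rewrite -(hv _ hS) Eq expm_diag.
Qed.

Lemma eigen_orth Z (a b : C) (v w : 'cV[C]_N) : Z^t* = Z -> a^* = a -> d Z *m v = a *: v ->
  d Z *m w = b *: w -> v^t* *m w != 0 -> a = b.
Proof.
move=> hZ ha hv hw; apply: contra_neq_eq => ab; apply/eqP.
have : v^t* *m (d Z *m w) = (d Z *m v)^t* *m w.
  by rewrite ctmxM (dpiC_ct He hp) hZ mulmxA.
rewrite hv hw ctmxZ ha -scalemxAl -scalemxAr => /eqP; rewrite -subr_eq0 -scalerBl.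
by rewrite scaler_eq0 subr_eq0 eq_sym (negbTE ab).
Qed.

(** The sl_2 computation |E_lk v|^2 = <v, [E_kl, E_lk] v> for a vector killed by E_kl. Positivity of
    the norm gives dominance in [hvec_dom]; equality of the eigenvalues gives E_lk v = 0 in
    [K_hvec]. *)
Lemma lower_norm (k l : 'I_n.+1) (v : 'cV[C]_N) a b : k != l -> d (E k l) *m v = 0 ->
  d (E k k) *m v = a *: v -> d (E l l) *m v = b *: v ->
  (d (E l k) *m v)^t* *m (d (E l k) *m v) = (a - b) *: (v^t* *m v).
Proof.
move=> kl h0 ha hb.
have hb1 : d (E k k) - d (E l l) = d (E k l) *m d (E l k) - d (E l k) *m d (E k l).
  by rewrite -(dpiC_bracket He hp) !mul_delta_mx (dpiCD He hp) (dpiCN He hp).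
rewrite ctmxM (dpiC_ct He hp) ct_delta -mulmxA.
rewrite (commutator_act _ hb1) h0 mulmx0 add0r mulmxBl ha hb -scalerBl.
by rewrite -scalemxAr.
Qed.

Lemma hvec_dom dd v (k l : 'I_n.+1) : hvec e p dd v -> v != 0 -> (k < l)%N -> 0 <= dd k - dd l.
Proof.
move=> [h1 h2] v0 kl; have k_l : k != l by rewrite -val_eqE ltn_eqF.
have := lower_norm k_l (h1 _ _ kl) (h2 k) (h2 l).
move/matrixP/(_ 0 0); rewrite [RHS]mxE => h.
by rewrite -(pmulr_lge0 _ (norm_gt0 v0)) -h norm_ge0.
Qed.

End OneRep.
End WeightVectors.

(** * Uniqueness of intertwiners from the K-type *)

Section Multiplicity.
Variables (C : numClosedFieldType) (e : C -> C) (He : is_expi e).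
Notation expm := (expm e).
Variables (m : nat) (hm : (1 < m)%N).
Local Notation M := 'M[C]_m.+2.
Local Notation E k l := (delta_mx k l : M).

Definition blk (X : M) := forall k l : 'I_m.+2, (k < 2)%N != (l < 2)%N -> X k l = 0.

Definition inK (g : M) := inSU g /\ blk g.

(** As a commutation relation, being block diagonal passes to exponentials through
    [expm_intertw]. *)
Lemma blkP X : blk X <-> X *m diag_mx (\row_k (k < 2)%N%:R) = diag_mx (\row_k (k < 2)%N%:R) *m X.
Proof.
rewrite mul_mx_diag mul_diag_mx; split=> [h|/matrixP h k l kl].
  apply/matrixP => k l; rewrite !mxE; have [kl|kl] := eqVneq (k < 2)%N (l < 2)%N.
    by rewrite kl mulrC.
  by rewrite h // mul0r mulr0.
have := h k l; rewrite !mxE; move: kl; case: (k < 2)%N; case: (l < 2)%N => // _.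
  by rewrite mulr0 mul1r => <-.
by rewrite mulr1 mul0r.
Qed.

Lemma inK_exp X : su X -> blk X -> inK (expm X).
Proof.
move=> hX /blkP hb; split; first exact: su_exp.
apply/blkP; apply/esym/expm_intertw; last by [].
- by apply: skew_normal; exact: hX.1.
- by apply: skew_normal; exact: hX.1.
Qed.

Lemma blkZ c X : blk X -> blk (c *: X).
Proof. by move=> h k l kl; rewrite mxE h // mulr0. Qed.

Lemma blk_scalar c : blk c%:M.
Proof.
by move=> k l kl; rewrite mxE; have [klE|//] := eqVneq k l; rewrite klE eqxx in kl.
Qed.

Lemma blk_diag t : blk (diag_mx t).
Proof.
by move=> k l kl; rewrite mxE; have [klE|//] := eqVneq k l; rewrite klE eqxx in kl.
Qed.

Section Pair.
Variables (N N' : nat) (p : M -> 'M[C]_N) (q : M -> 'M[C]_N').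
Hypotheses (hp : urep (@inSU C m.+1) p) (hq : urep inK q) (iq : irr inK q).
Notation d := (dpiC e p).

Lemma inK1 : inK 1%:M.
Proof. by split; [exact: inSU1|exact: blk_scalar]. Qed.

Lemma urepK : urep inK p.
Proof.
split; first exact: (ur1 hp).
- by move=> g h [hg _] [hh _]; exact: (urM hp).
- by move=> g [hg _]; exact: (urU hp).
- by move=> g h hg hh; apply: (urC hp); [move=> k; exact: (hg k).1|exact: hh.1].
Qed.

(** The representation [q] of K has a generator along [X] as well, and [expm_intertw_inv]
    differentiates the intertwining relation. Hence the image of [J] is stable under the Lie algebra
    of K. *)
Lemma dpi_K (J : 'M[C]_(N, N')) X : (forall g, inK g -> J *m q g = p g *m J) ->
  su X -> blk X -> exists B, dpi e p X *m J = J *m B.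
Proof.
move=> hJ hX bX; have [sX dX] := dpiP He hp hX.
have hE k : inK (expm (2 ^- k *: X)) by apply: inK_exp; [exact: su_half|exact: blkZ].
have [B sB hB] := rep_gen He hq inK1 hX.1 hE.
exists B; apply/esym/(expm_intertw_inv He) => // k.
by rewrite -hB -dX; exact: hJ.
Qed.

Lemma dpiC_K (J : 'M[C]_(N, N')) Z : (forall g, inK g -> J *m q g = p g *m J) ->
  blk Z -> exists B, d Z *m J = J *m B.
Proof.
move=> hJ bZ; rewrite dpiCE.
have b0 : blk (trace0 Z).
  by move=> k l kl; rewrite mxE [X in _ + X]mxE bZ // blk_scalar // subrr.
have b1 : blk ((trace0 Z)^t*).
  by move=> k l kl; rewrite 2!mxE b0 ?rmorph0 // eq_sym.
have [B hB] : exists B, dpi e p (skpart Z) *m J = J *m B.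
  apply: dpi_K => //; first exact: su_skpart.
  by apply: blkZ => k l kl; rewrite mxE [X in _ + X]mxE b0 // b1 // subrr.
have [B' hB'] : exists B, dpi e p (hmpart Z) *m J = J *m B.
  apply: dpi_K => //; first exact: su_hmpart.
  by apply: blkZ => k l kl; rewrite mxE b0 // b1 // addr0.
exists (B + 'i *: B').
by rewrite mulmxDl mulmxDr -scalemxAl -scalemxAr hB hB'.
Qed.

(* What is used of j v_mu: highest for gl_2, and an eigenvector of all of gl_m. *)
Definition quvec (dl : 'I_m.+2 -> C) (u : 'cV[C]_N) :=
  (forall k l : 'I_m.+2, k != l -> (k < 2)%N = (l < 2)%N -> ((k < l) || (1 < l))%N ->
     d (E k l) *m u = 0) /\
  (forall k, d (E k k) *m u = dl k *: u).

Lemma quvec_act dl u Z : quvec dl u -> qlow (Z^t*) ->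
  d Z *m u = (\sum_k Z k k * dl k) *: u.
Proof.
move=> [h1 h2] [q1 q2]; rewrite (dpiC_delta He hp) mulmx_suml scaler_suml.
apply: eq_bigr => k _; rewrite mulmx_suml (bigD1 k) //= -scalemxAl h2 scalerA.
rewrite big1 ?addr0 // => l lk; rewrite -scalemxAl.
have [kl|kl] := eqVneq (k < 2)%N (l < 2)%N; last first.
  have := q1 l k; rewrite eq_sym kl !mxE => /(_ isT) /eqP.
  by rewrite conjC_eq0 => /eqP ->; rewrite scale0r.
have [h|h] := boolP ((k < l) || (1 < l))%N; first by rewrite h1 ?scaler0 // eq_sym.
(* Inside the two blocks, the only off-diagonal position not covered by [h1] is (1, 0), and [qlow]
   forces the entry of [Z] there to vanish. *)
have [k1 l0] : k = 1%N :> nat /\ l = 0%N :> nat.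
  move: h; rewrite negb_or -!leqNgt => /andP[lk' l1].
  have l2 : (l < 2)%N by rewrite ltnS.
  rewrite l2 in kl; move: lk; rewrite -val_eqE /= => lk.
  lia.
have := q2 l k l0 k1; rewrite !mxE => /eqP.
by rewrite conjC_eq0 => /eqP ->; rewrite scale0r.
Qed.

(* v^x = p x v is an eigenvector of x b x^-1, so words in [qlow] applied to it span, and their
   adjoints act on u by scalars: <u, v^x> determines all <u, y>. *)
Lemma generic_pairing dd v x dl u : irr (@inSU C m.+1) p -> hvec e p dd v -> v != 0 ->
  inSU x -> (forall Z, exists Y X, [/\ qlow Y, upper (x^t* *m X *m x) & Z = Y + X]) ->
  quvec dl u -> u^t* *m (p x *m v) = 0 -> u = 0.
Proof.
move=> ip hv v0 hx hflag hu h0.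
have [p1 p2] := unitaryP (urU hp hx).
have xv0 : p x *m v != 0.
  by apply: contra_neq v0 => h; rewrite -[v]mul1mx -p2 -mulmxA h mulmx0.
have hall : forall w, reach e p (@qlow C m) (p x *m v) w.
  apply: (reach_all He hp (T := fun X => upper (x^t* *m X *m x)) ip xv0 hflag) => X hX.
  exists (\sum_k (x^t* *m X *m x) k k * dd k).
  have [[Ux _] _] := (hx, I); have [x1 _] := unitaryP Ux.
  have hXE : x *m (x^t* *m X *m x) *m x^t* = X.
    by rewrite !mulmxA x1 mul1mx -mulmxA x1 mulmx1.
  set X' := x^t* *m X *m x in hX hXE *.
  have := dpiC_conj He hp X' hx; rewrite hXE => <-.
  rewrite -!mulmxA [(p x)^t* *m _]mulmxA p2 mul1mx.
  by rewrite (hvec_upper He hp hv hX) -scalemxAr.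
have hz w : reach e p (@qlow C m) (p x *m v) w -> u^t* *m w = 0.
  elim=> [//|c y z _ IH1 _ IH2|Y y qY _ IH].
    by rewrite mulmxDr -scalemxAr IH1 IH2 scaler0 addr0.
  rewrite mulmxA.
  have -> : u^t* *m d Y = (d (Y^t*) *m u)^t* by rewrite ctmxM (dpiC_ct He hp) trmxCK.
  have hq' : qlow (Y^t*^t*) by rewrite trmxCK.
  by rewrite (quvec_act hu hq') ctmxZ -scalemxAl IH scaler0.
by apply: ker_adj; apply: hz; exact: hall.
Qed.

(** A raising operator of K maps J vmu to J of a vector of higher weight, which is 0 by maximality,
    [J] being injective. A lowering operator inside gl_m then kills J vmu by [lower_norm], because
    the diagonal eigenvalues agree there. *)
Lemma K_hvec (J : 'M[C]_(N, N')) chi dl vmu :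
  (forall g, inK g -> J *m q g = p g *m J) ->
  (forall t, inSU (diag_mx t) -> q (diag_mx t) *m vmu = chi t *: vmu) ->
  (forall (k l : 'I_m.+2) w, (k < l)%N -> (k < 2)%N = (l < 2)%N ->
     weightvec q (fun t => t 0 k * (t 0 l)^* * chi t) w -> w = 0) ->
  (forall k, d (E k k) *m (J *m vmu) = dl k *: (J *m vmu)) ->
  (forall k l : 'I_m.+2, (1 < k)%N -> (1 < l)%N -> dl k = dl l) ->
  quvec dl (J *m vmu).
Proof.
move=> hJ hchi hhw hdl hdl2; have [->|J0] := eqVneq J 0.
  by split=> *; rewrite mul0mx !mulmx0 ?scaler0.
have [c c0 cE] := schur_isometry hq urepK iq hJ J0.
have Jinj w : J *m w = 0 -> w = 0.
  move=> h; have : J^t* *m (J *m w) = 0 by rewrite h mulmx0.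
  by rewrite mulmxA cE mul_scalar_mx => /eqP; rewrite scaler_eq0 (negbTE c0) => /eqP.
have dK t : inSU (diag_mx t) -> inK (diag_mx t).
  by move=> ht; split=> //; exact: blk_diag.
have wJ : weightvec p chi (J *m vmu).
  by move=> t ht; rewrite mulmxA -hJ ?hchi -?mulmxA ?hchi ?scalemxAr //; exact: dK.
have raise (k l : 'I_m.+2) : (k < l)%N -> (k < 2)%N = (l < 2)%N -> d (E k l) *m (J *m vmu) = 0.
  move=> kl bl; have [B hB] : exists B, d (E k l) *m J = J *m B.
    apply: dpiC_K => // a b ab; rewrite mxE; case: andP => // -[/eqP ak /eqP bl'].
    by move: ab; rewrite ak bl' bl eqxx.
  rewrite mulmxA hB -mulmxA (hhw k l (B *m vmu)) ?mulmx0 // => t ht.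
  have hw := wvec_delta He hp k l wJ ht.
  have hE : d (E k l) *m (J *m vmu) = J *m (B *m vmu) by rewrite mulmxA hB mulmxA.
  rewrite hE in hw.
  apply/eqP; rewrite -subr_eq0; apply/eqP; apply: Jinj.
  by rewrite mulmxBr [J *m (q _ *m _)]mulmxA (hJ _ (dK _ ht)) -mulmxA hw scalemxAr subrr.
split=> // k l kl bl.
have [klt _|lk] := ltnP k l; first exact: raise.
have lk' : (l < k)%N by rewrite ltn_neqAle lk andbT eq_sym.
move=> /= l2.
have k2 : (1 < k)%N by exact: ltn_trans lk'.
have l_k : l != k by rewrite eq_sym.
have := lower_norm He hp l_k (raise l k lk' (esym bl)) (hdl l) (hdl k).
rewrite (hdl2 l k l2 k2) subrr scale0r; exact: ker_adj.
Qed.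

(** By [generic_pairing] a single number, the pairing of J vmu with p(x) v, detects whether [J]
    vanishes; a suitable multiple of [J2] cancels it for [J1]. *)
Theorem multiplicity_one (J1 J2 : 'M[C]_(N, N')) dd v dl vmu : irr (@inSU C m.+1) p ->
  hvec e p dd v -> v != 0 ->
  (forall g, inK g -> J1 *m q g = p g *m J1) ->
  (forall g, inK g -> J2 *m q g = p g *m J2) ->
  quvec dl (J1 *m vmu) -> quvec dl (J2 *m vmu) -> vmu != 0 -> J2 != 0 ->
  exists c, J1 = c *: J2.
Proof.
move=> ip hv v0 hJ1 hJ2 q1 q2 vmu0 J20.
have [x [hx hflag]] := generic_flag C hm.
pose al := ((J1 *m vmu)^t* *m (p x *m v)) 0 0.
pose be := ((J2 *m vmu)^t* *m (p x *m v)) 0 0.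
have kerP (J : 'M[C]_(N, N')) : (forall g, inK g -> J *m q g = p g *m J) ->
    J *m vmu = 0 -> J = 0.
  move=> hJ h0; apply: mulmx_ext => y; rewrite mul0mx.
  apply: (irr_ind (P := fun y => J *m y = 0) iq _ _ h0 vmu0).
    by split=> [|c a b ha hb]; rewrite ?mulmx0 // mulmxDr -scalemxAr ha hb scaler0 addr0.
  by move=> g z hg hz; rewrite mulmxA hJ // -mulmxA hz mulmx0.
have be0 : be != 0.
  apply: contra_neq J20 => be0; apply: kerP => //.
  apply: (generic_pairing ip hv v0 hx hflag q2).
  by rewrite [LHS]mx11_scalar -/be be0 raddf0.
(* Conjugated because the pairing is antilinear in its first argument. *)
pose c := (al / be)^*.
exists c; apply/eqP; rewrite -subr_eq0; apply/eqP; apply: kerP.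
  by move=> g hg; rewrite mulmxBl mulmxBr hJ1 // -scalemxAl hJ2 // scalemxAr.
have qc : quvec dl ((J1 - c *: J2) *m vmu).
  have [[a1 b1] [a2 b2]] := (q1, q2).
  split=> [k l h1 h2 h3|k]; rewrite mulmxBl -scalemxAl mulmxBr -scalemxAr.
    by rewrite a1 // a2 // scaler0 subrr.
  by rewrite b1 b2 scalerBr !scalerA [c * _]mulrC.
apply: (generic_pairing ip hv v0 hx hflag qc).
rewrite mulmxBl -scalemxAl ctmxD ctmxN ctmxZ conjCK mulmxBl -scalemxAl.
rewrite [X in X - _]mx11_scalar [X in _ - _ *: X]mx11_scalar -/al -/be.
by rewrite scale_scalar_mx mulfVK // subrr.
Qed.

End Pair.
End Multiplicity.

(** * The exponential on the imaginary axis of the complex numbers *)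

Section ComplexExp.
Variable R : realType.
Local Notation C := (cplx R).

Definition cexpi (t : R) : C := Complex (cos t) (sin t).

Lemma cexpiD s t : cexpi (s + t) = cexpi s * cexpi t.
Proof.
by rewrite /cexpi cosD sinD; apply/eqP; rewrite eq_complex /= [sin s * _ + _]addrC !eqxx.
Qed.

Lemma cexpi0 : cexpi 0 = 1.
Proof. by rewrite /cexpi cos0 sin0. Qed.

Lemma conj_cexpi t : (cexpi t)^* = cexpi (- t).
Proof. by rewrite /cexpi cosN sinN. Qed.

Lemma cexpi_neq0 t : cexpi t != 0.
Proof.
apply/eqP => h; have := cexpiD t (- t).
by rewrite subrr cexpi0 h mul0r => /eqP; rewrite oner_eq0.
Qed.

Lemma Complex_split (a b : R) : (Complex a b : C) = a%:C%C + 'i * b%:C%C.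
Proof.
by apply/eqP; rewrite eq_complex /= !(mul0r, mul1r, mulr0, addr0, add0r, subr0) !eqxx.
Qed.

Lemma cvg_Complex (u v : nat -> R) (a b : R) :
  u @ \oo --> a -> v @ \oo --> b ->
  (fun n => Complex (u n) (v n) : C) @ \oo --> (Complex a b : C).
Proof.
move=> /cvgrPdist_lt hu /cvgrPdist_lt hv; apply/cvgrPdist_lt => e e0.
have [e' e'0 ee] : exists2 e' : R, 0 < e' & e = e'%:C%C + e'%:C%C.
  exists (complex.Re e / 2).
    by move: e0; rewrite ltcE /= => /andP[_ h]; rewrite divr_gt0.
  move: e0; rewrite -rmorphD -splitr ltcE /= => /andP[/eqP h _].
  by case: (e) h => x y /= ->.
near=> n.
have -> : (Complex a b : C) - Complex (u n) (v n) =
   (a - u n)%:C%C + 'i * (b - v n)%:C%C.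
  by rewrite -Complex_split; apply/eqP; rewrite eq_complex /= !eqxx.
apply: le_lt_trans (ler_normD _ _) _.
rewrite normrM normCi mul1r ee.
have h (x : R) : `|x%:C%C : C| = `|x|%:C%C.
  by rewrite normc_def /= expr0n /= addr0 sqrtr_sqr.
by apply: ltrD; rewrite h ltcR; near: n; [exact: hu|exact: hv].
Unshelve. all: by end_near.
Qed.

Lemma half_cvg0 : (fun k => 2 ^- k : R) @ \oo --> (0 : R).
Proof.
rewrite (_ : (fun k => _) = GRing.exp (2^-1 : R)); last by apply/funext => k; rewrite exprVn.
apply: cvg_expr; by rewrite ger0_norm ?invr_ge0 // invf_lt1 // ltr1n.
Qed.

(** The difference quotient at 0 along the points 2^-k t, which avoid 0 when t is nonzero. *)
Lemma cvg_scale_inv (f : R -> R) (f' t : R) : f 0 = 0 -> is_derive (0 : R) (1 : R) f f' ->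
  (fun k => 2 ^+ k * f (2 ^- k * t)) @ \oo --> t * f'.
Proof.
move=> f0 df; have [->|t0] := eqVneq t 0.
  under eq_fun do rewrite mulr0 f0 mulr0.
  by rewrite mul0r; exact: cvg_cst.
have h : h^-1 * f h @[h --> (0 : R)^'] --> f'.
  have [df1 df2] := df; rewrite -df2.
  move: df1; rewrite /derivable /derive => df1.
  have := df1; rewrite /=.
  under [in X in X -> _]eq_fun do rewrite /= f0 addr0 subr0 -[_ *: 1]/(_ * 1) mulr1.
  under [in X in _ -> _ --> X]eq_fun do rewrite /= f0 addr0 subr0 -[_ *: 1]/(_ * 1) mulr1.
  by [].
have hn : (fun k => 2 ^- k * t) @ \oo --> (0 : R).
  by rewrite -(mul0r t); apply: cvgM; [exact: half_cvg0|exact: cvg_cst].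
have p0 k : 2 ^+ k != 0 :> R by rewrite expf_neq0 // pnatr_eq0.
have hn0 k : 2 ^- k * t != 0 by rewrite mulf_neq0 // invr_neq0.
have /cvgr_dnbhsP/(_ (fun k => 2 ^- k * t) (conj hn0 hn)) h' := h.
rewrite (_ : (fun k => _) = (fun k => t * ((2 ^- k * t)^-1 * f (2 ^- k * t)))).
  by apply: cvgM => //; exact: cvg_cst.
apply/funext => k.
by rewrite invfM invrK mulrA [t * (_ * _)]mulrCA mulfV // mulr1.
Qed.

Lemma cvg_cexpi (t : R) :
  (fun k => 2 ^+ k * (cexpi (2 ^- k * t) - 1)) @ \oo --> (Complex 0 t : C).
Proof.
have -> : (Complex 0 t : C) = Complex (t * - sin 0) (t * cos 0).
  by rewrite sin0 cos0 oppr0 mulr0 mulr1.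
have -> : (fun k => 2 ^+ k * (cexpi (2 ^- k * t) - 1)) =
  (fun k => Complex (2 ^+ k * (cos (2 ^- k * t) - 1)) (2 ^+ k * sin (2 ^- k * t)) : C).
  apply/funext => k.
  have -> : (2 ^+ k : C) = (2 ^+ k : R)%:C%C by rewrite rmorphXn rmorph_nat.
  by apply/eqP; rewrite eq_complex /= !(mul0r, mulr0, addr0, add0r, subr0) !eqxx.
apply: cvg_Complex.
  apply: (@cvg_scale_inv (fun x => cos x - 1)); first by rewrite cos0 subrr.
  by apply: is_derive_eq; rewrite subr0.
exact: (@cvg_scale_inv sin _ _ (sin0 _) (is_derive_sin 0)).
Qed.

Lemma norm1_complex (x y : R) : `|Complex x y : C| = 1 -> x ^+ 2 + y ^+ 2 = 1.
Proof.
rewrite normc_def => /eqP; rewrite eq_complex /= => /andP[/eqP h1 _].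
have := congr1 (fun z => z ^+ 2) h1; rewrite sqr_sqrtr ?addr_ge0 ?sqr_ge0 //.
by move=> ->; rewrite /= expr1n.
Qed.

Lemma ReE (z : C) : 'Re z = (complex.Re z)%:C%C.
Proof.
case: z => x y /=; rewrite Complex_split Re_rect //.
- by apply/CrealP; exact: conjc_real.
- by apply/CrealP; exact: conjc_real.
Qed.

(** It reads the imaginary part alone and so agrees with the exponential on the imaginary axis. *)
Definition ei (z : C) : C := cexpi (complex.Im z).

Lemma im_complex (z : C) : im z -> z = Complex 0 (complex.Im z).
Proof.
case: z => x y; rewrite /im => /eqP; rewrite eq_complex /= => /andP[/eqP h _].
by have -> : x = 0 by lra.
Qed.

Lemma halfE k : (2 ^- k : C) = (2 ^- k : R)%:C%C.
Proof. by rewrite fmorphV rmorphXn rmorph_nat. Qed.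

Lemma Im_half k (z : C) : complex.Im (2 ^- k * z) = 2 ^- k * complex.Im z.
Proof. by rewrite halfE; case: z => x y /=; rewrite mul0r addr0. Qed.

Lemma cvg_Im (u : nat -> C) (x : C) : u @ \oo --> x ->
  (fun k => complex.Im (u k)) @ \oo --> complex.Im x.
Proof.
move=> /cvgrPdist_lt h; apply/cvgrPdist_lt => eps e0.
have e0' : 0 < eps%:C%C :> C by rewrite ltcR.
near=> k.
have : `|x - u k| < eps%:C%C by near: k; exact: h.
rewrite normc_def ltcR; apply: le_lt_trans.
have -> : complex.Im x - complex.Im (u k) = complex.Im (x - u k).
  by case: (x) => ? ?; case: (u k).
case: (x - u k) => a b /=.
by rewrite -sqrtr_sqr ler_sqrt ?addr_ge0 ?sqr_ge0 // lerDr sqr_ge0.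
Unshelve. all: by end_near.
Qed.

Lemma is_expi_ei : is_expi ei.
Proof.
split.
- by move=> x y _ _; rewrite /ei -cexpiD; congr cexpi; case: x => ? ?; case: y.
- by move=> x; exact: cexpi_neq0.
- by move=> x _; rewrite /ei conj_cexpi; congr cexpi; case: x.
(* The values of [acos] lie between 0 and pi, so the sign of the angle is taken from [y]. *)
- case=> x y /norm1_complex h2.
  have hx : -1 <= x <= 1 by have := sqr_ge0 y; nra.
  have [y0|y0] := leP 0 y.
    exists (Complex 0 (acos x)).
      by rewrite /im; apply/eqP; rewrite eq_complex /= oppr0 !eqxx.
    apply/eqP; rewrite eq_complex /= acosK ?in_itv //= eqxx /=.
    by rewrite sin_acos // -h2 addrC addKr sqrtr_sqr ger0_norm.
  exists (Complex 0 (- acos x)).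
    by rewrite /im; apply/eqP; rewrite eq_complex /= oppr0 !eqxx.
  apply/eqP; rewrite eq_complex /= cosN sinN acosK ?in_itv //= eqxx /=.
  by rewrite sin_acos // -h2 addrC addKr sqrtr_sqr ltr0_norm // opprK.
(* With positive real part the angle is [asin y], strictly between -pi/2 and pi/2, an interval
   preserved by halving. *)
- case=> x y /norm1_complex h2; rewrite ReE ltcR /= => x0.
  have hy : -1 < y < 1 by nra.
  have /andP[hy1 hy2] := hy.
  have hy' : -1 <= y <= 1 by rewrite !ltW.
  exists (Complex 0 (asin y)); split.
  + by rewrite /im; apply/eqP; rewrite eq_complex /= oppr0 !eqxx.
  + apply/eqP; rewrite eq_complex /= cos_asin // asinK ?in_itv //= eqxx andbT.
    by rewrite -h2 addrK sqrtr_sqr gtr0_norm.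
  move=> k; rewrite ReE ltcR /ei Im_half /=; apply: cos_gt0_pihalf.
  have [h1 h3] : - (pi / 2) < asin y /\ asin y < pi / 2
    by split; [apply: asin_gtNpi2|apply: asin_ltpi2]; rewrite ?hy1 ?hy2 ?ltW.
  have hk : 0 < (2 ^- k : R) <= 1.
    by rewrite invr_gt0 exprn_gt0 //= invf_le1 ?exprn_gt0 // exprn_ege1 // ler1n.
  have /andP[k0 k1] := hk.
  have pi0 : 0 < pi / 2 :> R by rewrite divr_gt0 // pi_gt0.
  apply/andP; split; nra.
- have -> : (fun k => 2 ^- k : C) = (fun k => Complex (2 ^- k) 0 : C).
    by apply/funext => k; rewrite halfE.
  by apply: cvg_Complex; [exact: half_cvg0|exact: cvg_cst].
- move=> u x _ _ hu; have hI := cvg_Im hu; apply: cvg_Complex.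
    by apply: (@cvg_comp _ _ _ _ cos _ _ _ hI); exact: continuous_cos.
  by apply: (@cvg_comp _ _ _ _ sin _ _ _ hI); exact: continuous_sin.
- case=> r s t0; have [r0 s0] : 0 <= r /\ s = 0.
    by move: t0; rewrite lecE /= => /andP[/eqP ->].
  (* Truncating r 2^k leaves an error of at most 2^-k after rescaling. *)
  exists (fun k => Num.truncn (r * 2 ^+ k)).
  have -> : (fun k => 2 ^- k * (Num.truncn (r * 2 ^+ k))%:R : C) =
     (fun k => Complex (2 ^- k * (Num.truncn (r * 2 ^+ k))%:R) 0 : C).
    apply/funext => k; rewrite halfE -[(Num.truncn _)%:R](rmorph_nat (real_complex R)).
    by rewrite -rmorphM.
  rewrite s0; apply: cvg_Complex; last exact: cvg_cst.
  apply/cvgrPdist_lt => eps e0.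
  have /cvgrPdist_lt/(_ eps e0) h := half_cvg0.
  near=> k; have hk : `|0 - 2 ^- k| < eps by near: k; exact: h.
  apply: le_lt_trans hk; rewrite sub0r normrN.
  have p0 : 0 < 2 ^+ k :> R by rewrite exprn_gt0.
  have r2 : 0 <= r * 2 ^+ k by rewrite mulr_ge0 // ltW.
  have /andP[h1 h2] := truncn_itv r2.
  have -> : r - 2 ^- k * (Num.truncn (r * 2 ^+ k))%:R =
     2 ^- k * (r * 2 ^+ k - (Num.truncn (r * 2 ^+ k))%:R).
    by rewrite mulrBr mulrCA mulVf ?mulr1 // gt_eqF.
  rewrite normrM -[leRHS]mulr1 ler_wpM2l // ger0_norm ?subr_ge0 //.
  by rewrite lerBlDl natr1 ltW.
- move=> x /im_complex hx; rewrite [X in _ --> X]hx.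
  rewrite (_ : (fun k => _) = (fun k => 2 ^+ k * (cexpi (2 ^- k * complex.Im x) - 1))).
    exact: cvg_cexpi.
  by apply/funext => k; rewrite /ei Im_half.
Unshelve. all: by end_near.
Qed.

End ComplexExp.

(** * Exterior and symmetric powers *)

Section CauchyBinet.
Variables (m l : nat).
Local Notation idx := 'I_#|{: lset m l}|.

Definition lnth (S : idx) (p : 'I_l) : 'I_m.+2 := lset_nth S p.

Lemma lset_card (S : idx) : #|sval (enum_val S)| = l.
Proof. by have /eqP := svalP (enum_val S). Qed.

Lemma lnth_inj S : injective (lnth S).
Proof.
move=> p q /eqP; rewrite /lnth /lset_nth nth_uniq ?enum_uniq -?cardE ?lset_card //.
by move/eqP/val_inj.
Qed.

Lemma lnth_in S p : lnth S p \in sval (enum_val S).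
Proof. by rewrite -mem_enum mem_nth // -cardE lset_card. Qed.

Lemma lnth_image S : lnth S @: 'I_l = sval (enum_val S).
Proof.
apply/eqP; rewrite eqEcard card_imset; last exact: lnth_inj.
rewrite lset_card card_ord leqnn andbT.
by apply/fintype.subsetP => _ /imsetP[p _ ->]; exact: lnth_in.
Qed.

Lemma lnth_uniq S T (f g : 'I_l -> 'I_l) : injective f -> injective g ->
  (forall p, lnth S (f p) = lnth T (g p)) -> S = T.
Proof.
move=> hf hg h; apply: enum_val_inj; apply: val_inj => /=.
suff E : forall U k, injective k -> (lnth U \o k) @: 'I_l = sval (enum_val U).
  rewrite -(E S f hf) -(E T g hg); apply: eq_imset => p; exact: h.
move=> U k hk; apply/eqP; rewrite eqEcard card_imset; last exact: inj_comp (@lnth_inj U) hk.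
rewrite lset_card card_ord leqnn andbT.
by apply/fintype.subsetP => _ /imsetP[p _ ->]; exact: lnth_in.
Qed.

Lemma lset_of (S : {set 'I_m.+2}) : #|S| = l -> exists T : idx, sval (enum_val T) = S.
Proof.
move=> /eqP hS; exists (enum_rank (exist _ S hS : lset m l)).
by rewrite enum_rankK.
Qed.

(** An injective choice of indices is the increasing enumeration of its image, preceded by a
    permutation. *)
Lemma lset_ffun (f : {ffun 'I_l -> 'I_m.+2}) : injective f ->
  exists T : idx, exists s : {perm 'I_l}, forall p, f p = lnth T (s p).
Proof.
move=> fi; have /lset_of[T hT] : #|f @: 'I_l| = l.
  by rewrite card_imset // card_ord.
have hp p : exists q, lnth T q == f p.
  have : f p \in sval (enum_val T) by rewrite hT imset_f.
  by rewrite -lnth_image => /imsetP[q _ ->]; exists q.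
pose s p := xchoose (hp p).
have sP p : lnth T (s p) = f p by exact/eqP/(xchooseP (hp p)).
have si : injective s by move=> p q h; apply: fi; rewrite -!sP h.
by exists T, (perm si) => p; rewrite permE sP.
Qed.

(** The determinant is expanded over all maps f from rows to indices. A map that is not injective
    contributes a determinant with two equal rows; an injective one splits into a set and a
    permutation, and summing over the permutations gives the minor of [A]. *)
Theorem cauchy_binet (R : comNzRingType) (A : 'M[R]_(l, m.+2)) (B : 'M[R]_(m.+2, l)) :
  \det (A *m B) = \sum_(S : idx) \det (colsub (lnth S) A) * \det (rowsub (lnth S) B).
Proof.
have -> : \det (A *m B) = \sum_(f : {ffun 'I_l -> 'I_m.+2})
   (\prod_p A p (f p)) * \det (rowsub f B).
  under [RHS]eq_bigr => f _ do rewrite /determinant big_distrr /=.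
  rewrite exchange_big /=; apply: eq_bigr => s _.
  under eq_bigr => p _ do rewrite mxE.
  rewrite bigA_distr_bigA /= big_distrr /=; apply: eq_bigr => f _.
  by rewrite mulrCA -big_split /=; congr (_ * _); apply: eq_bigr => p _; rewrite mxE.
under [RHS]eq_bigr => S _ do rewrite /(\det (colsub _ _)) big_distrl /=.
under [RHS]eq_bigr => S _ do under eq_bigr => s _ do rewrite -mulrA.
rewrite (bigID (fun f : {ffun _} => injectiveb f)) /= addrC big1 ?add0r; last first.
  move=> f /injectivePn[p [q pq fpq]]; rewrite [\det _](determinant_alternate pq) ?mulr0 //.
  by move=> k; rewrite !mxE fpq.
(* The bijection between pairs (set, permutation) and injective maps. *)
pose F (x : idx * {perm 'I_l}) := [ffun p => lnth x.1 (x.2 p)] : {ffun 'I_l -> 'I_m.+2}.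
have Finj : injective F.
  move=> [S s] [T t] /ffunP h.
  have ST : S = T.
    by apply: (lnth_uniq (@perm_inj _ s) (@perm_inj _ t)) => p; have := h p; rewrite !ffunE.
  move: h; rewrite ST => h; congr pair; apply/perm.permP => p.
  by apply: (@lnth_inj T); have := h p; rewrite !ffunE.
rewrite (eq_bigl (fun f => f \in F @: finset.setT)); last first.
  move=> f; apply/injectiveP/imsetP => [/lset_ffun[T [s h]]|[[S s] _ ->]].
    by exists (T, s) => //; apply/ffunP => p; rewrite ffunE.
  by move=> p q; rewrite !ffunE => /lnth_inj/perm_inj.
rewrite big_imset /=; last by move=> ? ? _ _; exact: Finj.
rewrite (eq_bigl xpredT) => [|x]; last by rewrite finset.in_setT.
rewrite [RHS]pair_big /=; apply: eq_bigr => -[S s] _ /=.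
rewrite [LHS]mulrC [RHS]mulrCA [RHS]mulrC; congr (_ * _); last first.
  by apply: eq_bigr => p _; rewrite !mxE ffunE.
have -> : rowsub (F (S, s)) B = row_perm s (rowsub (lnth S) B).
  by apply/matrixP => p q; rewrite !mxE ffunE.
by rewrite row_permE det_mulmx det_perm.
Qed.

End CauchyBinet.

Section Exterior.
Variables (C : numClosedFieldType) (m : nat).
Local Notation M := 'M[C]_m.+2.

(* Over C = cplx R, [awedge], [aLam], [asymvec], [aSym], [achar], [aevec], [aaelt], [av1], ...
   are convertible to the definitions without the initial a. *)
Definition awedge (l : nat) (v : 'I_l -> 'cV[C]_m.+2) : 'cV[C]_#|{: lset m l}| :=
  \col_S \det (\matrix_(p < l, q < l) v q (lset_nth S p) 0).

Definition aLam (l : nat) (g : M) : 'M[C]_#|{: lset m l}| :=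
  \matrix_(S, T) awedge (fun q : 'I_l => col (lset_nth T q) g) S 0.

Lemma aLamE l (g : M) S T : aLam l g S T = \det (mxsub (@lnth m l S) (@lnth m l T) g).
Proof. by rewrite !mxE; congr (\det _); apply/matrixP => p q; rewrite !mxE. Qed.

Lemma awedgeE l (v : 'I_l -> 'cV[C]_m.+2) S :
  awedge v S 0 = \det (rowsub (@lnth m l S) (\matrix_(p, q) v q p 0)).
Proof. by rewrite !mxE; congr (\det _); apply/matrixP => p q; rewrite !mxE. Qed.

(** The entries of [aLam l g] are the minors of g, so multiplicativity is the Cauchy-Binet
    formula. *)
Lemma aLamM l (g h : M) : aLam l (g *m h) = aLam l g *m aLam l h.
Proof.
apply/matrixP => S T; rewrite aLamE mxE.
have -> : mxsub (@lnth m l S) (@lnth m l T) (g *m h) =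
  rowsub (@lnth m l S) g *m colsub (@lnth m l T) h.
  by apply/matrixP => p q; rewrite !mxE; apply: eq_bigr => k _; rewrite !mxE.
rewrite cauchy_binet; apply: eq_bigr => U _; rewrite !aLamE.
by rewrite -!mxsub_comp; congr (\det _ * \det _); apply/matrixP => p q; rewrite !mxE.
Qed.

Lemma aLam_wedge l (g : M) (v : 'I_l -> 'cV[C]_m.+2) :
  aLam l g *m awedge v = awedge (fun q => g *m v q).
Proof.
apply/colP => S; rewrite awedgeE mxE.
have -> : rowsub (@lnth m l S) (\matrix_(p, q) (g *m v q) p 0) =
  rowsub (@lnth m l S) g *m (\matrix_(p, q) v q p 0).
  by apply/matrixP => p q; rewrite !mxE; apply: eq_bigr => k _; rewrite !mxE.
rewrite cauchy_binet; apply: eq_bigr => U _; rewrite awedgeE aLamE.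
by congr (\det _ * _); apply/matrixP => p q; rewrite !mxE.
Qed.

(** The Gram determinant, again by Cauchy-Binet. *)
Lemma awedge_dot l (v w : 'I_l -> 'cV[C]_m.+2) :
  ((awedge v)^t* *m awedge w) 0 0 = \det (\matrix_(p, q) ((v p)^t* *m w q) 0 0).
Proof.
have -> : (\matrix_(p, q) ((v p)^t* *m w q) 0 0) =
  (\matrix_(p, q) v q p 0)^t* *m (\matrix_(p, q) w q p 0).
  by apply/matrixP => p q; rewrite !mxE; apply: eq_bigr => k _; rewrite !mxE.
rewrite cauchy_binet mxE; apply: eq_bigr => S _; rewrite !mxE.
congr (_ * _); last by congr (\det _); apply/matrixP => p q; rewrite !mxE.
by rewrite -det_map_mx -det_tr; congr (\det _); apply/matrixP => p q; rewrite !mxE.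
Qed.

Lemma aLam_ct l (g : M) : aLam l (g^t*) = (aLam l g)^t*.
Proof.
apply/matrixP => S T; rewrite aLamE [RHS]mxE [in RHS]mxE aLamE -det_map_mx -det_tr.
by congr (\det _); apply/matrixP => p q; rewrite !mxE.
Qed.

Lemma aLam_diag l (t : 'rV[C]_m.+2) :
  aLam l (diag_mx t) = diag_mx (\row_(S < #|{: lset m l}|) \prod_(k in sval (enum_val S)) t 0 k).
Proof.
apply/matrixP => S T; rewrite aLamE 2!mxE; have [<-|ST] := eqVneq S T.
  rewrite -lnth_image big_imset /=; last by move=> ? ? _ _; exact: lnth_inj.
  rewrite (_ : mxsub _ _ _ = diag_mx (\row_p t 0 (lnth S p))) ?det_diag.
    by under eq_bigr do rewrite mxE.
  by apply/matrixP => p q; rewrite !mxE (inj_eq (@lnth_inj _ _ S)).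
rewrite mulr0n.
(* Two distinct sets of the same size: the row of an element of S outside T vanishes in the
   minor. *)
have [p hp] : exists p, lnth S p \notin sval (enum_val T).
  apply/existsP; apply: contraNT ST => /existsPn h; apply/eqP.
  apply: enum_val_inj; apply: val_inj => /=; apply/eqP.
  rewrite eqEcard !lset_card leqnn andbT -lnth_image.
  by apply/fintype.subsetP => _ /imsetP[p _ ->]; have := h p; rewrite negbK.
rewrite (expand_det_row _ p) big1 // => q _; rewrite !mxE.
case: eqP => [E|_]; last by rewrite mulr0n mul0r.
by move: hp; rewrite E lnth_in.
Qed.

Lemma cvg_det l (A : nat -> 'M[C]_l) L : mcv A L -> (fun k => \det (A k)) @ \oo --> \det L.
Proof.
case=> h; apply: cvg_bigsum => s; apply: cvgM; first exact: cvg_cst.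
by apply: cvg_bigprod => p.
Qed.

Lemma aLam_cont l (g : nat -> M) h : mcv g h -> mcv (fun k => aLam l (g k)) (aLam l h).
Proof.
case=> H; apply: Mcv => S T; rewrite aLamE.
rewrite (_ : (fun k => _) = fun k => \det (mxsub (@lnth m l S) (@lnth m l T) (g k))).
  by apply: cvg_det; apply: Mcv => p q; rewrite mxE; under eq_fun do rewrite mxE; exact: H.
by apply/funext => k; rewrite aLamE.
Qed.

End Exterior.

(** * Symmetric powers and powers of linear forms *)

Section Symmetric.
Variables (C : numClosedFieldType) (m : nat).
Local Notation M := 'M[C]_m.+2.
Local Notation P := (mpoly m.+2 C).

Definition linear_form (c : 'cV[C]_m.+2) : P := \sum_j c j 0 *: mpolyX C (mnm1 j).

Definition mfact (al : multinom m.+2) : nat := \prod_p (al p)`!.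

Lemma mfact_neq0 al : (mfact al)%:R != 0 :> C.
Proof. by rewrite pnatr_eq0 -lt0n prodn_gt0 // => p; rewrite fact_gt0. Qed.

Lemma deriv_linear_form_exp c i N :
  mderiv i (linear_form c ^+ N.+1) = (c i 0 *+ N.+1) *: linear_form c ^+ N.
Proof.
have d1 : mderiv i (linear_form c) = mpolyC m.+2 (c i 0).
  rewrite /linear_form raddf_sum (bigD1 i) //= big1 => [|j ji].
    have E : mnm_sub (mnm1 i) (mnm1 i) = mnm0 :> multinom m.+2.
      by apply/mnmP => j; rewrite mnmBE mnm0E subnn.
    rewrite linearZ /= mderivX mnm1E eqxx E mulr1n addr0 -mul_mpolyC mpolyX0.
    by rewrite scale1r mulr1.
  by rewrite linearZ /= mderivX mnm1E (negbTE ji) mulr0n scale0r scaler0.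
elim: N => [|N IH]; first by rewrite expr1 d1 expr0 -mul_mpolyC mulr1.
rewrite exprS mderivM d1 IH mul_mpolyC -scalerAr -exprS -scalerDl; congr (_ *: _).
Qed.

(** The multinomial theorem, by induction on N: differentiating in a variable that occurs in the
    monomial lowers the power of the linear form by one. *)
Lemma linear_form_coef c N (al : multinom m.+2) : mdeg al = N ->
  mcoeff al (linear_form c ^+ N) = N`!%:R / (mfact al)%:R * \prod_p c p 0 ^+ al p.
Proof.
elim: N al => [|N IH] al.
  move=> /eqP; rewrite mdeg_eq0 => /eqP ->; rewrite expr0 mcoeff1 eqxx /mfact.
  rewrite !big1 ?divr1 ?mulr1 // => p _; rewrite mnm0E //.
move=> hal; have [i hi] : exists i, al i != 0.
  apply/existsP; apply: contra_eqT hal => /existsPn h.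
  by rewrite mdegE big1 // => p _; apply/eqP; have := h p; rewrite negbK.
have [be E] : exists be : multinom m.+2, al = (mnm_add be (mnm1 i)).
  by exists (mnm_sub al (mnm1 i)); rewrite submK // lep1mP.
rewrite {}E in hal *.
have fE : mfact (mnm_add be (mnm1 i)) = ((be i).+1 * mfact be)%N.
  rewrite /mfact (bigD1 i) //= [in RHS](bigD1 i) //= mnmDE mnm1E eqxx addn1 factS mulnA.
  by congr (_ * _)%N; apply: eq_bigr => p pi; rewrite mnmDE mnm1E eq_sym (negbTE pi) addn0.
have cE : \prod_p c p 0 ^+ (mnm_add be (mnm1 i)) p = c i 0 * \prod_p c p 0 ^+ be p.
  rewrite (bigD1 i) //= [in RHS](bigD1 i) //= mnmDE mnm1E eqxx addn1 exprS mulrA.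
  by congr (_ * _); apply: eq_bigr => p pi; rewrite mnmDE mnm1E eq_sym (negbTE pi) addn0.
move: hal; rewrite mdegD mdeg1 addn1 => -[hbe].
have := mcoeff_deriv i be (linear_form c ^+ N.+1); rewrite deriv_linear_form_exp mcoeffZ IH // => h.
have b0 : (be i).+1%:R != 0 :> C by rewrite pnatr_eq0.
apply: (mulIf b0); rewrite mulr_natr -h cE fE factS !natrM.
have f0 := mfact_neq0 be; rewrite -mulr_natr.
move: b0 f0; move: (be i).+1%:R (mfact be)%:R => b f b0 f0.
by field; rewrite b0 f0.
Qed.

Lemma homog_expand N (p : P) : (forall al, mdeg al != N -> mcoeff al p = 0) ->
  p = \sum_(k < #|{: monomial m N}|) mcoeff (exponent k) p *: mpolyX C (exponent k).
Proof.
move=> hp; apply/mpolyP => al; rewrite raddf_sum /=.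
under eq_bigr => k _ do rewrite mcoeffZ mcoeffX.
have [hal|hal] := eqVneq (mdeg al) N; last first.
  rewrite hp // big1 // => k _; case: eqP => [E|]; rewrite ?mulr0 //.
  by move: hal; rewrite -E /exponent; have /eqP -> := svalP (enum_val k); rewrite eqxx.
have hb : (mdeg al < N.+1)%N by rewrite hal.
have hc : mdeg (BMultinom hb) == N by rewrite /= hal.
pose x : monomial m N := exist _ (BMultinom hb) hc.
have kE : exponent (enum_rank x) = al by rewrite /exponent enum_rankK.
rewrite (bigD1 (enum_rank x)) //= kE eqxx mulr1 big1 ?addr0 // => k kx.
case: eqP => [E|]; rewrite ?mulr0 //; case/eqP: kx.
by apply: enum_val_inj; rewrite enum_rankK; do 2 apply: val_inj.
Qed.

Lemma exponent_deg N (k : 'I_#|{: monomial m N}|) : mdeg (exponent k) = N.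
Proof. by have /eqP := svalP (enum_val k). Qed.

Lemma exponent_inj N : injective (@exponent m N).
Proof. by move=> k l h; apply: enum_val_inj; do 2 apply: val_inj. Qed.

Lemma linear_form_exp_homog c N al : mdeg al != N -> mcoeff al (linear_form c ^+ N) = 0.
Proof.
elim: N al => [|N IH] al h.
  by rewrite expr0 mcoeff1; rewrite -mdeg_eq0 (negbTE h).
rewrite exprSr /linear_form mulr_sumr raddf_sum /= big1 // => j _.
rewrite -scalerAr mcoeffZ; have [ha|ha] := eqVneq (al j) 0%N.
  rewrite mcoeffMr big1 ?mulr0 // => -[k l] /= /eqP E.
  rewrite mcoeffX; case: eqP => [jl|]; rewrite ?mulr0 //.
  by move: (congr1 (fun x : multinom _ => x j) E) => /=; rewrite ha -jl mnmDE mnm1E eqxx add1n.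
have [be E] : exists be : multinom m.+2, al = (mnm_add be (mnm1 j)).
  by exists (mnm_sub al (mnm1 j)); rewrite submK // lep1mP.
rewrite E addmC mcoeffMX -/(linear_form c) IH ?mulr0 //.
by apply: contra h => /eqP <-; rewrite E mdegD mdeg1 addn1.
Qed.

Variables (N : nat) (nrm : multinom m.+2 -> C).
Hypothesis nrm_real : forall al, (nrm al)^* = nrm al.
Hypothesis nrm_sqr : forall al, nrm al ^+ 2 = (mfact al)%:R / N`!%:R.

Definition asubst (g : M) (p : P) : P :=
  comp_mpoly [tuple \sum_(j < m.+2) g j i *: mpolyX C (mnm1 j) | i < m.+2] p.

Definition asymvec (p : P) : 'cV[C]_#|{: monomial m N}| :=
  \col_k (nrm (exponent k) * mcoeff (exponent k) p).

Definition aSym (g : M) : 'M[C]_#|{: monomial m N}| :=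
  \matrix_(k, l) asymvec (asubst g ((nrm (exponent l))^-1 *: mpolyX C (exponent l))) k 0.

Lemma nrm_neq0 al : nrm al != 0.
Proof.
rewrite -sqrf_eq0 nrm_sqr mulf_neq0 ?invr_neq0 ?mfact_neq0 // pnatr_eq0 -lt0n fact_gt0 //.
Qed.

Lemma aSym_vec g p : (forall al, mdeg al != N -> mcoeff al p = 0) ->
  aSym g *m asymvec p = asymvec (asubst g p).
Proof.
move=> hp; apply/colP => k; rewrite [LHS]mxE [RHS]mxE [in RHS](homog_expand hp).
rewrite /asubst (raddf_sum (comp_mpoly _)) /= raddf_sum /= mulr_sumr; apply: eq_bigr => l _; rewrite !mxE.
rewrite /asubst !comp_mpolyZ !mcoeffZ; field; exact: nrm_neq0.
Qed.

Lemma asubst_lin g c : asubst g (linear_form c ^+ N) = linear_form (g *m c) ^+ N.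
Proof.
rewrite /asubst rmorphXn /=; congr (_ ^+ _).
rewrite /linear_form raddf_sum /=; under eq_bigr => j _ do
  rewrite comp_mpolyZ comp_mpolyXU -tnth_nth tnth_mktuple scaler_sumr.
rewrite exchange_big /=; apply: eq_bigr => j _; rewrite mxE scaler_suml.
by apply: eq_bigr => k _; rewrite scalerA mulrC.
Qed.

Lemma aSym_lin g c : aSym g *m asymvec (linear_form c ^+ N) = asymvec (linear_form (g *m c) ^+ N).
Proof. by rewrite aSym_vec ?asubst_lin // => al; exact: linear_form_exp_homog. Qed.

(** The squared norm al!/N! cancels one of the two multinomial coefficients; what remains is the
    multinomial expansion of the N-th power of <c, d>. *)
Lemma asymvec_dot (c d : 'cV[C]_m.+2) :
  ((asymvec (linear_form c ^+ N))^t* *m asymvec (linear_form d ^+ N)) 0 0 = ((c^t* *m d) 0 0) ^+ N.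
Proof.
(* The linear form with these coefficients takes the value <c, d> at (1, ..., 1). *)
pose cd : 'cV[C]_m.+2 := \col_j ((c j 0)^* * d j 0).
have -> : (c^t* *m d) 0 0 = meval (fun=> 1) (linear_form cd).
  rewrite mxE /linear_form raddf_sum /=; apply: eq_bigr => j _.
  by rewrite mevalZ mevalXU mulr1 !mxE.
rewrite -rmorphXn /= (homog_expand (@linear_form_exp_homog cd N)) raddf_sum /= mxE.
apply: eq_bigr => k _; rewrite mevalZ mevalX big1 => [|i _]; last by rewrite expr1n.
rewrite mulr1 !mxE !linear_form_coef ?exponent_deg // rmorphM /= nrm_real mulrACA -expr2 nrm_sqr.
rewrite !rmorphM /= fmorphV !rmorph_nat (rmorph_prod Num.conj) /=.
under [in RHS]eq_bigr => p _ do rewrite /cd mxE exprMn.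
rewrite big_split /=; under eq_bigr => p _ do rewrite rmorphXn.
have f0 := mfact_neq0 (exponent k).
have n0 : N`!%:R != 0 :> C by rewrite pnatr_eq0 -lt0n fact_gt0.
by field; rewrite f0 n0.
Qed.

Lemma aSym_diag (t : 'rV[C]_m.+2) :
  aSym (diag_mx t) = diag_mx (\row_(k < #|{: monomial m N}|) \prod_p t 0 p ^+ exponent k p).
Proof.
apply/matrixP => k l; rewrite !mxE /asubst comp_mpolyZ comp_mpolyX.
have -> : \prod_(i < m.+2) tnth [tuple \sum_(j < m.+2) diag_mx t j i *: mpolyX C (mnm1 j) | i < m.+2] i
   ^+ exponent l i = (\prod_p t 0 p ^+ exponent l p) *: mpolyX C (exponent l).
  rewrite [in RHS]mpolyXE_id -scaler_prod; apply: eq_bigr => i _.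
  rewrite tnth_mktuple (bigD1 i) //= big1 ?addr0 => [|j ji]; last by rewrite mxE (negbTE ji) scale0r.
  by rewrite mxE eqxx mulr1n exprZn.
rewrite !mcoeffZ mcoeffX (inj_eq (@exponent_inj N)) eq_sym.
have [->|_] := eqVneq k l; last by rewrite !mulr0.
by rewrite mulr1 mulr1n mulrA mulfV ?mul1r // nrm_neq0.
Qed.

End Symmetric.

(** * Weights *)

Section WeightLattice.
Variable m : nat.
Local Notation wt := (weight m).

(* The character t_(s+1). *)
Definition eps (s : nat) : wt := omega m s.+1 - omega m s.

Lemma omega0 : omega m 0 = 0.
Proof. by apply/rowP => k; rewrite !mxE. Qed.

Lemma omega_last : omega m m.+2 = 0.
Proof. by apply/rowP => k; rewrite !mxE eqn_leq andbC leqNgt ltnS ltn_ord. Qed.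

Lemma alphaE i : (0 < i)%N -> alpha m i = eps i.-1 - eps i.
Proof. by case: i => // i _; rewrite /alpha /eps /= mulr2n opprB addrACA !addrA. Qed.

Lemma omega_sum l : omega m l = \sum_(q < l) eps q.
Proof.
elim: l => [|l IH]; first by rewrite omega0 big_ord0.
by rewrite big_ord_recr /= -IH /eps addrC subrK.
Qed.

(* The pairing with 2 rho^vee: [alpha i] has height 2. *)
Definition ht (l : wt) : int := \sum_k l 0 k * (k.+1 * (m.+1 - k))%N%:Z.

Lemma htD l l' : ht (l + l') = ht l + ht l'.
Proof. by rewrite /ht -big_split; apply: eq_bigr => k _; rewrite mxE mulrDl. Qed.

Lemma htN l : ht (- l) = - ht l.
Proof. by rewrite /ht -sumrN; apply: eq_bigr => k _; rewrite mxE mulNr. Qed.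

Lemma ht0 : ht 0 = 0.
Proof. by rewrite /ht big1 // => k _; rewrite mxE mul0r. Qed.

Lemma ht_omega i : (i <= m.+2)%N -> ht (omega m i) = (i * (m.+2 - i))%N.
Proof.
case: i => [|i]; first by rewrite omega0 ht0.
rewrite leq_eqVlt => /orP[/eqP[->]|].
  by rewrite omega_last ht0 subnn muln0.
rewrite !ltnS => hi; rewrite /ht (bigD1 (Ordinal (hi : (i < m.+1)%N))) //= mxE eqxx mul1r.
rewrite big1 ?addr0 ?subSS // => k ki; rewrite mxE eqSS; case: eqP => [E|]; last by rewrite mul0r.
by case/eqP: ki; apply: val_inj.
Qed.

Lemma ht_eps s : (s <= m.+1)%N -> ht (eps s) = m.+1%:Z - (s.*2)%:Z.
Proof. move=> hs; rewrite /eps htD htN (ht_omega (leqW hs)) (@ht_omega s.+1) //.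
have [d hd] : exists d, m.+1 = (s + d)%N by exists (m.+1 - s)%N; rewrite subnKC.
have -> : (m.+2 - s.+1 = d)%N by lia.
have -> : (m.+2 - s = d.+1)%N by lia.
by rewrite hd mulSn mulnS; lia. Qed.

(** Every simple root has height 2. Heights replace the partial orders by a total one, and since P
    is arbitrary this serves both [preceq] and [preceqK]. *)
Lemma ht_preceq_on P l' l : preceq_on P l' l -> ht l' <= ht l.
Proof.
case=> c hc; rewrite -subr_ge0 -htN -htD hc.
have : forall s : seq nat, all (fun i => 0 < i < m.+2)%N s ->
   0 <= ht (\sum_(i <- s | P i) alpha m i *+ c i).
  elim=> [|i s IH] /=; first by rewrite big_nil ht0.
  case/andP => /andP[i0 im] /IH h; rewrite big_cons; case: (P i) => //.
  rewrite htD addr_ge0 //; elim: (c i) => [|n hn]; first by rewrite mulr0n ht0.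
  rewrite mulrS htD addr_ge0 // alphaE // htD htN !ht_eps //; lia.
by apply; apply/allP => i; rewrite mem_index_iota.
Qed.

Definition pos (x : wt) : Prop :=
  exists c : nat -> nat, x = \sum_(1 <= i < m.+2) alpha m i *+ c i.

Lemma preceqE l' l : preceq l' l <-> pos (l - l').
Proof. by []. Qed.

Lemma pos0 : pos 0.
Proof. by exists (fun=> 0%N); rewrite big1. Qed.

Lemma posD x y : pos x -> pos y -> pos (x + y).
Proof.
move=> [c ->] [d ->]; exists (fun i => c i + d i)%N.
by rewrite -big_split; apply: eq_bigr => i _; rewrite mulrnDr.
Qed.

Lemma pos_sum (I : Type) (r : seq I) (P : pred I) (F : I -> wt) :
  (forall i, P i -> pos (F i)) -> pos (\sum_(i <- r | P i) F i).
Proof. by move=> h; apply: big_ind => //; [exact: pos0|exact: posD]. Qed.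

Lemma pos_alpha i : (0 < i < m.+2)%N -> pos (alpha m i).
Proof.
move=> hi; exists (fun k => (k == i)%N).
rewrite (bigD1_seq i) ?mem_index_iota ?iota_uniq //= eqxx mulr1n big1 ?addr0 // => k ki.
by rewrite (negbTE ki).
Qed.

Lemma pos_eps q s : (q <= s < m.+2)%N -> pos (eps q - eps s).
Proof.
elim: s => [|s IH].
  by rewrite leqn0 => /andP[/eqP -> _]; rewrite subrr; exact: pos0.
rewrite leq_eqVlt => /andP[/orP[/eqP ->|qs] sm]; first by rewrite subrr; exact: pos0.
have -> : eps q - eps s.+1 = (eps q - eps s) + alpha m s.+1 by rewrite alphaE //= addrA subrK.
apply: posD; first by apply: IH; rewrite -ltnS qs ltnW.
exact: pos_alpha.
Qed.

Lemma preceqD (l l' k k' : wt) : preceq l l' -> preceq k k' -> preceq (l + k) (l' + k').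
Proof. by rewrite !preceqE opprD addrACA; exact: posD. Qed.

Lemma preceq0 (l : wt) : preceq l l.
Proof. by rewrite preceqE subrr; exact: pos0. Qed.

Lemma ltn_sorted_nth (s : seq nat) q : sorted ltn s -> (q < size s)%N -> (q <= nth 0 s q)%N.
Proof.
move=> hs; elim: q => // q IH hq.
apply: leq_ltn_trans (IH (ltnW hq)) _.
by apply: (sorted_ltn_nth ltn_trans) => //; rewrite inE ?(ltnW hq).
Qed.

(** Counting from 0, the q-th smallest element s of a set of natural numbers is at least q, so eps q
    - eps s is a sum of simple roots. *)
Lemma preceq_wedge l (S : {set 'I_m.+2}) : #|S| = l ->
  preceq (\sum_(k in S) eps k) (omega m l).
Proof.
move=> hS; rewrite preceqE omega_sum.
have sz : size (enum S) = l by rewrite -cardE.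
rewrite -[\sum_(k in S) _]big_enum /= (big_nth ord0) sz big_mkord -sumrB; apply: pos_sum => q _.
apply: pos_eps; rewrite ltn_ord andbT.
rewrite -(nth_map ord0 0%N val) ?sz //; apply: ltn_sorted_nth; last by rewrite size_map sz.
(* The enumeration is a filtered interval, hence increasing. *)
have -> : map val (enum S) = [seq i <- iota 0 m.+2 | i \in map val (enum S)].
  rewrite -val_enum_ord filter_map; congr map; rewrite [LHS]/enum_mem enumT; apply: eq_filter => k /=.
  by rewrite (mem_map val_inj) mem_enum.
by rewrite sorted_filter ?iota_ltn_sorted //; exact: ltn_trans.
Qed.

End WeightLattice.

(** * Characters of the diagonal torus *)

Section Characters.
Variables (C : numClosedFieldType) (m : nat).

Definition achar (l : weight m) (t : 'rV[C]_m.+2) : C :=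
  \prod_(k < m.+1) (\prod_(p < m.+2 | (p <= k)%N) t 0 p) ^ l 0 k.

Lemma achar0 t : achar 0 t = 1.
Proof. by rewrite /achar big1 // => k _; rewrite mxE expr0z. Qed.

Lemma torus_norm (t : 'rV[C]_m.+2) : inSU (diag_mx t) -> forall k, t 0 k * (t 0 k)^* = 1.
Proof.
move=> [/unitaryP[h _] _] k; move/matrixP/(_ k k): h.
by rewrite tr_diag_mx map_diag_mx mulmx_diag !mxE eqxx mulr1n.
Qed.

Lemma torus_neq0 (t : 'rV[C]_m.+2) : inSU (diag_mx t) -> forall k, t 0 k != 0.
Proof.
move=> ht k; apply/eqP => h; have /eqP := torus_norm ht k.
by rewrite h mul0r eq_sym oner_eq0.
Qed.

Lemma acharD t l l' : inSU (diag_mx t) -> achar (l + l') t = achar l t * achar l' t.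
Proof.
move=> ht; rewrite /achar -big_split; apply: eq_bigr => k _; rewrite mxE expfzDr //.
by apply/prodf_neq0 => p _; exact: torus_neq0.
Qed.

Lemma acharN t l : achar (- l) t = (achar l t)^-1.
Proof. by rewrite /achar -prodfV; apply: eq_bigr => k _; rewrite mxE invr_expz. Qed.

Lemma achar_omega t i : inSU (diag_mx t) -> (i <= m.+2)%N ->
  achar (omega m i) t = \prod_(p < m.+2 | (p < i)%N) t 0 p.
Proof.
move=> ht; case: i => [|i]; first by rewrite omega0 achar0 big_pred0.
rewrite leq_eqVlt => /orP[/eqP[->]|].
  rewrite omega_last achar0; transitivity (\det (diag_mx t)); first by case: ht => _ ->.
  rewrite det_diag.
  by apply: eq_bigl => p; rewrite ltn_ord.
rewrite !ltnS => hi; rewrite /achar (bigD1 (Ordinal (hi : (i < m.+1)%N))) //= mxE eqxx expr1z.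
rewrite [X in _ * X]big1 ?mulr1 // => k ki; rewrite mxE eqSS; case: eqP => [E|]; last by rewrite expr0z.
by case/eqP: ki; apply: val_inj.
Qed.

Lemma achar_eps t (s : 'I_m.+2) : inSU (diag_mx t) -> achar (eps m s) t = t 0 s.
Proof.
move=> ht; rewrite /eps acharD // acharN !achar_omega ?ltn_ord //; last exact: ltnW.
rewrite (bigD1 s) //= -[RHS]mulr1 -mulrA; congr (_ * _).
rewrite (eq_bigl (fun p : 'I__ => (p < s)%N)) ?mulfV //.
  by apply/prodf_neq0 => p _; exact: torus_neq0.
by move=> p; rewrite ltnS ltn_neqAle andbC.
Qed.

Lemma achar_sum t (I : Type) (r : seq I) (P : pred I) (F : I -> weight m) : inSU (diag_mx t) ->
  achar (\sum_(i <- r | P i) F i) t = \prod_(i <- r | P i) achar (F i) t.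
Proof.
move=> ht; apply: (big_morph (fun l => achar l t)); last exact: achar0.
by move=> l l'; exact: acharD.
Qed.

Lemma acharMn t l n : inSU (diag_mx t) -> achar (l *+ n) t = achar l t ^+ n.
Proof.
move=> ht; elim: n => [|n IH]; first by rewrite achar0.
by rewrite mulrS acharD // IH exprS.
Qed.

Lemma achar_root t l (k k' : 'I_m.+2) : inSU (diag_mx t) ->
  t 0 k * (t 0 k')^* * achar l t = achar (l + (eps m k - eps m k')) t.
Proof.
move=> ht; rewrite (acharD l _ ht) (acharD (eps m k) _ ht) acharN !achar_eps // mulrC; congr (_ * (_ * _)).
by apply: (mulfI (torus_neq0 ht k')); rewrite torus_norm // mulfV // torus_neq0.
Qed.

End Characters.

(** * Weights as eigenvalues, and highest weight vectors *)

Section Eigenvalues.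
Variables (C : numClosedFieldType) (e : C -> C) (He : is_expi e).
Variable m : nat.
Local Notation M := 'M[C]_m.+2.
Local Notation E k l := (delta_mx k l : M).

Lemma expi_int x (z : int) : im x -> e (x * z%:~R) = e x ^ z.
Proof.
move=> hx; have h n : e (x * n%:R) = e x ^+ n.
  elim: n => [|n IH]; first by rewrite mulr0 (expi0 He) expr0.
  rewrite -natr1 mulrDr mulr1 (expiD He) ?IH ?exprSr // mulrC.
  by apply: imZ => //; rewrite rmorph_nat.
case: z => n; first exact: h.
rewrite NegzE rmorphN mulrN -exprnN; apply: (mulfI (expi_neq0 He (x * n.+1%:R))).
rewrite (expiNK He); last by rewrite mulrC; apply: imZ => //; rewrite rmorph_nat.
by rewrite h mulfV // expf_neq0 // expi_neq0.
Qed.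

Lemma achar_expi (l : weight m) (x : 'rV[C]_m.+2) : (forall k, im (x 0 k)) ->
  achar l (map_mx e x) = e (\sum_(q < m.+1) (\sum_(p < m.+2 | (p <= q)%N) x 0 p) * (l 0 q)%:~R).
Proof.
move=> hx; have hs q : im (\sum_(p < m.+2 | (p <= q)%N) x 0 p) by have [] := expi_sum He (index_enum _) (fun p : 'I_m.+2 => (p <= q)%N) hx.
rewrite (proj1 (expi_sum He _ _ _)) => [|q]; last first.
  by rewrite mulrC; apply: imZ => //; rewrite rmorph_int.
apply: eq_bigr => q _; rewrite expi_int // (proj1 (expi_sum He _ _ _)) //.
by congr (_ ^ _); apply: eq_bigr => p _; rewrite mxE.
Qed.

(* The eigenvalue of E_kk minus its trace part on vectors of weight l. *)
Definition ev (l : weight m) (k : 'I_m.+2) : C :=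
  \sum_(q < m.+1) (\sum_(p < m.+2 | (p <= q)%N) ((p == k)%:R - m.+2%:R^-1)) * (l 0 q)%:~R.

Lemma wvec_eigen N (p : M -> 'M[C]_N) l v k : urep (@inSU C m.+1) p ->
  weightvec p (achar l) v -> dpiC e p (E k k) *m v = ev l k *: v.
Proof.
(* i times the diagonal of the traceless part of E_kk, an element of su to which [wvec_dpi]
   applies. *)
move=> hp hv; pose x : 'rV[C]_m.+2 := \row_p ('i * ((p == k)%:R - m.+2%:R^-1)).
have real b : ((b : bool)%:R - m.+2%:R^-1 : C)^* = b%:R - m.+2%:R^-1.
  by rewrite rmorphB fmorphV !rmorph_nat.
have imi (t : C) : t^* = t -> im ('i * t) by move=> ht; rewrite mulrC; apply: imZ => //; rewrite /im conjCi.
have hx q : im (x 0 q) by rewrite mxE; exact: imi.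
have n0 : m.+2%:R != 0 :> C by rewrite pnatr_eq0.
have x0 : \sum_q x 0 q = 0.
  under eq_bigr do rewrite mxE; rewrite -mulr_sumr big_split /= sumr_const card_ord.
  rewrite (bigD1 k) //= eqxx big1 => [|q /negbTE ->//].
  by rewrite addr0 -[_ *+ m.+2]mulr_natr mulNr mulVf // subrr mulr0.
have rev : (ev l k)^* = ev l k.
  rewrite rmorph_sum; apply: eq_bigr => q _; rewrite rmorphM rmorph_int rmorph_sum.
  by congr (_ * _); apply: eq_bigr => r _; exact: real.
have := wvec_dpi He hp hv hx x0 (imi _ rev).
have hX : su (diag_mx x).
  split; last by rewrite mxtrace_diag.
  rewrite /skew tr_diag_mx map_diag_mx -diag_mxN; congr diag_mx.
  by apply/rowP => q; rewrite [LHS]mxE [RHS]mxE; exact: hx.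
have xE : diag_mx x = 'i *: (E k k - (m.+2%:R^-1)%:M).
  apply/matrixP => a b; rewrite !mxE; have [->|ab] := eqVneq a b.
    by rewrite !mulr1n andbb.
  by rewrite !mulr0n subr0; case: eqP => [ak|]; rewrite ?mulr0 //= -ak eq_sym (negbTE ab) mulr0.
rewrite -(dpiC_su He hp hX) xE (dpiCZ He hp) (dpiCD He hp) (dpiCN He hp) (dpiC_scalar He hp).
rewrite subr0 -scalemxAl -scalerA => h; apply: (scalerI (neq0Ci C)); apply: h => n.
rewrite achar_expi => [|q]; last first.
  rewrite mxE; apply: imZ => //; by rewrite fmorphV rmorphXn rmorph_nat.
congr e; rewrite /ev !mulr_sumr; apply: eq_bigr => q _; rewrite !mulrA; congr (_ * _).
by rewrite -mulrA !mulr_sumr; apply: eq_bigr => r _; rewrite !mxE.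
Qed.

Lemma evE l k : ev l k =
  \sum_(q < m.+1) ((k <= q)%N%:R - q.+1%:R / m.+2%:R) * (l 0 q)%:~R.
Proof.
apply: eq_bigr => q _; congr (_ * _); rewrite big_split /=; congr (_ + _).
  have [kq|kq] := leqP k q.
    rewrite (bigD1 k) //= eqxx big1 ?addr0 // => p /andP[_ /negbTE ->] //.
  rewrite big1 // => p pq; case: eqP => // pk; by move: kq; rewrite -pk ltnNge pq.
have hq : (q.+1 <= m.+2)%N by rewrite ltnS ltnW.
transitivity (\sum_(p < q.+1) - (m.+2%:R^-1 : C)); first by rewrite (big_ord_widen _ (fun=> - (m.+2%:R^-1 : C)) hq).
by rewrite sumrN sumr_const card_ord -[_ *+ q.+1]mulr_natl.
Qed.

Lemma ev_diff l (k : 'I_m.+1) (k1 k2 : 'I_m.+2) : k1 = k :> nat -> k2 = k.+1 :> nat ->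
  ev l k1 - ev l k2 = (l 0 k)%:~R.
Proof.
move=> h1 h2; rewrite !evE -sumrB (bigD1 k) //= big1 => [|q qk].
  by rewrite h1 h2 leqnn ltnn addr0 -mulrBl opprB addrA subrK subr0 mul1r.
rewrite h1 h2 -mulrBl opprB addrA subrK.
have -> : (k.+1 <= q)%N = (k <= q)%N by rewrite ltn_neqAle eq_sym [(q == k :> nat)](negbTE qk).
by rewrite subrr mul0r.
Qed.

Lemma ev_inj l l' : (forall k, ev l k = ev l' k) -> l = l'.
Proof.
move=> h; apply/rowP => k.
have h1 : (k < m.+2)%N by exact: leqW.
have h2 : (k.+1 < m.+2)%N by rewrite ltnS.
apply: (@intr_inj C).
by rewrite -!(@ev_diff _ k (Ordinal h1) (Ordinal h2)) // !h.
Qed.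

Lemma ev_real l k : (ev l k)^* = ev l k.
Proof.
rewrite evE rmorph_sum; apply: eq_bigr => q _.
by rewrite rmorphM rmorphB rmorphM fmorphV !rmorph_nat rmorph_int.
Qed.

(** A weight in the span of omega_1 and omega_2 does not distinguish the indices of the lower block;
    this is what makes v_mu an eigenvector of gl_m. *)
Lemma ev_high (l : weight m) (k k' : 'I_m.+2) : (forall q : 'I_m.+1, (1 < q)%N -> l 0 q = 0) ->
  (1 < k)%N -> (1 < k')%N -> ev l k = ev l k'.
Proof.
move=> hl hk hk'; rewrite !evE; apply: eq_bigr => q _.
have [q1|q1] := ltnP 1 q; first by rewrite hl // !mulr0.
have h (r : 'I_m.+2) : (1 < r)%N -> (r <= q)%N = false by move=> hr; rewrite leqNgt (leq_ltn_trans q1 hr).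
by rewrite !h.
Qed.

Lemma wvec_orth N (p : M -> 'M[C]_N) l l' v w : urep (@inSU C m.+1) p ->
  weightvec p (achar l) v -> weightvec p (achar l') w -> v^t* *m w != 0 -> l = l'.
Proof.
move=> hp hv hw vw; apply: ev_inj => k.
apply: (eigen_orth He hp (Z := E k k) _ (ev_real l k) _ _ vw).
- exact: ct_delta.
- exact: wvec_eigen.
- exact: wvec_eigen.
Qed.

Lemma wvec_raise N (p : M -> 'M[C]_N) l v (k k' : 'I_m.+2) : urep (@inSU C m.+1) p ->
  weightvec p (achar l) v -> weightvec p (achar (l + (eps m k - eps m k'))) (dpiC e p (E k k') *m v).
Proof.
move=> hp hv t ht; rewrite (wvec_delta He hp k k' hv) //; by rewrite achar_root.
Qed.

Lemma ht_raise (l : weight m) (k k' : 'I_m.+2) : (k < k')%N ->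
  ht l < ht (l + (eps m k - eps m k')).
Proof.
move=> kk'; rewrite (htD l) (htD (eps m k)) htN !ht_eps -1?ltnS //; lia.
Qed.

(** Raising strictly increases the height, so a raised vector of maximal height must vanish. *)
Lemma highest_hvec N (p : M -> 'M[C]_N) l v : urep (@inSU C m.+1) p ->
  weightvec p (achar l) v ->
  (forall l' w, w != 0 -> weightvec p (achar l') w -> ht l' <= ht l) ->
  hvec e p (ev l) v.
Proof.
move=> hp hv hmax; split=> [k k' kk'|k]; last exact: wvec_eigen.
apply/eqP; apply: contraTT (ht_raise l kk') => w0; rewrite -leNgt.
exact: hmax w0 (wvec_raise _ _ hp hv).
Qed.

(** The columns of [A] span, as its right inverse [A'] expresses; they may be dependent. In this
    form the property survives orthogonal projection, see [spanw_sub]. *)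
Definition weight_spanned (la : weight m) N (p : M -> 'M[C]_N) : Prop :=
  exists r (A : 'M[C]_(N, r)) (A' : 'M[C]_(r, N)), A *m A' = 1%:M /\
    forall i, exists l, preceq l la /\ weightvec p (achar l) (col i A).

Lemma spanw_find N r (A : 'M[C]_(N, r)) (A' : 'M[C]_(r, N)) (x : 'cV[C]_N) :
  A *m A' = 1%:M -> x != 0 -> exists i, x^t* *m col i A != 0.
Proof.
move=> AA x0; apply/existsP; apply: contraNT x0 => /existsPn h.
have xA : x^t* *m A = 0.
  apply/matrixP => a i; have := h i; rewrite negbK => /eqP/matrixP/(_ a 0).
  rewrite mxE [RHS]mxE => h'; rewrite [RHS]mxE -[RHS]h' mxE.
  by apply: eq_bigr => k _; rewrite [col i A _ _]mxE.
have : x^t* = 0 by rewrite -[LHS]mulmx1 -AA mulmxA xA mul0mx.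
by move=> /(congr1 (fun B => B^t*)); rewrite trmxCK ctmx0 => ->.
Qed.

(** A nonzero column of maximal height is taken. Any weight vector is non-orthogonal to some column,
    whose weight is then the same by [wvec_orth], so the maximum is over all weights of [p]. *)
Lemma spanw_hvec la N (p : M -> 'M[C]_N) : urep (@inSU C m.+1) p -> (0 < N)%N ->
  weight_spanned la p -> exists l v, [/\ v != 0, preceq l la, weightvec p (achar l) v & hvec e p (ev l) v].
Proof.
move=> hp N0 [r [A [A' [AA hA]]]]; have [L hL] := choice hA.
have [i0 hi0] : exists i, col i A != 0.
  have x0 : (delta_mx (Ordinal N0) 0 : 'cV[C]_N) != 0.
    by apply/eqP => /matrixP/(_ (Ordinal N0) 0)/eqP; rewrite !mxE !eqxx oner_eq0.
  have [i hi] := spanw_find AA x0; exists i; apply: contraNneq hi => ->.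
  by rewrite mulmx0.
case: (@Order.TotalTheory.arg_maxP _ _ _ i0 (fun i => col i A != 0) (fun i => ht (L i)) hi0) => i ci hi.
exists (L i), (col i A); have [h1 h2] := hL i; split=> //.
apply: highest_hvec => // l' w w0 hw.
have [i' hi'] := spanw_find AA w0; have [_ h4] := hL i'.
rewrite (wvec_orth hp hw h4 hi'); apply: hi.
by apply: contraNneq hi' => ->; rewrite mulmx0.
Qed.

Lemma spanw_sub la N r (p : M -> 'M[C]_N) (B : 'M[C]_(N, r)) : B^t* *m B = 1%:M ->
  (forall t, inSU (diag_mx t) -> p (diag_mx t) *m (B *m B^t*) = B *m B^t* *m p (diag_mx t)) ->
  weight_spanned la p -> weight_spanned la (fun g => B^t* *m p g *m B).
Proof.
move=> B1 hc [s [A [A' [AA hA]]]]; exists s, (B^t* *m A), (A' *m B); split.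
  by rewrite mulmxA -[_ *m A *m A']mulmxA AA mulmx1.
move=> i; have [l [hl hw]] := hA i; exists l; split=> // t ht.
have cE : col i (B^t* *m A) = B^t* *m col i A by rewrite !colE mulmxA.
rewrite cE -!mulmxA [B *m (_ *m _)]mulmxA [p _ *m _]mulmxA hc // -!mulmxA hw //.
by rewrite -!scalemxAr !mulmxA B1 mul1mx.
Qed.

Lemma urep_sub N r (p : M -> 'M[C]_N) (B : 'M[C]_(N, r)) : urep (@inSU C m.+1) p ->
  B^t* *m B = 1%:M ->
  (forall g, inSU g -> p g *m (B *m B^t*) = B *m B^t* *m p g) ->
  urep (@inSU C m.+1) (fun g => B^t* *m p g *m B).
Proof.
move=> hp B1 hc; have E g : inSU g -> B^t* *m p g *m (B *m B^t*) = B^t* *m p g.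
  by move=> hg; rewrite -mulmxA hc // !mulmxA B1 mul1mx.
split.
- by rewrite (ur1 hp) mulmx1.
- move=> g h hg hh; rewrite (urM hp) // [B^t* *m (_ *m _)]mulmxA.
  by rewrite -[X in X *m p h *m B](E g hg) !mulmxA.
- move=> g hg; apply/unitarymxP; rewrite !ctmxM trmxCK !mulmxA.
  rewrite -[_ *m B *m B^t*]mulmxA E // -[_ *m p g *m _]mulmxA.
  by rewrite (unitaryP (urU hp hg)).1 mulmx1 B1.
- move=> g h hg hh gh; apply: mcvM; last exact: mcv_cst.
  by apply: mcvM; [exact: mcv_cst|exact: urC hp _ _ hg hh gh].
Qed.

(** Stability under g^* together with adjunction turns invariance of the subspace under g into
    commutation with its projection. *)
Lemma stable_proj N r (p : M -> 'M[C]_N) (P : 'cV[C]_N -> Prop) (B : 'M[C]_(N, r)) g :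
  urep (@inSU C m.+1) p -> B^t* *m B = 1%:M -> (forall x, P x <-> x = B *m (B^t* *m x)) ->
  (forall g x, inSU g -> P x -> P (p g *m x)) -> inSU g ->
  p g *m (B *m B^t*) = B *m B^t* *m p g.
Proof.
move=> hp B1 hB hs hg.
have PB y : P (B *m y) by apply/hB; rewrite [B^t* *m _]mulmxA B1 mul1mx.
have key h : inSU h -> B *m B^t* *m p h *m (B *m B^t*) = p h *m (B *m B^t*).
  move=> hh; apply: mulmx_ext => y.
  have /hB E := hs h _ hh (PB (B^t* *m y)).
  by rewrite -!mulmxA -E.
have := congr1 (fun A => A^t*) (key _ (inSUct hg)).
by rewrite (rep_ct hp) // !ctmxM !trmxCK !mulmxA => h; rewrite -[RHS]h -[LHS]mulmxA -key // !mulmxA.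
Qed.

End Eigenvalues.

(** * Expansion into spherical functions *)

Section Decomposition.
Variables (C : numClosedFieldType) (e : C -> C) (He : is_expi e).
Variables (m : nat) (hm : (1 < m)%N).
Local Notation M := 'M[C]_m.+2.
Local Notation E k l := (delta_mx k l : M).
Local Notation G := (@inSU C m.+1).
Local Notation K := (@inK C m).

Variables (N' : nat) (q : M -> 'M[C]_N') (mu : weight m) (vmu : 'cV[C]_N').
Hypotheses (hq : urep K q) (iq : irr K q).
Hypotheses (vmu0 : vmu != 0) (hvmu : weightvec q (achar mu) vmu).
Hypothesis hmu : forall l w, w != 0 -> weightvec q (achar l) w -> preceqK l mu.
Hypothesis mu_high : forall k : 'I_m.+1, (1 < k)%N -> mu 0 k = 0.

Variables (VN : weight m -> nat) (V : forall l, M -> 'M[C]_(VN l)).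
Hypothesis hV : forall l, dominant l -> urep G (V l).
Hypothesis iV : forall l, dominant l -> irr G (V l).
Hypothesis wV : forall l, dominant l -> exists2 v, v != 0 & weightvec (V l) (achar l) v.
Hypothesis mV : forall l, dominant l -> forall l' w, w != 0 -> weightvec (V l) (achar l') w ->
  preceq l' l.

Definition intK N (p : M -> 'M[C]_N) (j : 'M[C]_(N, N')) : Prop :=
  forall k, K k -> j *m q k = p k *m j.

Definition occurs (l : weight m) : Prop :=
  dominant l /\ exists2 j, intK (V l) j & j != 0.

Variable jV : forall l, 'M[C]_(VN l, N').
Hypothesis hjV : forall l, occurs l -> intK (V l) (jV l) /\ jV l != 0.

Lemma V_hvec l v : dominant l -> weightvec (V l) (achar l) v -> hvec e (V l) (ev C l) v.
Proof.
move=> dl hv; apply: highest_hvec => //; first exact: hV.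
by move=> l' w w0 hw; exact: (ht_preceq_on (mV dl w0 hw)).
Qed.

Lemma intK_quvec N (p : M -> 'M[C]_N) (j : 'M[C]_(N, N')) : urep G p -> intK p j ->
  quvec e p (ev C mu) (j *m vmu).
Proof.
move=> hp hj; have dK t : inSU (diag_mx t) -> K (diag_mx t).
  by move=> ht; split=> //; exact: blk_diag.
apply: (K_hvec He hp hq iq hj (chi := achar mu)).
- exact: hvmu.
- move=> k l w kl _ hw; apply/eqP; apply: contraTT (ht_raise mu kl) => w0; rewrite -leNgt.
  apply: (ht_preceq_on (hmu w0 _)) => t ht; rewrite -achar_root //; exact: hw.
- move=> k; apply: wvec_eigen => // t ht; have hK := dK t ht.
  by rewrite mulmxA -hj // -mulmxA hvmu // scalemxAr.
- by move=> k l; exact: ev_high.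
Qed.

Lemma normalize N (v : 'cV[C]_N) : v != 0 ->
  exists2 c : C, c != 0 & (c *: v)^t* *m (c *: v) = 1%:M.
Proof.
move=> v0; have n0 := norm_gt0 v0; set n := (_ *m _) 0 0 in n0.
have s0 : 0 < sqrtC n by rewrite sqrtC_gt0.
have sr : (sqrtC n)^-1^* = (sqrtC n)^-1.
  by apply/conj_Creal; rewrite rpredV; exact: gtr0_real.
exists (sqrtC n)^-1; first by rewrite invr_neq0 // gt_eqF.
rewrite ctmxZ sr -scalemxAl -scalemxAr scalerA [_ *m v]mx11_scalar -/n scale_scalar_mx.
by rewrite -invfM -expr2 sqrtCK mulVf // gt_eqF.
Qed.

Lemma hvecZ N (p : M -> 'M[C]_N) d c v : hvec e p d v -> hvec e p d (c *: v).
Proof.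
move=> [h1 h2]; split=> [k l kl|k]; rewrite -scalemxAr; first by rewrite h1 // scaler0.
by rewrite h2 !scalerA mulrC.
Qed.

(** The list may repeat a weight; [sum_regroup] collects the coefficients. *)
Definition expands (la : weight m) N (p : M -> 'M[C]_N) (j : 'M[C]_(N, N')) : Prop :=
  exists s : seq (weight m * C), (forall x, x \in s -> preceq x.1 la /\ occurs x.1) /\
    forall g, G g -> j^t* *m p g *m j =
      \sum_(x <- s) x.2 *: ((jV x.1)^t* *m V x.1 g *m jV x.1).

Lemma expands_irr la N (p : M -> 'M[C]_N) (j : 'M[C]_(N, N')) : urep G p -> irr G p ->
  weight_spanned la p -> intK p j -> expands la p j.
Proof.
move=> hp ip sp hj; have [->|j0] := eqVneq j 0.
  by exists [::]; split=> // g _; rewrite ctmx0 !mul0mx big_nil.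
have [l [v [v0 lla hv hhv]]] := spanw_hvec He hp (proj1 ip) sp.
(* The coefficients of [l] are differences of consecutive eigenvalues, nonnegative by [hvec_dom]. *)
have dl : dominant l.
  move=> k; have h1 : (k < m.+2)%N by exact: leqW.
  have h2 : (k.+1 < m.+2)%N by rewrite ltnS.
  have := hvec_dom He hp hhv v0 (k := Ordinal h1) (l := Ordinal h2) (ltnSn k).
  by rewrite (@ev_diff C m l k) // ler0z.
have [w w0 hw] := wV dl; have hhw := V_hvec dl hw.
have [a a0 a1] := normalize v0; have [b b0 b1] := normalize w0.
have [T T0 hT] := highest_weight_intertwiner He hp (hV dl) ip (iV dl) a1 b1 (hvecZ a hhv) (hvecZ b hhw).
have [c c0 cE] := schur_isometry hp (hV dl) ip hT T0.
have hTj : intK (V l) (T *m j).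
  by move=> k hk; rewrite -mulmxA hj // !mulmxA hT //; case: hk.
have Tj0 : T *m j != 0.
  apply: contra_neq j0 => h; have : T^t* *m (T *m j) = 0 by rewrite h mulmx0.
  by rewrite mulmxA cE mul_scalar_mx => /eqP; rewrite scaler_eq0 (negbTE c0) => /eqP.
have ol : occurs l by split=> //; exists (T *m j).
have [hJ J0] := hjV ol.
have [d dE] := multiplicity_one He hm (hV dl) iq (iV dl) hhw w0 hTj hJ
  (intK_quvec (hV dl) hTj) (intK_quvec (hV dl) hJ) vmu0 J0.
(* T^* T = c contributes c^-1, and T j = d jV contributes |d|^2. *)
exists [:: (l, c^-1 * (d^* * d))]; split=> [x|g hg].
  by rewrite inE => /eqP ->.
rewrite big_seq1 /=.
have -> : j^t* *m p g *m j = c^-1 *: ((T *m j)^t* *m V l g *m (T *m j)).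
  rewrite ctmxM -!mulmxA [V l g *m _]mulmxA -hT // -mulmxA [T^t* *m _]mulmxA cE.
  by rewrite mul_scalar_mx -scalemxAr scalerA mulVf // scale1r.
by rewrite dE ctmxZ -!scalemxAl -!scalemxAr !scalerA mulrA.
Qed.

Lemma isometry_size N r (B : 'M[C]_(N, r)) : B^t* *m B = 1%:M -> (r <= N)%N.
Proof.
move=> h; have := mxrankM_maxr (B^t*) B; rewrite h mxrank1 => /leq_trans; apply.
exact: rank_leq_row.
Qed.

Lemma isometry_full N r (B : 'M[C]_(N, r)) : r = N -> B^t* *m B = 1%:M -> B *m B^t* = 1%:M.
Proof. by move=> rN; case: _ / rN B => B; exact: mulmx1C. Qed.

(** Strong induction on the dimension: a proper nonzero invariant subspace and its orthogonal
    complement carry smaller representations, and [j] is projected to each. *)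
Theorem expands_all la N (p : M -> 'M[C]_N) (j : 'M[C]_(N, N')) : urep G p ->
  weight_spanned la p -> intK p j -> expands la p j.
Proof.
have [n le_Nn] := ubnP N; elim: n N p j le_Nn => // n IH N p j; rewrite ltnS => le_Nn hp sp hj.
have [N0|N0] := posnP N.
  exists [::]; split=> // g _; rewrite big_nil; apply/matrixP => a b; rewrite !mxE big1 //.
  by move=> [k hk]; exfalso; rewrite N0 in hk.
have [ip|nip] := pselect (irr G p); first exact: expands_irr.
have [P [sP hP nz nf]] : exists P, [/\ subsp P, forall g v, G g -> P v -> P (p g *m v),
    ~ (forall v, P v -> v = 0) & ~ (forall v, P v)].
  apply: contrapT => h; apply: nip; split=> // P sP hP; apply: contrapT => /not_orP[h1 h2].
  by apply: h; exists P.
have [r1 [B1 [B1o hB1]]] := orthonormal_basis sP.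
have sP' : subsp (fun x : 'cV[C]_N => B1^t* *m x = 0).
  split=> [|c x y hx hy]; first by rewrite mulmx0.
  by rewrite mulmxDr -scalemxAr hx hy scaler0 addr0.
have [r2 [B2 [B2o hB2]]] := orthonormal_basis sP'.
have B12 : B1^t* *m B2 = 0.
  apply: mulmx_ext => x; rewrite mul0mx -mulmxA; apply/hB2.
  by rewrite [B2^t* *m _]mulmxA B2o mul1mx.
have sum1 : B1 *m B1^t* + B2 *m B2^t* = 1%:M.
  apply: mulmx_ext => x; rewrite mul1mx mulmxDl -!mulmxA.
  have hy : B1^t* *m (x - B1 *m (B1^t* *m x)) = 0.
    by rewrite mulmxBr [B1^t* *m (B1 *m _)]mulmxA B1o mul1mx subrr.
  have B21 : B2^t* *m B1 = 0 by rewrite -[B1]trmxCK -ctmxM B12 ctmx0.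
  have /hB2 := hy; rewrite mulmxBr [B2^t* *m (B1 *m _)]mulmxA B21 mul0mx subr0 => <-.
  by rewrite addrC subrK.
have c1 g : G g -> p g *m (B1 *m B1^t*) = B1 *m B1^t* *m p g.
  exact: stable_proj hB1 hP.
have c2 g : G g -> p g *m (B2 *m B2^t*) = B2 *m B2^t* *m p g.
  move=> hg; have -> : B2 *m B2^t* = 1%:M - B1 *m B1^t* by rewrite -sum1 addrC addKr.
  by rewrite mulmxBr mulmxBl mulmx1 mul1mx c1.
have lt1 : (r1 < N)%N.
  rewrite ltn_neqAle (isometry_size B1o) andbT; apply/eqP => E; apply: nf => v.
  by apply/hB1; rewrite mulmxA (isometry_full E B1o) mul1mx.
have lt2 : (r2 < N)%N.
  rewrite ltn_neqAle (isometry_size B2o) andbT; apply/eqP => E; apply: nz => v /hB1 ->.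
  have := isometry_full E B2o; rewrite -sum1 => /eqP; rewrite -subr_eq0 opprD addrCA subrr addr0 oppr_eq0 => /eqP h.
  by rewrite mulmxA h mul0mx.
have sub r (B : 'M[C]_(N, r)) : (r < N)%N -> B^t* *m B = 1%:M ->
    (forall g, G g -> p g *m (B *m B^t*) = B *m B^t* *m p g) ->
    expands la (fun g => B^t* *m p g *m B) (B^t* *m j).
  move=> rN Bo Bc; apply: IH.
  - exact: leq_trans rN le_Nn.
  - exact: urep_sub.
  - by apply: spanw_sub => // t ht; exact: Bc.
  - move=> k hk; have Gk : G k by case: hk.
    have := congr1 (fun A => B^t* *m A *m j) (Bc k Gk).
    by move=> E; rewrite -[LHS]mulmxA hj // !mulmxA; rewrite !mulmxA Bo mul1mx in E.
have [s1 [h1 e1]] := sub _ B1 lt1 B1o c1; have [s2 [h2 e2]] := sub _ B2 lt2 B2o c2.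
exists (s1 ++ s2); split=> [x|g hg].
  by rewrite mem_cat => /orP[]; [exact: h1|exact: h2].
have := e1 g hg; have := e2 g hg; rewrite big_cat /= => <- <-.
(* Compressing to a piece inserts its projection, which commutes with [p g]; the two projections add
   up to 1. *)
have cut r (B : 'M[C]_(N, r)) : (forall g, G g -> p g *m (B *m B^t*) = B *m B^t* *m p g) ->
   B^t* *m B = 1%:M ->
   (B^t* *m j)^t* *m (B^t* *m p g *m B) *m (B^t* *m j) = j^t* *m (B *m B^t*) *m p g *m j.
  move=> Bc Bo; rewrite ctmxM trmxCK !mulmxA -[_ *m B *m B^t*]mulmxA.
  rewrite -[_ *m p g *m _]mulmxA Bc // !mulmxA -[_ *m B^t* *m B]mulmxA Bo mulmx1 //.
rewrite !cut // -!mulmxDl -mulmxDr sum1 mulmx1 //.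
Qed.

End Decomposition.

(** * The unitary representation on the span of an orbit *)

Section Cyclic.
Variables (C : numClosedFieldType) (m : nat).
Local Notation M := 'M[C]_m.+2.
Local Notation G := (@inSU C m.+1).

Definition basis_weights (la : weight m) N (W : M -> 'M[C]_N) : Prop :=
  forall i, exists l, preceq l la /\ forall t, G (diag_mx t) ->
    W (diag_mx t) *m delta_mx i 0 = achar l t *: delta_mx i (0 : 'I_1).

Record star_rep (la : weight m) N (W : M -> 'M[C]_N) : Prop := Star {
  star1 : W 1%:M = 1%:M;
  starM : forall g h, W (g *m h) = W g *m W h;
  star_ct : forall g, W (g^t*) = (W g)^t*;
  star_cont : forall (g : nat -> M) h, mcv g h -> mcv (fun k => W (g k)) (W h);
  star_wt : basis_weights la W }.

(* What is needed of W on the orbit of w only: this spares proving that [aSym] is unitary. *)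
Record cyclic_rep (la : weight m) N (W : M -> 'M[C]_N) (w : 'cV[C]_N) : Prop := Cyc {
  cyc1 : W 1%:M *m w = w;
  cycM : forall g h, W g *m (W h *m w) = W (g *m h) *m w;
  cyc_dot : forall g h, (W g *m w)^t* *m (W h *m w) = w^t* *m (W (g^t* *m h) *m w);
  cyc_cont : forall (g : nat -> M) h, mcv g h ->
    mcv (fun k => w^t* *m (W (g k) *m w)) (w^t* *m (W h *m w));
  cyc_wt : basis_weights la W }.

Lemma star_cyc la N (W : M -> 'M[C]_N) w : star_rep la W -> cyclic_rep la W w.
Proof.
move=> h; split.
- by rewrite (star1 h) mul1mx.
- by move=> g g'; rewrite (starM h) mulmxA.
- by move=> g g'; rewrite ctmxM (starM h) (star_ct h) !mulmxA.
- move=> g g' gg'; apply: mcvM; first exact: mcv_cst.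
  by apply: mcvM; [exact: star_cont h _ _ gg'|exact: mcv_cst].
- exact: star_wt h.
Qed.

Lemma ct_tens a b c d (A : 'M[C]_(a, b)) (B : 'M[C]_(c, d)) : (A *t B)^t* = A^t* *t B^t*.
Proof. by rewrite trmx_tens map_mxT. Qed.

Lemma tens_act N N' (A : 'M[C]_N) (B : 'M[C]_N') (x : 'cV[C]_N) (y : 'cV[C]_N') :
  (A *t B) *m (x *t y : 'cV[C]_(N * N')) = ((A *m x) *t (B *m y) : 'cV[C]_(N * N')).
Proof. exact: (tensmx_mul A B x y). Qed.

Lemma tens_dot N N' (x x' : 'cV[C]_N) (y y' : 'cV[C]_N') :
  (x *t y : 'cV[C]_(N * N'))^t* *m (x' *t y' : 'cV[C]_(N * N')) =
  ((x^t* *m x') *t (y^t* *m y') : 'M[C]_1).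
Proof.
exact: (etrans (congr1 (fun A => A *m (x' *t y')) (ct_tens x y))
  (tensmx_mul (x^t*) (y^t*) x' y')).
Qed.

Lemma tens1 N N' : (1%:M : 'M[C]_N) *t (1%:M : 'M[C]_N') = 1%:M.
Proof.
apply/matrixP => x y; rewrite -[x]mxtens_unindexK -[y]mxtens_unindexK.
case: (mxtens_unindex x) (mxtens_unindex y) => a b [c d].
rewrite !mxE !mxtens_indexK /= (can_eq (@mxtens_indexK _ _)) xpair_eqE.
by case: eqP => _; rewrite ?mul1r ?mul0r.
Qed.

Lemma mcv_tens a b c d (A : nat -> 'M[C]_(a, b)) (B : nat -> 'M[C]_(c, d)) L L' :
  mcv A L -> mcv B L' -> mcv (fun k => A k *t B k) (L *t L').
Proof.
move=> [hA] [hB]; split=> i j; under eq_fun do rewrite mxE; rewrite mxE.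
by apply: cvgM; [exact: hA|exact: hB].
Qed.

Lemma tens_basis a b (i : 'I_a) (i' : 'I_b) :
  delta_mx i (0 : 'I_1) *t delta_mx i' (0 : 'I_1) =
  delta_mx (mxtens_index (i, i')) (0 : 'I_(1 * 1)) :> 'M[C]_(a * b, 1 * 1).
Proof.
apply/matrixP => x y; rewrite -[x]mxtens_unindexK; case: (mxtens_unindex x) => k k'.
rewrite !mxE mxtens_indexK /= !ord1 !eqxx !andbT.
rewrite (can_eq (@mxtens_indexK _ _)) xpair_eqE; case: eqP => _; rewrite ?mul1r ?mul0r //.
Qed.

Lemma tens_basis1 a b (i : 'I_a) (i' : 'I_b) :
  ((delta_mx i 0 : 'cV[C]_a) *t (delta_mx i' 0 : 'cV[C]_b) : 'cV[C]_(a * b)) =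
  delta_mx (mxtens_index (i, i')) 0.
Proof. exact: tens_basis. Qed.

Lemma basis_weights_tens la lb N N' (W : M -> 'M[C]_N) (W' : M -> 'M[C]_N') :
  basis_weights la W -> basis_weights lb W' ->
  basis_weights (la + lb) (fun g => W g *t W' g).
Proof.
move=> hW hW' x; rewrite -[x]mxtens_unindexK; case: (mxtens_unindex x) => k k'.
have [l [h1 h2]] := hW k; have [l' [h3 h4]] := hW' k'.
exists (l + l'); split=> [|t ht]; first exact: preceqD.
rewrite -tens_basis1 tens_act h2 // h4 // acharD //.
by apply/matrixP => a b; rewrite !mxE mulrACA.
Qed.

Lemma star_tens la lb N N' (W : M -> 'M[C]_N) (W' : M -> 'M[C]_N') :
  star_rep la W -> star_rep lb W' -> star_rep (la + lb) (fun g => W g *t W' g).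
Proof.
move=> h h'; split.
- by rewrite (star1 h) (star1 h') tens1.
- by move=> g g'; rewrite (starM h) (starM h') tensmx_mul.
- by move=> g; rewrite (star_ct h) (star_ct h') ct_tens.
- by move=> g g' gg'; apply: mcv_tens; [exact: star_cont h _ _ gg'|exact: star_cont h' _ _ gg'].
- exact: basis_weights_tens (star_wt h) (star_wt h').
Qed.

Lemma cyc_tens la lb N N' (W : M -> 'M[C]_N) (W' : M -> 'M[C]_N') w w' :
  cyclic_rep la W w -> cyclic_rep lb W' w' ->
  cyclic_rep (la + lb) (fun g => W g *t W' g) (w *t w' : 'cV[C]_(N * N')).
Proof.
move=> h h'; split.
- by rewrite tens_act (cyc1 h) (cyc1 h').
- by move=> g g'; rewrite !tens_act (cycM h) (cycM h').
- by move=> g g'; rewrite !tens_act !tens_dot (cyc_dot h) (cyc_dot h').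
- move=> g g' gg'; rewrite tens_act tens_dot.
  under eq_fun do rewrite tens_act tens_dot.
  exact: (mcv_tens (cyc_cont h gg') (cyc_cont h' gg')).
- exact: basis_weights_tens (cyc_wt h) (cyc_wt h').
Qed.

Lemma basis_weights_diag la N (W : M -> 'M[C]_N) (d : 'rV[C]_m.+2 -> 'rV[C]_N) (L : 'I_N -> weight m) :
  (forall t, W (diag_mx t) = diag_mx (d t)) ->
  (forall i, preceq (L i) la) ->
  (forall t i, G (diag_mx t) -> d t 0 i = achar (L i) t) -> basis_weights la W.
Proof.
move=> hW hL hd i; exists (L i); split=> // t ht.
rewrite hW mul_diag_mx -hd //; apply/colP => k; rewrite !mxE.
by case: eqP => [->|]; rewrite ?mulr0.
Qed.

Lemma star_triv : star_rep 0 (fun=> 1%:M : 'M[C]_1).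
Proof.
split=> //.
- by move=> g h; rewrite mul1mx.
- by move=> g; rewrite ctmx1.
- by move=> g h _; exact: mcv_cst.
- move=> i; exists 0; split=> [|t ht]; first exact: preceq0.
  by rewrite mul1mx achar0 scale1r.
Qed.

Lemma star_Lam l : star_rep (omega m l) (@aLam C m l).
Proof.
split.
- rewrite -diag_const_mx aLam_diag -diag_const_mx; congr diag_mx.
  by apply/rowP => S; rewrite !mxE big1 // => k _; rewrite mxE.
- exact: aLamM.
- exact: aLam_ct.
- exact: aLam_cont.
- apply: (basis_weights_diag (d := fun t => \row_(S < #|{: lset m l}|) \prod_(k in sval (enum_val S)) t 0 k)
     (L := fun S => \sum_(k in sval (enum_val S)) eps m k) (aLam_diag l)).
    by move=> S; apply: preceq_wedge; exact: lset_card.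
  move=> t S ht; rewrite mxE achar_sum //; apply: eq_bigr => k _.
  by rewrite achar_eps.
Qed.

(** The vectors s(x) are permuted by the action and their inner products are powers of <x, y>, so
    all conditions on the orbit of s(c) reduce to the natural representation. It is applied to N-th
    powers of linear forms. *)
Lemma coherent_cyc la N (W : M -> 'M[C]_N) (s : 'cV[C]_m.+2 -> 'cV[C]_N) k c :
  (forall g x, W g *m s x = s (g *m x)) ->
  (forall x y, (s x)^t* *m s y = ((x^t* *m y) 0 0 ^+ k)%:M) ->
  basis_weights la W -> cyclic_rep la W (s c).
Proof.
move=> act dot hW; split=> //.
- by rewrite act mul1mx.
- by move=> g h; rewrite !act mulmxA.
- by move=> g h; rewrite !act !dot ctmxM !mulmxA.
- move=> g h gh; rewrite act dot; under eq_fun do rewrite act dot.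
  split=> i j; rewrite !ord1; under eq_fun do rewrite mxE eqxx mulr1n; rewrite mxE eqxx mulr1n.
  have [/(_ 0 0) H] := mcvM (mcv_cst (c^t*)) (mcvM gh (mcv_cst c)).
  elim: k {dot} => [|k IH]; first exact: cvg_cst.
  under eq_fun do rewrite exprS; rewrite exprS; exact: cvgM.
Qed.

Lemma cyc_Sym N (nrm : multinom m.+2 -> C) :
  (forall al, (nrm al)^* = nrm al) ->
  (forall al, nrm al ^+ 2 = (mfact al)%:R / N`!%:R) ->
  cyclic_rep (omega m 1 *+ N) (aSym N nrm) (asymvec N nrm (mpolyX C (mnm1 ord0) ^+ N)).
Proof.
move=> h1 h2; have -> : mpolyX C (mnm1 (ord0 : 'I_m.+2)) = linear_form (delta_mx ord0 0).
  rewrite /linear_form (bigD1 ord0) //= big1 ?addr0; last by move=> j j0; rewrite mxE (negbTE j0) scale0r.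
  by rewrite mxE !eqxx scale1r.
apply: (@coherent_cyc _ _ (aSym N nrm) (fun c => asymvec N nrm (linear_form c ^+ N)) N).
- by move=> g c; exact: aSym_lin.
- by move=> c d; rewrite [LHS]mx11_scalar asymvec_dot.
- refine (basis_weights_diag (d := fun t => \row_(k < #|{: monomial m N}|) \prod_p t 0 p ^+ exponent k p)
    (L := fun k => \sum_(p < m.+2) eps m p *+ exponent k p) (aSym_diag h2) _ _).
    move=> k; have -> : omega m 1 *+ N = \sum_(p < m.+2) omega m 1 *+ exponent k p.
      by rewrite sumrMnr -mdegE exponent_deg.
    rewrite preceqE -sumrB; apply: pos_sum => p _; rewrite -mulrnBl.
    have hp : pos (omega m 1 - eps m p).
      have := @pos_eps m 0 p; rewrite {1}/eps omega0 subr0; apply.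
      by rewrite ltn_ord.
    elim: (exponent k p) => [|n IH]; first by rewrite mulr0n; exact: pos0.
    by rewrite mulrS; exact: posD.
  move=> t k ht; rewrite mxE achar_sum //; apply: eq_bigr => p _.
  by rewrite acharMn // achar_eps.
Qed.

Section SpanRep.
Variables (la : weight m) (N : nat) (W : M -> 'M[C]_N) (w : 'cV[C]_N).
Hypothesis hW : cyclic_rep la W w.

Inductive orbit_span : 'cV[C]_N -> Prop :=
| span0 : orbit_span 0
| spanA c g x : G g -> orbit_span x -> orbit_span (c *: (W g *m w) + x).

Lemma subsp_orbit : subsp orbit_span.
Proof.
split=> [|c x y hx hy]; first exact: span0.
elim: hx => [|d g x' hg _ IH]; first by rewrite scaler0 add0r.
by rewrite scalerDr scalerA -addrA; exact: spanA.
Qed.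

Lemma orbit_w : orbit_span w.
Proof.
have := @spanA 1 _ _ (inSU1 C m.+1) span0.
by rewrite scale1r addr0 (cyc1 hW).
Qed.

Lemma orbit_act g x : G g -> orbit_span x -> orbit_span (W g *m x).
Proof.
move=> hg; elim=> [|c h y hh _ IH]; first by rewrite mulmx0; exact: span0.
by rewrite mulmxDr -scalemxAr (cycM hW); apply: spanA => //; exact: inSUM.
Qed.

Lemma orbitM g h x : orbit_span x -> W (g *m h) *m x = W g *m (W h *m x).
Proof.
elim=> [|c k y _ _ IH]; first by rewrite !mulmx0.
by rewrite !mulmxDr -!scalemxAr IH !(cycM hW) -mulmxA.
Qed.

Lemma orbit1 x : orbit_span x -> W 1%:M *m x = x.
Proof.
elim=> [|c k y _ _ IH]; first by rewrite !mulmx0.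
by rewrite !mulmxDr -!scalemxAr IH !(cycM hW) mul1mx.
Qed.

Lemma orbit_dot g x y : G g -> orbit_span x -> orbit_span y ->
  (W g *m x)^t* *m (W g *m y) = x^t* *m y.
Proof.
move=> [/unitaryP[_ gg] _] hx; elim: hx y => [|c k x' _ _ IHx] y hy.
  by rewrite mulmx0 !ctmx0 !mul0mx.
rewrite mulmxDr !ctmxD !mulmxDl IHx //; congr (_ + _).
rewrite -scalemxAr !ctmxZ -!scalemxAl; congr (_ *: _).
elim: hy => [|d l y' _ _ IHy]; first by rewrite !mulmx0.
rewrite !mulmxDr IHy -!scalemxAr; congr (_ *: _ + _).
rewrite !(cycM hW) !(cyc_dot hW) ctmxM -mulmxA [g^t* *m _]mulmxA gg mul1mx //.
Qed.

Lemma orbit_cont x y (g : nat -> M) h : orbit_span x -> orbit_span y -> mcv g h ->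
  mcv (fun k => x^t* *m (W (g k) *m y)) (x^t* *m (W h *m y)).
Proof.
move=> hx hy gh; elim: hx => [|c a x' _ _ IHx].
  by rewrite ctmx0 mul0mx; under eq_fun do rewrite mul0mx; exact: mcv_cst.
rewrite ctmxD mulmxDl; under eq_fun do rewrite mulmxDl; apply: mcvD => //.
rewrite ctmxZ -scalemxAl; under eq_fun do rewrite -scalemxAl.
apply: mcvZ; first exact: cvg_cst.
elim: hy => [|d b y' _ _ IHy].
  by rewrite !mulmx0; under eq_fun do rewrite !mulmx0; exact: mcv_cst.
rewrite !mulmxDr; under eq_fun do rewrite !mulmxDr; apply: mcvD => //.
rewrite -!scalemxAr; under eq_fun do rewrite -!scalemxAr.
apply: mcvZ; first exact: cvg_cst.
rewrite (cycM hW) (cyc_dot hW); under eq_fun do rewrite (cycM hW) (cyc_dot hW).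
exact: (cyc_cont hW (mcvM (mcv_cst _) (mcvM gh (mcv_cst _)))).
Qed.

Lemma achar_conj (l : weight m) (t : 'rV[C]_m.+2) : achar l (map_mx Num.conj t) = (achar l t)^*.
Proof.
rewrite /achar rmorph_prod; apply: eq_bigr => k _; rewrite fmorphXz rmorph_prod.
by congr (_ ^ _); apply: eq_bigr => p _; rewrite mxE.
Qed.

(** On the torus [W] is diagonal in the standard basis with characters as entries. Consequently the
    projection onto the orbit span commutes with the torus and respects weights. *)
Lemma torus_ct t : G (diag_mx t) -> W ((diag_mx t)^t*) = (W (diag_mx t))^t*.
Proof.
move=> ht; have ht' : G (diag_mx (map_mx Num.conj t)).
  by rewrite -map_diag_mx -tr_diag_mx; exact: inSUct.
apply/matrixP => i j; rewrite 2!mxE.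
have entry (t' : 'rV[C]_m.+2) a b : W (diag_mx t') a b = (W (diag_mx t') *m delta_mx b 0) a (0 : 'I_1).
  by rewrite -colE mxE.
rewrite tr_diag_mx map_diag_mx !entry.
have [l [_ hl]] := cyc_wt hW i; have [l' [_ hl']] := cyc_wt hW j.
rewrite hl // hl' // !mxE !eqxx !andbT rmorphM rmorph_nat achar_conj.
have [E|ij] := eqVneq i j; last by rewrite !mulr0.
rewrite !mulr1; subst j.
have := hl t ht; rewrite hl' // => /matrixP/(_ i 0); rewrite !mxE !eqxx !mulr1 => -> //.
Qed.

(** An orthonormal basis [B] of the orbit span turns [W] into a unitary representation, and [j]
    takes its values in that span, so that nothing of the compression is lost. *)
Theorem cyc_urep N' (q : M -> 'M[C]_N') (j : 'M[C]_(N, N')) vmu : irr (@inK C m) q ->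
  intK q W j -> j *m vmu = w -> vmu != 0 ->
  exists r (V0 : M -> 'M[C]_r) (j0 : 'M[C]_(r, N')),
    [/\ urep G V0, weight_spanned la V0, intK q V0 j0 &
        forall g, G g -> j^t* *m W g *m j = j0^t* *m V0 g *m j0].
Proof.
move=> iq hj hw vmu0.
have [r [B [Bo hB]]] := orthonormal_basis subsp_orbit.
have PB y : orbit_span (B *m y) by apply/hB; rewrite [B^t* *m _]mulmxA Bo mul1mx.
have BB x : orbit_span x -> B *m (B^t* *m x) = x by move/hB.
(* The vectors sent into the span form a K-invariant subspace containing [vmu]. *)
have Pj x : orbit_span (j *m x).
  apply: (irr_ind (P := fun x => orbit_span (j *m x)) iq _ _ _ vmu0).
  - split=> [|c y z hy hz]; first by rewrite mulmx0; exact: span0.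
    by rewrite mulmxDr -scalemxAr; apply: subspD subsp_orbit _ hz; exact: subspZ subsp_orbit hy.
  - by move=> g z hg hz; rewrite mulmxA hj // -mulmxA; apply: orbit_act => //; case: hg.
  - by rewrite hw; exact: orbit_w.
have jE : B *m (B^t* *m j) = j by apply: mulmx_ext => x; rewrite -!mulmxA BB.
have key h : G h -> B *m B^t* *m W h *m (B *m B^t*) = W h *m (B *m B^t*).
  move=> hh; apply: mulmx_ext => x; rewrite -!mulmxA BB //; exact: orbit_act.
have torusC t : G (diag_mx t) -> W (diag_mx t) *m (B *m B^t*) = B *m B^t* *m W (diag_mx t).
  move=> ht; have := congr1 (fun A => A^t*) (key _ (inSUct ht)).
  rewrite (torus_ct ht) !ctmxM !trmxCK !mulmxA => h.
  by rewrite -[RHS]h -[LHS]mulmxA -key // !mulmxA.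
exists r, (fun g => B^t* *m W g *m B), (B^t* *m j); split.
- split.
  + by apply: mulmx_ext => x; rewrite mul1mx -!mulmxA orbit1 // mulmxA Bo mul1mx.
  + move=> g h hg hh; apply: mulmx_ext => x; rewrite -!mulmxA orbitM // [in RHS]BB //.
    exact: orbit_act.
  + move=> g hg; apply/unitarymxP; apply: mulmx1C; apply: mulmx_ext => x.
    rewrite mul1mx; set z := _ *m x.
    (* Unitarity is tested against an arbitrary y, since W g preserves inner products on the orbit
       span. *)
    have H (y : 'cV[C]_r) : y^t* *m z = y^t* *m x.
      rewrite /z !ctmxM trmxCK -!mulmxA BB; last exact: orbit_act.
      transitivity ((W g *m (B *m y))^t* *m (W g *m (B *m x))); first by rewrite !ctmxM -!mulmxA.
      by rewrite orbit_dot // ctmxM -!mulmxA [B^t* *m (B *m _)]mulmxA Bo mul1mx.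
    by apply/eqP; rewrite -subr_eq0; apply/eqP; apply: ker_adj; rewrite mulmxBr H subrr.
  + move=> g h hg hh gh; split=> a b.
    have [/(_ 0 0)] := orbit_cont (PB (delta_mx a 0)) (PB (delta_mx b 0)) gh.
    have E k : ((B *m delta_mx a 0)^t* *m (W k *m (B *m delta_mx b (0 : 'I_1)))) 0 0 =
      (B^t* *m W k *m B) a b.
      rewrite ctmxM trmx_delta map_delta_mx !mulmxA -colE mxE -!mulmxA.
      rewrite mxE (bigD1 a) //= mxE !eqxx mul1r big1 ?addr0 // => c /negbTE ca.
      by rewrite mxE ca andbF mul0r.
    by rewrite E; under eq_fun do rewrite E.
(* The spanning weight vectors are the projections of the standard basis vectors of the ambient
   space. *)
- exists N, (B^t* ), B; split=> // i; have [l [hl hi]] := cyc_wt hW i.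
  exists l; split=> // t ht; rewrite colE mulmxA -[_ *m B *m _]mulmxA -[_ *m W _ *m _]mulmxA torusC //.
  by rewrite !mulmxA Bo mul1mx -mulmxA hi // scalemxAr.
- by move=> k hk; rewrite -!mulmxA jE hj.
- move=> g hg; rewrite ctmxM trmxCK -!mulmxA jE [B *m _]mulmxA [j^t* *m (_ *m (W g *m j))]mulmxA.
  have -> : j^t* *m (B *m B^t*) = j^t* by rewrite -[in RHS]jE !ctmxM trmxCK mulmxA.
  by rewrite mulmxA.
Qed.

End SpanRep.
End Cyclic.

(** * The invariant vectors and the elements a_t *)

Section Invariants.
Variables (C : numClosedFieldType) (m : nat).
Local Notation M := 'M[C]_m.+2.
Local Notation G := (@inSU C m.+1).
Local Notation K := (@inK C m).

Definition aevec (k : nat) : 'cV[C]_m.+2 := delta_mx (inord k.-1) 0.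

Definition alam12 : 'cV[C]_#|{: lset m 2}| := awedge (fun q : 'I_2 => aevec q.+1).
Definition alam2 : 'cV[C]_#|{: lset m m.+1}| := awedge (fun q : 'I_m.+1 => aevec q.+2).
Definition alam13 : 'cV[C]_#|{: lset m m.+1}| :=
  awedge (fun q : 'I_m.+1 => aevec (if q == ord0 then 1 else q.+2)).
Definition alam3 : 'cV[C]_#|{: lset m m}| := awedge (fun q : 'I_m => aevec q.+3).
Definition alam1 (k : nat) : 'cV[C]_#|{: lset m 1}| := awedge (fun _ : 'I_1 => aevec k).

Definition av1 : 'cV[C]_(#|{: lset m 1}| * #|{: lset m m.+1}|) :=
  (alam1 1 *t alam2 : 'cV[C]_(_ * _)) - alam1 2 *t alam13.
Definition av2 : 'cV[C]_(#|{: lset m 2}| * #|{: lset m m}|) := alam12 *t alam3.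

(** For determinant 1 the adjugate is the inverse, and for a unitary matrix the inverse is the
    adjoint. *)
Lemma cofactor_SU (g : M) k l : G g -> cofactor g k l = (g k l)^*.
Proof.
move=> [/unitaryP[_ g2] dg]; have := mul_mx_adj g; rewrite dg => h.
have : \adj g = g^t* by rewrite -[LHS]mul1mx -g2 -mulmxA h mulmx1.
by move/matrixP/(_ l k); rewrite !mxE.
Qed.

Lemma evec_dot (g : M) a b : ((aevec a)^t* *m (g *m aevec b)) 0 0 = g (inord a.-1) (inord b.-1).
Proof.
rewrite -colE trmx_delta map_delta_mx mxE (bigD1 (inord a.-1)) //= big1 => [|k /negbTE ka].
  by rewrite addr0 !mxE !eqxx mul1r.
by rewrite mxE ka andbF mul0r.
Qed.

Lemma wedge_dot l (g : M) (f h : 'I_l -> nat) :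
  ((awedge (fun q => aevec (f q)))^t* *m (aLam l g *m awedge (fun q => aevec (h q)))) 0 0 =
  \det (mxsub (fun p => inord (f p).-1) (fun p => inord (h p).-1) g).
Proof.
rewrite aLam_wedge awedge_dot; congr (\det _); apply/matrixP => p q.
by rewrite mxE evec_dot mxE.
Qed.

Lemma addmxE (A B : 'M[C]_1) i j : (A + B) i j = A i j + B i j.
Proof. by rewrite mxE. Qed.

Lemma oppmxE (A : 'M[C]_1) i j : (- A) i j = - A i j.
Proof. by rewrite mxE. Qed.

Lemma tens11 (A B : 'M[C]_1) : ((A *t B : 'M[C]_1) 0 0) = A 0 0 * B 0 0.
Proof. by rewrite mxE; congr (A _ _ * B _ _); exact: ord1. Qed.

Definition i0 : 'I_m.+2 := inord 0.
Definition i1 : 'I_m.+2 := inord 1.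

(** The matrix entry of g between wedges omitting the basis vectors I and J is the minor (-1)^(I+J)
    times the cofactor. The minus sign in v_1 compensates these signs in the mixed terms. *)
Lemma dot_av1_cofactor (g : M) :
  (av1^t* *m ((aLam 1 g *t aLam m.+1 g) *m av1)) 0 0 =
  g i0 i0 * cofactor g i0 i0 + g i0 i1 * cofactor g i0 i1
  + (g i1 i0 * cofactor g i1 i0 + g i1 i1 * cofactor g i1 i1).
Proof.
have v0 : i0 = 0%N :> nat by rewrite inordK.
have v1 : i1 = 1%N :> nat by rewrite inordK.
have l0 (p : 'I_m.+1) : inord p.+1 = lift i0 p.
  by apply: val_inj; rewrite /= /bump v0 inordK //= ltnS.
have l1 (p : 'I_m.+1) : inord (if p == ord0 then 1 else p.+2).-1 = lift i1 p.
  apply: val_inj; rewrite /= /bump v1; case: eqVneq => [->|p0]; first by rewrite inordK.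
  have -> : (0 < p)%N by rewrite lt0n; exact: p0.
  by rewrite add1n /= inordK // ltnS.
have wl k l : ((alam1 k)^t* *m (aLam 1 g *m alam1 l)) 0 0 = g (inord k.-1) (inord l.-1).
  by rewrite /alam1 wedge_dot det_mx11 mxE.
have minor (f h : 'I_m.+1 -> nat) (I J : 'I_m.+2) : (forall p, inord (f p).-1 = lift I p) ->
    (forall p, inord (h p).-1 = lift J p) ->
    ((awedge (fun q => aevec (f q)))^t* *m (aLam m.+1 g *m awedge (fun q => aevec (h q)))) 0 0
    = (-1) ^+ (I + J) * cofactor g I J.
  move=> hf hh; rewrite wedge_dot /cofactor mulrA -exprD addnn -muln2 exprM sqrr_sign mul1r.
  by congr (\det _); apply/matrixP => p q; rewrite !mxE hf hh.
rewrite /av1 mulmxBr !tens_act ctmxD ctmxN mulmxDl mulNmx !mulmxBr !tens_dot.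
rewrite !(addmxE, oppmxE) !tens11 !wl /alam2 /alam13.
pose F0 (p : 'I_m.+1) := p.+2; pose F1 (p : 'I_m.+1) := if p == ord0 then 1%N else p.+2.
rewrite (minor F0 F0 i0 i0 l0 l0) (minor F0 F1 i0 i1 l0 l1) (minor F1 F0 i1 i0 l1 l0).
rewrite (minor F1 F1 i1 i1 l1 l1).
rewrite -/i0 -/i1 !v0 !v1.
by ring.
Qed.

Lemma dot_av1 (g : M) : G g ->
  (av1^t* *m ((aLam 1 g *t aLam m.+1 g) *m av1)) 0 0 =
  g i0 i0 * (g i0 i0)^* + g i0 i1 * (g i0 i1)^* + (g i1 i0 * (g i1 i0)^* + g i1 i1 * (g i1 i1)^*).
Proof. by move=> hg; rewrite dot_av1_cofactor !cofactor_SU. Qed.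

(* Jacobi's identity for complementary minors: with g = (A B; C D) unitary,
   g (A^* 0; B^* 1) = (1 B; 0 D). *)
Lemma dr_det (g : M) : G g ->
  \det (drsubmx (g : 'M[C]_(2 + m))) = (\det (ulsubmx (g : 'M[C]_(2 + m))))^*.
Proof.
move=> [/unitaryP[g1 _] dg]; set g' : 'M[C]_(2 + m) := g.
have h : g' *m block_mx ((ulsubmx g')^t* ) 0 ((ursubmx g')^t* ) 1%:M =
    block_mx 1%:M (ursubmx g') 0 (drsubmx g').
  have : g' *m g'^t* = 1%:M by exact: g1.
  rewrite -{1 2}[g']submxK tr_block_mx map_block_mx mulmx_block scalar_mx_block.
  case/eq_block_mx => h1 _ h2 _.
  by rewrite -{1}[g']submxK mulmx_block !mulmx1 !mulmx0 !add0r h1 h2.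
have := congr1 (fun A => \det A) h; rewrite det_mulmx det_ublock det1 mul1r det_lblock det1 mulr1.
by rewrite [\det g']dg mul1r det_map_mx det_tr => ->.
Qed.

Lemma dot_av2 (g : M) : G g ->
  (av2^t* *m ((aLam 2 g *t aLam m g) *m av2)) 0 0 =
  \det (ulsubmx (g : 'M[C]_(2 + m))) * (\det (ulsubmx (g : 'M[C]_(2 + m))))^*.
Proof.
move=> hg; rewrite /av2 tens_act tens_dot tens11 !wedge_dot -dr_det //.
congr (_ * _); apply: congr1; apply/matrixP => p q; rewrite !mxE.
  by congr (g _ _); apply: val_inj; rewrite /= inordK //; apply: (leq_trans (ltn_ord _)).
by congr (g _ _); apply: val_inj; rewrite /= inordK // !ltnS ltn_ord.
Qed.

Lemma invariant N (W : M -> 'M[C]_N) la (v : 'cV[C]_N) g : star_rep la W -> G g ->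
  v^t* *m (W g *m v) = v^t* *m v -> W g *m v = v.
Proof.
move=> hW [/unitaryP[_ g2] _] h; apply/eqP; rewrite -subr_eq0; apply/eqP; apply: ker_adj.
have h' : (W g *m v)^t* *m v = v^t* *m v.
  by have := congr1 (fun A => A^t*) h; rewrite !ctmxM !trmxCK.
have h2 : (W g *m v)^t* *m (W g *m v) = v^t* *m v.
  by rewrite ctmxM -(star_ct hW) -mulmxA [W _ *m (W g *m v)]mulmxA -(starM hW) g2 (star1 hW) mul1mx.
by rewrite ctmxD ctmxN mulmxDl mulNmx !mulmxBr h h' h2 !subrr.
Qed.

Lemma mx11_eq (A B : 'M[C]_1) : A 0 0 = B 0 0 -> A = B.
Proof. by move=> h; apply/matrixP => i j; rewrite !ord1. Qed.

Lemma star1v N (W : M -> 'M[C]_N) la (v : 'cV[C]_N) : star_rep la W ->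
  v^t* *m v = v^t* *m (W 1%:M *m v).
Proof. by move=> hW; rewrite (star1 hW) mul1mx. Qed.

Lemma av1_inv k : K k -> (aLam 1 k *t aLam m.+1 k) *m av1 = av1.
Proof.
have hs := star_tens (star_Lam C m 1) (star_Lam C m m.+1).
move=> [hk bk]; apply: (invariant hs hk); rewrite (star1v av1 hs); apply: mx11_eq.
rewrite !dot_av1 //; last exact: inSU1.
have v0 : i0 = 0%N :> nat by rewrite inordK.
have v1 : i1 = 1%N :> nat by rewrite inordK.
have i01 : i0 != i1 by rewrite -val_eqE /= v0 v1.
have rowk (r : 'I_m.+2) : (r < 2)%N -> k r i0 * (k r i0)^* + k r i1 * (k r i1)^* = 1.
  move=> r2; have [/unitaryP[/matrixP/(_ r r) h _] _] := hk.
  rewrite !mxE eqxx (bigD1 i0) //= (bigD1 i1) /= in h; last by rewrite eq_sym.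
  move: h; rewrite [X in _ + (_ + X)]big1 ?addr0 => [|l /andP[l0 l1]]; first by rewrite !mxE.
  rewrite bk ?mul0r // r2; apply/eqP => /esym l2.
  case: l l0 l1 l2 => -[|[|l]] hl // /eqP l0 /eqP l1 _.
    by apply: l0; apply: val_inj; rewrite /= v0.
  by apply: l1; apply: val_inj; rewrite /= v1.
rewrite !rowk ?v0 ?v1 // !mxE !eqxx (negbTE i01) eq_sym (negbTE i01).
by rewrite !mul0r !mul1r rmorph1 addr0 add0r.
Qed.

Lemma av2_inv k : K k -> (aLam 2 k *t aLam m k) *m av2 = av2.
Proof.
have hs := star_tens (star_Lam C m 2) (star_Lam C m m).
move=> [hk bk]; apply: (invariant hs hk); rewrite (star1v av2 hs); apply: mx11_eq.
rewrite !dot_av2 //; last exact: inSU1.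
have one : ulsubmx (1%:M : 'M[C]_(2 + m)) = 1%:M by rewrite scalar_mx_block block_mxKul.
rewrite one det1 rmorph1 mulr1; set k' : 'M[C]_(2 + m) := k.
have ur0 : ursubmx k' = 0.
  by apply/matrixP => a b; rewrite mxE [RHS]mxE mxE; apply: bk; rewrite /= (leq_trans (ltn_ord a)).
have : k' *m k'^t* = 1%:M by have [/unitaryP[]] := hk.
rewrite -[k']submxK ur0 tr_block_mx map_block_mx mulmx_block scalar_mx_block.
case/eq_block_mx => h _ _ _; rewrite block_mxKul; move: h.
rewrite trmx0 map_mx0 mulmx0 addr0 => /(congr1 (fun A => \det A)).
by rewrite det_mulmx det_map_mx det_tr det1.
Qed.

(** The parameters [s1] and [s2] stand for i sin t_1 and i sin t_2, so the multiplication law in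
    [aaeltM] is polynomial with plus signs only. *)
Definition aaelt (c1 s1 c2 s2 : C) : M :=
  \matrix_(k, l)
    (if l == inord 0 then c1 *: aevec 1 + s1 *: aevec m.+2
     else if l == inord m.+1 then s1 *: aevec 1 + c1 *: aevec m.+2
     else if l == inord 1 then c2 *: aevec 2 + s2 *: aevec m.+1
     else if l == inord m then s2 *: aevec 2 + c2 *: aevec m.+1
     else aevec l.+1) k 0.

Hypothesis hm : (2 < m)%N.

Let e0 := aevec 1.
Let e1 := aevec 2.
Let em := aevec m.+1.
Let en := aevec m.+2.

Lemma inord_eqF (a b : nat) : (a < m.+2)%N -> (b < m.+2)%N -> a != b ->
  ((inord a : 'I_m.+2) == inord b) = false.
Proof. by move=> ha hb ab; rewrite -val_eqE /= !inordK // (negbTE ab). Qed.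

Lemma aaelt_col c1 s1 c2 s2 (l : 'I_m.+2) : aaelt c1 s1 c2 s2 *m delta_mx l 0 =
  (if l == inord 0 then c1 *: e0 + s1 *: en
     else if l == inord m.+1 then s1 *: e0 + c1 *: en
     else if l == inord 1 then c2 *: e1 + s2 *: em
     else if l == inord m then s2 *: e1 + c2 *: em
     else delta_mx l 0).
Proof.
rewrite -colE; apply/colP => k; rewrite mxE mxE /e0 /e1 /em /en.
by do 4 (case: ifP => _ //); rewrite /aevec /= inord_val.
Qed.

Lemma aaelt_e c1 s1 c2 s2 :
  [/\ aaelt c1 s1 c2 s2 *m e0 = c1 *: e0 + s1 *: en,
      aaelt c1 s1 c2 s2 *m en = s1 *: e0 + c1 *: en,
      aaelt c1 s1 c2 s2 *m e1 = c2 *: e1 + s2 *: em &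
      aaelt c1 s1 c2 s2 *m em = s2 *: e1 + c2 *: em].
Proof.
have hm2 : (m < m.+2)%N by [].
rewrite {1}/e0 {1}/e1 {1}/em {1}/en /aevec /= !aaelt_col !eqxx.
rewrite !inord_eqF //; lia.
Qed.

Lemma mulmx_basis N (A B : 'M[C]_(N, m.+2)) : (forall l, A *m delta_mx l (0 : 'I_1) = B *m delta_mx l 0) -> A = B.
Proof. by move=> h; apply/matrixP => i l; have /colP/(_ i) := h l; rewrite -!colE !mxE. Qed.

Lemma aaeltM c1 s1 c2 s2 d1 r1 d2 r2 : aaelt c1 s1 c2 s2 *m aaelt d1 r1 d2 r2 =
  aaelt (c1 * d1 + s1 * r1) (c1 * r1 + s1 * d1) (c2 * d2 + s2 * r2) (c2 * r2 + s2 * d2).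
Proof.
have [a1 a2 a3 a4] := aaelt_e c1 s1 c2 s2.
apply: mulmx_basis => l; rewrite -mulmxA !aaelt_col.
have comb (x y : 'cV[C]_m.+2) (a b a' b' d r : C) :
    d *: (a *: x + b *: y) + r *: (a' *: x + b' *: y) = (d * a + r * a') *: x + (d * b + r * b') *: y.
  by rewrite !scalerDr !scalerA addrACA -!scalerDl.
case: ifP => h0; first by rewrite mulmxDr -!scalemxAr a1 a2 comb; congr (_ *: _ + _ *: _); ring.
case: ifP => h1; first by rewrite mulmxDr -!scalemxAr a1 a2 comb; congr (_ *: _ + _ *: _); ring.
case: ifP => h2; first by rewrite mulmxDr -!scalemxAr a3 a4 comb; congr (_ *: _ + _ *: _); ring.
case: ifP => h3; first by rewrite mulmxDr -!scalemxAr a3 a4 comb; congr (_ *: _ + _ *: _); ring.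
by rewrite aaelt_col h0 h1 h2 h3.
Qed.

Lemma aaelt1 : aaelt 1 0 1 0 = 1%:M.
Proof.
apply: mulmx_basis => l; rewrite aaelt_col mul1mx !scale1r !scale0r !addr0 !add0r.
by do 4 (case: eqP => [->|_]; first by []).
Qed.

Lemma aaelt_entry c1 s1 c2 s2 a b : aaelt c1 s1 c2 s2 a b =
  if b == inord 0 then c1 * (a == inord 0)%:R + s1 * (a == inord m.+1)%:R
  else if b == inord m.+1 then s1 * (a == inord 0)%:R + c1 * (a == inord m.+1)%:R
  else if b == inord 1 then c2 * (a == inord 1)%:R + s2 * (a == inord m)%:R
  else if b == inord m then s2 * (a == inord 1)%:R + c2 * (a == inord m)%:R
  else (a == b)%:R.
Proof.
have -> : aaelt c1 s1 c2 s2 a b = (aaelt c1 s1 c2 s2 *m delta_mx b (0 : 'I_1)) a 0 by rewrite -colE [RHS]mxE.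
by rewrite aaelt_col; do 4 (case: ifP => _; first by rewrite !mxE !andbT); rewrite mxE andbT.
Qed.

Lemma aaelt_ct c1 s1 c2 s2 : (aaelt c1 s1 c2 s2)^t* = aaelt (c1^*) (s1^*) (c2^*) (s2^*).
Proof.
have hm2 : (m < m.+2)%N by [].
have n0 : inord 0 != inord m.+1 :> 'I_m.+2 by rewrite inord_eqF.
have n1 : inord 0 != inord 1 :> 'I_m.+2 by rewrite inord_eqF.
have n2 : inord 0 != inord m :> 'I_m.+2 by rewrite inord_eqF //; lia.
have n3 : inord 1 != inord m :> 'I_m.+2 by rewrite inord_eqF //; lia.
have n4 : inord 1 != inord m.+1 :> 'I_m.+2 by rewrite inord_eqF //; lia.
have n5 : inord m != inord m.+1 :> 'I_m.+2 by rewrite inord_eqF //; lia.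
apply/matrixP => a b; rewrite 2!mxE !aaelt_entry !(fun_if Num.conj).
rewrite !rmorphD !rmorphM !rmorph_nat /=.
(* What matters from here on is that the four special indices are distinct. *)
move: (inord 0) (inord 1) (inord m) (inord m.+1) n0 n1 n2 n3 n4 n5 => x0 x1 xm xn.
move=> /negbTE n0 /negbTE n1 /negbTE n2 /negbTE n3 /negbTE n4 /negbTE n5.
pose nn := (n0, n1, n2, n3, n4, n5, eq_sym xn x0, eq_sym x1 x0, eq_sym xm x0, eq_sym xm x1, eq_sym xn x1, eq_sym xn xm).
pose simp := (mulr0, mulr1, addr0, add0r, eqxx).
have [->|a0] := eqVneq a x0; last have [->|an] := eqVneq a xn;
  last have [->|a1] := eqVneq a x1; last have [->|am] := eqVneq a xm.
all: have [E|b0] := eqVneq b x0; last have [E|bn] := eqVneq b xn;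
  last have [E|b1] := eqVneq b x1; last have [E|bm] := eqVneq b xm.
all: try rewrite E.
all: rewrite ?nn ?simp //.
all: by rewrite eq_sym ?(negbTE a0) ?(negbTE an) ?(negbTE a1) ?(negbTE am).
Qed.

(* The element is the square of the one B with half angles, and B^-1 = J B J for a diagonal
   sign matrix J, so that det B^2 = 1. *)
Lemma aaelt_SU c1 s1 c2 s2 d1 r1 d2 r2 :
  c1 = d1 ^+ 2 + r1 ^+ 2 -> s1 = d1 * r1 *+ 2 -> c2 = d2 ^+ 2 + r2 ^+ 2 -> s2 = d2 * r2 *+ 2 ->
  d1 ^+ 2 - r1 ^+ 2 = 1 -> d2 ^+ 2 - r2 ^+ 2 = 1 ->
  d1^* = d1 -> r1^* = - r1 -> d2^* = d2 -> r2^* = - r2 ->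
  G (aaelt c1 s1 c2 s2).
Proof.
move=> hc1 hs1 hc2 hs2 h1 h2 k1 k2 k3 k4; pose B := aaelt d1 r1 d2 r2.
have -> : aaelt c1 s1 c2 s2 = B *m B.
  by rewrite aaeltM hc1 hs1 hc2 hs2; congr aaelt; ring.
have Bt : B^t* = aaelt d1 (- r1) d2 (- r2) by rewrite aaelt_ct k1 k2 k3 k4.
have BB : B *m B^t* = 1%:M.
  by rewrite Bt aaeltM -aaelt1; congr aaelt; [rewrite -h1| |rewrite -h2|]; ring.
have uB : B \is unitarymx by apply/unitarymxP.
pose J : M := diag_mx (\row_l (if (l == inord m) || (l == inord m.+1) then -1 else 1)).
have JE l : J *m delta_mx l (0 : 'I_1) =
    (if (l == inord m) || (l == inord m.+1) then -1 else 1) *: delta_mx l 0.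
  rewrite mul_diag_mx; apply/colP => k; rewrite !mxE.
  by case: (eqVneq k l) => [->|]; rewrite ?mulr0.
have hm2 : (m < m.+2)%N by [].
have J0 : J *m e0 = e0 by rewrite JE !inord_eqF ?scale1r //; lia.
have J1 : J *m e1 = e1 by rewrite JE !inord_eqF ?scale1r //; lia.
have Jm : J *m em = - em by rewrite JE eqxx scaleN1r.
have Jn : J *m en = - en by rewrite JE eqxx orbT scaleN1r.
have JJ : J *m J = 1%:M.
  apply: mulmx_basis => l; rewrite -mulmxA JE -scalemxAr JE scalerA mul1mx.
  by case: ifP => _; rewrite ?mulrNN mulr1 scale1r.
have JB : J *m B *m J = B^t*.
  rewrite Bt; apply: mulmx_basis => l; rewrite -!mulmxA JE -!scalemxAr !aaelt_col.
  have [->|l0] := eqVneq l (inord 0).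
    by rewrite !inord_eqF ?scale1r ?mulmxDr -?scalemxAr ?J0 ?Jn ?scalerN ?scaleNr //; lia.
  have [->|l1] := eqVneq l (inord m.+1).
    by rewrite orbT scaleN1r mulmxDr -!scalemxAr J0 Jn opprD scaleNr scalerN opprK.
  have [->|l2] := eqVneq l (inord 1).
    by rewrite !inord_eqF ?scale1r ?mulmxDr -?scalemxAr ?J1 ?Jm ?scalerN ?scaleNr //; lia.
  have [_|l3] := eqVneq l (inord m).
    by rewrite /= scaleN1r mulmxDr -!scalemxAr J1 Jm opprD scaleNr scalerN opprK.
  by rewrite /= scale1r JE (negbTE l1) (negbTE l3) scale1r.
split; first exact: mul_unitarymx.
have dJ : \det J * \det J = 1 by rewrite -det_mulmx JJ det1.
have : \det (B *m B^t*) = 1 by rewrite BB det1.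
rewrite -JB !det_mulmx => h; rewrite -[RHS]h -[LHS]mulr1 -dJ; ring.
Qed.

Lemma det_ul2 (A : 'M[C]_(2 + m)) : A (lshift m 0) (lshift m 1) = 0 ->
  \det (ulsubmx A) = A (lshift m 0) (lshift m 0) * A (lshift m 1) (lshift m 1).
Proof.
move=> h; rewrite det_trig; last first.
  apply/is_trig_mxP => -[[|[|//]] a] [[|[|//]] b] // _; rewrite 2!mxE -[RHS]h.
  by congr (A _ _); apply: val_inj.
by rewrite big_ord_recl big_ord1 !mxE; congr (A _ _ * A _ _); apply: val_inj.
Qed.

Lemma aaelt_block c1 s1 c2 s2 :
  \det (ulsubmx (aaelt c1 s1 c2 s2 : 'M[C]_(2 + m))) = c1 * c2 /\
  [/\ aaelt c1 s1 c2 s2 i0 i0 = c1, aaelt c1 s1 c2 s2 i0 i1 = 0,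
      aaelt c1 s1 c2 s2 i1 i0 = 0 & aaelt c1 s1 c2 s2 i1 i1 = c2].
Proof.
have H : [/\ aaelt c1 s1 c2 s2 i0 i0 = c1, aaelt c1 s1 c2 s2 i0 i1 = 0,
      aaelt c1 s1 c2 s2 i1 i0 = 0 & aaelt c1 s1 c2 s2 i1 i1 = c2].
  have hm2 : (m < m.+2)%N by [].
  rewrite !aaelt_entry /i0 /i1 !eqxx.
  by rewrite !inord_eqF ?(mulr0, mulr1, addr0) //; lia.
split=> //; case: H => h1 h2 h3 h4.
have l0 : lshift m (0 : 'I_2) = i0 by apply: val_inj; rewrite /= inordK.
have l1 : lshift m (1 : 'I_2) = i1 by apply: val_inj; rewrite /= inordK.
by rewrite det_ul2 l0 l1 ?h1 ?h4.
Qed.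

Lemma av1_aaelt c1 s1 c2 s2 : G (aaelt c1 s1 c2 s2) -> c1^* = c1 -> c2^* = c2 ->
  av1^t* *m ((aLam 1 (aaelt c1 s1 c2 s2) *t aLam m.+1 (aaelt c1 s1 c2 s2)) *m av1) =
  (c1 ^+ 2 + c2 ^+ 2)%:M.
Proof.
move=> hg r1 r2; apply: mx11_eq; rewrite dot_av1 // [RHS]mxE eqxx mulr1n.
have [_ [-> -> -> ->]] := aaelt_block c1 s1 c2 s2.
by rewrite r1 r2 !mul0r addr0 add0r !expr2.
Qed.

Lemma av2_aaelt c1 s1 c2 s2 : G (aaelt c1 s1 c2 s2) -> c1^* = c1 -> c2^* = c2 ->
  av2^t* *m ((aLam 2 (aaelt c1 s1 c2 s2) *t aLam m (aaelt c1 s1 c2 s2)) *m av2) =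
  (c1 ^+ 2 * c2 ^+ 2)%:M.
Proof.
move=> hg r1 r2; apply: mx11_eq; rewrite dot_av2 // [RHS]mxE eqxx mulr1n.
have [-> _] := aaelt_block c1 s1 c2 s2.
by rewrite rmorphM /= r1 r2 -expr2 exprMn.
Qed.

End Invariants.

(** * Splitting off an invariant tensor factor *)

Section TensorFactor.
Variables (C : numClosedFieldType) (m : nat).
Local Notation M := 'M[C]_m.+2.
Local Notation K := (@inK C m).

(** The matrix of the map sending x to the tensor product of v with j x. *)
Definition tcol N1 N2 N' (v : 'cV[C]_N1) (j : 'M[C]_(N2, N')) : 'M[C]_(N1 * N2, N') :=
  \matrix_(i, k) (v *t col k j) i 0.

Lemma tcolE N1 N2 N' (v : 'cV[C]_N1) (j : 'M[C]_(N2, N')) (x : 'cV[C]_N') :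
  tcol v j *m x = (v *t (j *m x) : 'cV[C]_(N1 * N2)).
Proof.
apply/colP => i; rewrite !mxE mulr_sumr; apply: eq_bigr => k _.
by rewrite /tcol !mxE -mulrA; congr (_ * (_ * x _ _)); exact/esym/ord1.
Qed.

(** The inner product of a tensor product factors, and the first factor is <v, A v> = c
    independently of the vectors on which the identity is tested. *)
Lemma tcol_compress N1 N2 N' (v : 'cV[C]_N1) (j : 'M[C]_(N2, N')) (A : 'M[C]_N1) (B : 'M[C]_N2) c :
  v^t* *m (A *m v) = c%:M ->
  (tcol v j)^t* *m (A *t B) *m tcol v j = c *: (j^t* *m B *m j).
Proof.
move=> hc; apply: mulmx_ext => y; apply/eqP; rewrite -subr_eq0; apply/eqP.
have ext (z : 'cV[C]_N') : (forall x : 'cV[C]_N', x^t* *m z = 0) -> z = 0.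
  by move=> h; apply: ker_adj; exact: h.
apply: ext => x; rewrite mulmxBr -!mulmxA tcolE tens_act [x^t* *m _]mulmxA -ctmxM tcolE tens_dot hc.
have -> (Z : 'M[C]_1) : ((c%:M : 'M[C]_1) *t Z : 'M[C]_1) = c *: Z.
  by apply: mx11_eq; rewrite tens11 !mxE eqxx mulr1n.
by rewrite ctmxM -scalemxAl -scalemxAr -!mulmxA subrr.
Qed.

Lemma tcol_int N1 N2 N' (q : M -> 'M[C]_N') (A : M -> 'M[C]_N1) (B : M -> 'M[C]_N2) v j :
  (forall k, K k -> A k *m v = v) -> intK q B j -> intK q (fun g => A g *t B g) (tcol v j).
Proof.
move=> hv hj k hk; apply: mulmx_ext => x.
by rewrite -!mulmxA !tcolE tens_act hv // !mulmxA hj.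
Qed.

Lemma intK_uniq N N' (q : M -> 'M[C]_N') (p : M -> 'M[C]_N) (j j' : 'M[C]_(N, N')) (x : 'cV[C]_N') :
  irr K q -> intK q p j -> intK q p j' -> x != 0 -> j *m x = j' *m x -> j = j'.
Proof.
move=> iq hj hj' x0 hx; apply: mulmx_ext.
apply: (irr_ind (P := fun y => j *m y = j' *m y) iq _ _ hx x0).
  by split=> [|c y z hy hz]; rewrite ?mulmx0 // !mulmxDr -!scalemxAr hy hz.
by move=> g z hg hz; rewrite !mulmxA hj // hj' // -!mulmxA hz.
Qed.

End TensorFactor.

(** * The theorem *)

Section Translation.
Variables (C : numClosedFieldType) (m : nat).
Local Notation M := 'M[C]_m.+2.

Lemma inKP (g : M) : inK g <-> exists (k1 : 'M[C]_2) (k2 : 'M[C]_m),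
  [/\ k1 \is unitarymx, k2 \is unitarymx, \det k1 * \det k2 = 1 &
      g = (block_mx k1 0 0 k2 : 'M[C]_(2 + m))].
Proof.
split=> [[[/unitaryP[g1 _] dg] bg]|[k1 [k2 [/unitaryP[u1 _] /unitaryP[u2 _] d12 gE]]]].
  pose g' : 'M[C]_(2 + m) := g.
  have ur0 : ursubmx g' = 0.
    by apply/matrixP => a b; rewrite mxE [RHS]mxE mxE; apply: bg; rewrite /= (leq_trans (ltn_ord a)).
  have dl0 : dlsubmx g' = 0.
    apply/matrixP => a b; rewrite mxE [RHS]mxE mxE; apply: bg.
    by rewrite /= (leq_trans (ltn_ord b)).
  have gE : g' = block_mx (ulsubmx g') 0 0 (drsubmx g') by rewrite -{1}[g']submxK ur0 dl0.
  have : g' *m g'^t* = 1%:M by exact: g1.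
  rewrite gE tr_block_mx map_block_mx mulmx_block scalar_mx_block !trmx0 !map_mx0 !mulmx0 !mul0mx !addr0 !add0r.
  case/eq_block_mx => h1 _ _ h2.
  exists (ulsubmx g'), (drsubmx g'); split => //.
  - exact/unitarymxP.
  - exact/unitarymxP.
  - by rewrite -(det_ublock _ 0) -gE.
subst g; split; [split|].
- apply/unitarymxP; have : (block_mx k1 0 0 k2 : 'M[C]_(2 + m)) *m (block_mx k1 0 0 k2)^t* = 1%:M.
    rewrite tr_block_mx map_block_mx mulmx_block scalar_mx_block !trmx0 !map_mx0 !mulmx0 !mul0mx !addr0 !add0r.
    by rewrite u1 u2.
  exact.
- by rewrite -[RHS]d12 -(det_ublock _ (0 : 'M[C]_(2, m))).
move=> k l; rewrite -(splitK (k : 'I_(2 + m))) -(splitK (l : 'I_(2 + m))).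
case: (fintype.split (k : 'I_(2 + m))) => a; case: (fintype.split (l : 'I_(2 + m))) => b /=.
- by rewrite !(leq_trans (ltn_ord _)).
- by move=> _; have h := block_mxEur k1 0 0 k2 a b; rewrite [RHS]mxE in h; exact: h.
- by move=> _; have h := block_mxEdl k1 0 0 k2 a b; rewrite [RHS]mxE in h; exact: h.
- by [].
Qed.

Lemma mcv_cvg a b (A : nat -> 'M[C]_(a, b)) L : mcv A L -> A @ \oo --> L.
Proof.
case=> h; apply/cvg_ballP => eps e0; near=> k; split=> //.
near: k; apply: filter_forall => i; apply: filter_forall => j.
by have /cvg_ballP/(_ _ e0) := h i j.
Unshelve. all: by end_near.
Qed.

(** A sequence in [H] that converges entrywise converges for the subspace filter of [H]; entries are
    continuous, which leads back to [mcv]. *)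
Lemma within_mcv N (H : set M) (p : M -> 'M[C]_N) (g : nat -> M) h :
  {within H, continuous p} -> (forall k, H (g k)) -> H h -> mcv g h ->
  mcv (fun k => p (g k)) (p h).
Proof.
move=> /subspace_continuousP hp hg hh gh.
have gH : g @ \oo --> within H (nbhs h).
  move=> A hA; have hA' : \forall k \near \oo, H (g k) -> A (g k) by exact: mcv_cvg gh _ hA.
  suff : \forall k \near \oo, A (g k) by [].
  by apply: filterS hA' => k; apply; exact: hg.
have pg : (fun k => p (g k)) @ \oo --> p h by exact: (cvg_comp _ _ gH (hp h hh)).
split=> i j; exact: (cvg_comp _ (fun A : 'M[C]_N => A i j) pg (@coord_continuous C N N i j (p h))).
Qed.

(** A predicate subspace with orthonormal basis B is a [{vspace}], namely the kernel of 1 - B B^* as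
    an operator. *)
Lemma vspace_irr N (H : M -> Prop) (p : M -> 'M[C]_N) : (0 < N)%N ->
  (forall W : {vspace 'cV[C]_N}, (forall g v, H g -> v \in W -> p g *m v \in W) ->
    W = 0%VS \/ W = fullv) -> irr H p.
Proof.
move=> N0 h; split=> // P sP hP; have [r [B [_ hB]]] := orthonormal_basis sP.
pose W : {vspace 'cV[C]_N} := lker (linfun (mulmx (1%:M - B *m B^t*))).
have WP v : v \in W <-> P v.
  rewrite memv_ker lfunE /= mulmxBl mul1mx subr_eq0 -mulmxA; split=> [/eqP|] h'.
    exact/hB.
  by apply/eqP/hB.
case: (h W) => [g v hg|W0|WT]; first by rewrite !WP; exact: hP.
  by left=> v /WP; rewrite W0 memv0 => /eqP.
by right=> v; apply/WP; rewrite WT memvf.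
Qed.

Lemma sum_regroup (I : choiceType) (V : lmodType C) (s : seq (I * C)) (F : I -> V) :
  \sum_(x <- s) x.2 *: F x.1 =
  \sum_(l <- undup (map fst s)) (\sum_(x <- s | x.1 == l) x.2) *: F l.
Proof.
under [RHS]eq_bigr => l _ do rewrite scaler_suml.
rewrite (exchange_big_dep xpredT) //= big_seq [RHS]big_seq; apply: eq_bigr => x xs.
rewrite (eq_bigl (pred1 x.1)) => [|l]; last by rewrite eq_sym.
by rewrite -big_filter filter_pred1_uniq ?undup_uniq ?mem_undup ?map_f // big_seq1.
Qed.

(** The coefficient vanishes off the finite list, so the sum over [A] has finite support, whatever
    the size of [A]. *)
Lemma sum_fsbig (I : choiceType) (V : lmodType C) (s : seq (I * C)) (F : I -> V) (A : set I) :
  (forall x, x \in s -> A x.1) ->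
  \sum_(x <- s) x.2 *: F x.1 =
  \sum_(l \in A) (\sum_(x <- s | x.1 == l) x.2) *: F l.
Proof.
move=> sA; rewrite sum_regroup (fsbig_seq _ _ (undup_uniq _)); apply: fsbig_widen.
  by move=> l /=; rewrite mem_undup => /mapP[x xs ->]; exact: sA.
move=> l [_ /= /negP]; rewrite mem_undup => ls; rewrite big_seq_cond big1 ?scale0r //.
by move=> x /andP[xs /eqP xl]; case/negP: ls; rewrite -xl map_f.
Qed.

End Translation.

(** * Application to the given representations *)

Section Concrete.
Variables (R : realType) (m : nat).
Notation C := (cplx R).
Local Notation M := 'M[C]_m.+2.

Lemma SU2UmP (k : M) : SU2Um k <-> @inK C m k.
Proof. exact: iff_sym (inKP k). Qed.

Lemma urep_SU (V : rep R m) : unitary_rep (@SU R m) V -> urep (@inSU C m.+1) (ract V).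
Proof.
move=> [h1 hM hU hC]; split=> // g h hg hh gh; exact: (within_mcv hC hg hh gh).
Qed.

Lemma urep_SU2Um (V : rep R m) : unitary_rep (@SU2Um R m) V -> urep (@inK C m) (ract V).
Proof.
move=> [h1 hM hU hC]; split=> //.
- by move=> g h /SU2UmP hg /SU2UmP hh; exact: hM.
- by move=> g /SU2UmP; exact: hU.
- move=> g h hg /SU2UmP hh gh; apply: (within_mcv hC _ hh gh) => k; exact/SU2UmP.
Qed.

Lemma irr_SU (V : rep R m) : irreducible (@SU R m) V -> irr (@inSU C m.+1) (ract V).
Proof. by move=> [h0 h]; exact: vspace_irr h0 h. Qed.

Lemma irr_SU2Um (V : rep R m) : irreducible (@SU2Um R m) V -> irr (@inK C m) (ract V).
Proof.
move=> [h0 h]; apply: vspace_irr h0 _ => W hW; apply: h => g v /SU2UmP; exact: hW.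
Qed.

Lemma conj_real (x : R) : (x%:C%C : C)^* = x%:C%C.
Proof. exact: conjc_real. Qed.

Lemma star_rpow (V : rep R m) la d : star_rep la (ract V) -> star_rep (la *+ d) (ract (rpow V d)).
Proof.
move=> hV; elim: d => [|d IH]; first exact: star_triv.
by rewrite mulrS; exact: (star_tens hV IH).
Qed.

Lemma star_LamR l : star_rep (omega m l) (ract (Lam R m l)).
Proof. exact: (@star_Lam C m l). Qed.

Lemma cyc_SymR N : cyclic_rep (omega m 1 *+ N) (ract (Sym R m N))
  (symvec N (mpolyX C (mnm1 ord0) ^+ N)).
Proof.
apply: (@cyc_Sym C m N (fun al => (monomial_norm R N al)%:C%C)) => al.
  exact: conj_real.
rewrite -rmorphXn /= sqr_sqrtr; last by rewrite divr_ge0.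
by rewrite rmorphM fmorphV !rmorph_nat.
Qed.

Lemma cyc_Urep a b i : cyclic_rep (omega m 1 *+ (a - i) + ((omega m 2 + omega m m.+1) *+ i + omega m 2 *+ b))
  (ract (Urep R m a b i)) (uvec R m a b i).
Proof.
have h1 := star_rpow (V := rtens (Lam R m 2) (Lam R m m.+1)) i (star_tens (star_LamR 2) (star_LamR m.+1)).
have h2 := star_rpow b (star_LamR 2).
exact: (cyc_tens (cyc_SymR (a - i)) (cyc_tens (star_cyc (vpow (v0 R m) i) h1) (star_cyc (vpow (e12 R m) b) h2))).
Qed.

Lemma cyc_Wrep a b i d1 d2 :
  cyclic_rep (nu m a b i + lambda1 m *+ d1 + lambda2 m *+ d2) (ract (Wrep R m a b i d1 d2))
    (wvec R m a b i d1 d2).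
Proof.
(* The summands are put in the order of the tensor factors of [Wrep]. *)
have -> : nu m a b i + lambda1 m *+ d1 + lambda2 m *+ d2 =
  (omega m 1 + omega m m.+1) *+ d1 + ((omega m 2 + omega m m) *+ d2 +
   (omega m 1 *+ (a - i) + ((omega m 2 + omega m m.+1) *+ i + omega m 2 *+ b))).
  rewrite /nu /lambda1 /lambda2 !mulrnDl [omega m 2 *+ (i + b)]mulrnDr.
  move: (omega m 1 *+ (a - i)) (omega m 2 *+ i) (omega m 2 *+ b) (omega m m.+1 *+ i) => x y z t.
  rewrite addrC [RHS]addrCA; congr (_ + _); rewrite addrC; congr (_ + _).
  by rewrite -!addrA; congr (_ + (_ + _)); rewrite addrC.
have h1 := star_rpow (V := rtens (Lam R m 1) (Lam R m m.+1)) d1 (star_tens (star_LamR 1) (star_LamR m.+1)).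
have h2 := star_rpow (V := rtens (Lam R m 2) (Lam R m m)) d2 (star_tens (star_LamR 2) (star_LamR m)).
exact: (cyc_tens (star_cyc (vpow (v1 R m) d1) h1)
  (cyc_tens (star_cyc (vpow (v2 R m) d2) h2) (cyc_Urep a b i))).
Qed.

Lemma vpow_inv (V : rep R m) (v : 'cV[C]_(rdim V)) g d : ract V g *m v = v ->
  ract (rpow V d) g *m vpow v d = vpow v d.
Proof.
move=> h; elim: d => [|d IH]; first exact: mul1mx.
exact: (etrans (tens_act (ract V g) (ract (rpow V d) g) v (vpow v d)) (congr2 _ h IH)).
Qed.

Lemma vpow_dot (V : rep R m) (v : 'cV[C]_(rdim V)) g d c : v^t* *m (ract V g *m v) = c%:M ->
  (vpow v d)^t* *m (ract (rpow V d) g *m vpow v d) = (c ^+ d)%:M.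
Proof.
move=> h; elim: d => [|d IH]; first by rewrite /= mul1mx ctmx1 mul1mx.
have E : (vpow v d.+1)^t* *m (ract (rpow V d.+1) g *m vpow v d.+1) =
  ((v^t* *m (ract V g *m v)) *t ((vpow v d)^t* *m (ract (rpow V d) g *m vpow v d)) : 'M[C]_1).
  rewrite -tens_dot; congr (_ *m _).
  exact: (tens_act (ract V g) (ract (rpow V d) g) v (vpow v d)).
rewrite E h IH; apply: mx11_eq; rewrite tens11 !mxE eqxx !mulr1n exprS //.
Qed.

Lemma conj_imag (x : R) : ('i%C * x%:C%C : C)^* = - ('i%C * x%:C%C).
Proof.
have -> : 'i%C * x%:C%C = Complex 0 x :> C.
  apply/eqP; rewrite eq_complex /=.
  by apply/andP; split; apply/eqP; ring.
by apply/eqP; rewrite eq_complex /= oppr0 !eqxx.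
Qed.

(** Half-angle formulas in the form required by [aaelt_SU], where the element is a square. *)
Lemma half_cos (t : R) : (cos t)%:C%C = (cos (t / 2))%:C%C ^+ 2 + ('i%C * (sin (t / 2))%:C%C) ^+ 2 :> C.
Proof.
rewrite exprMn sqr_i mulN1r -!rmorphXn -rmorphB /=; congr (_ %:C%C).
by rewrite {1}[t]splitr cosD !expr2.
Qed.

Lemma half_sin (t : R) : 'i%C * (sin t)%:C%C = (cos (t / 2))%:C%C * ('i%C * (sin (t / 2))%:C%C) *+ 2 :> C.
Proof.
rewrite {1}[t]splitr sinD [cos _ * sin _]mulrC -mulr2n rmorphMn rmorphM /=.
by rewrite mulrnAr [_ * (cos _)%:C%C]mulrC mulrCA.
Qed.

Lemma half_one (t : R) : (cos t)%:C%C ^+ 2 - ('i%C * (sin t)%:C%C) ^+ 2 = 1 :> C.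
Proof. by rewrite exprMn sqr_i mulN1r opprK -!rmorphXn -rmorphD cos2Dsin2. Qed.

Lemma aelt_SU (hm : (2 < m)%N) t1 t2 : @inSU C m.+1 (aelt m t1 t2).
Proof.
exact: (aaelt_SU hm (half_cos t1) (half_sin t1) (half_cos t2) (half_sin t2)
  (half_one (t1 / 2)) (half_one (t2 / 2)) (conj_real _) (conj_imag _) (conj_real _) (conj_imag _)).
Qed.

Lemma mu_high a b (k : 'I_m.+1) : (1 < k)%N -> mu m a b 0 k = 0.
Proof.
move=> hk; have [h1 h2] : k.+1 != 1%N /\ k.+1 != 2%N by split; lia.
by rewrite mxE !mulmxnE !mxE (negbTE h1) (negbTE h2) !mul0rn addr0.
Qed.

Variables (a b i : nat) (VK : rep R m) (hVK : irrepK VK (mu m a b)).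
Variables (VG : weight m -> rep R m) (hVG : forall l : weight m, dominant l -> irrepG (VG l) l).
Variable jG : forall l : weight m, 'M[C]_(rdim (VG l), rdim VK).
Hypothesis hjG : forall l : weight m, Pplus VK VG l -> unitary_K_intertwiner (jG l).
Variables (vmu : 'cV[C]_(rdim VK)) (hvmu : weight_vector (mu m a b) vmu) (vmu0 : vmu != 0).

Lemma intKP (V : rep R m) (j : 'M[C]_(rdim V, rdim VK)) :
  K_intertwiner j <-> intK (ract VK) (ract V) j.
Proof. by split=> h k /SU2UmP; exact: h. Qed.

Lemma factor_Wrep d1 d2 (j : 'M[C]_(rdim (Wrep R m a b i d1 d2), rdim VK))
  (jnu : 'M[C]_(rdim (Urep R m a b i), rdim VK)) :
  K_intertwiner j -> j *m vmu = wvec R m a b i d1 d2 ->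
  K_intertwiner jnu -> jnu *m vmu = uvec R m a b i ->
  j = tcol (vpow (v1 R m) d1) (tcol (vpow (v2 R m) d2) jnu).
Proof.
have [_ iK _] := hVK; move=> /intKP hj hjw /intKP hjnu hjnuu.
have inv1 k : @inK C m k -> ract (rpow (rtens (Lam R m 1) (Lam R m m.+1)) d1) k *m vpow (v1 R m) d1 = vpow (v1 R m) d1.
  by move=> hk; apply: (vpow_inv (V := rtens (Lam R m 1) (Lam R m m.+1))); exact: av1_inv.
have inv2 k : @inK C m k -> ract (rpow (rtens (Lam R m 2) (Lam R m m)) d2) k *m vpow (v2 R m) d2 = vpow (v2 R m) d2.
  by move=> hk; apply: (vpow_inv (V := rtens (Lam R m 2) (Lam R m m))); exact: av2_inv.
have h2 := tcol_int inv2 hjnu; have h1 := tcol_int inv1 h2.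
apply: (intK_uniq (irr_SU2Um iK) hj h1 vmu0); rewrite hjw tcolE tcolE hjnuu //.
Qed.

Lemma compression_Wrep (hm : (2 < m)%N) d1 d2
  (jnu : 'M[C]_(rdim (Urep R m a b i), rdim VK)) t1 t2 :
  compression (W := Wrep R m a b i d1 d2)
    (tcol (vpow (v1 R m) d1) (tcol (vpow (v2 R m) d2) jnu)) (aelt m t1 t2) =
  (psi1 t1 t2 ^+ d1 * psi2 t1 t2 ^+ d2) *: compression jnu (aelt m t1 t2).
Proof.
have hg := aelt_SU hm t1 t2.
have e1 : (v1 R m)^t* *m (ract (rtens (Lam R m 1) (Lam R m m.+1)) (aelt m t1 t2) *m v1 R m) =
    (psi1 t1 t2 : C)%:M.
  have := av1_aaelt hm hg (conj_real (cos t1)) (conj_real (cos t2)).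
  by rewrite -!rmorphXn -rmorphD.
have e2 : (v2 R m)^t* *m (ract (rtens (Lam R m 2) (Lam R m m)) (aelt m t1 t2) *m v2 R m) =
    (psi2 t1 t2 : C)%:M.
  have := av2_aaelt hm hg (conj_real (cos t1)) (conj_real (cos t2)).
  by rewrite -!rmorphXn -rmorphM.
have f1 := vpow_dot (V := rtens (Lam R m 1) (Lam R m m.+1)) d1 e1.
have f2 := vpow_dot (V := rtens (Lam R m 2) (Lam R m m)) d2 e2.
rewrite -scalerA -(tcol_compress jnu (ract (Urep R m a b i) (aelt m t1 t2)) f2).
exact: (tcol_compress _ _ f1).
Qed.

Lemma expand_compression (hm : (2 < m)%N) la (W : rep R m) (w : 'cV[C]_(rdim W))
  (j : 'M[C]_(rdim W, rdim VK)) : cyclic_rep la (ract W) w -> K_intertwiner j -> j *m vmu = w ->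
  exists c : weight m -> C, forall t1 t2 : R,
     compression j (aelt m t1 t2) =
     \sum_(l \in [set l : weight m | preceq l la /\ Pplus VK VG l])
        c l *: compression (jG l) (aelt m t1 t2).
Proof.
move=> hW /intKP hj hjw; have [uK iK [wK mK]] := hVK.
have [r [V0 [j0 [uV0 sV0 hj0 cE]]]] := cyc_urep hW (irr_SU2Um iK) hj hjw vmu0.
have hP l : occurs (ract VK) (fun l => ract (VG l)) l <-> Pplus VK VG l.
  by split=> -[dl [J hJ J0]]; split=> //; exists J => //; apply/intKP.
have hm1 : (1 < m)%N by exact: ltnW.
have [s [hs sE]] : expands (ract VK) (fun l => ract (VG l)) jG la V0 j0.
  apply: (expands_all (is_expi_ei R) hm1 (urep_SU2Um uK) (irr_SU2Um iK) vmu0 (mu := mu m a b)) => //.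
  - by move=> l v v0 hv; apply: mK; exists v.
  - by move=> k; exact: mu_high.
  - by move=> l /hVG[h _ _]; exact: urep_SU.
  - by move=> l /hVG[_ h _]; exact: irr_SU.
  - by move=> l /hVG[_ _ [[v v0 hv] _]]; exists v.
  - by move=> l /hVG[_ _ [_ h]] l' w' w0 hw; apply: h; exists w'.
  - move=> l /hP hl; have [h1 h2] := hjG hl; split; first exact/intKP.
    (* An isometry cannot vanish, as it does not kill [vmu]. *)
    apply: contra_neq vmu0 => J0; have : (jG l)^t* *m jG l *m vmu = 0.
      by rewrite J0 mulmx0 mul0mx.
    by rewrite h2 mul1mx.
(* The coefficient of a weight collects the contributions of all irreducible pieces of that highest
   weight. *)
exists (fun l => \sum_(x <- s | x.1 == l) x.2) => t1 t2.
have hg := aelt_SU hm t1 t2.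
rewrite -(sum_fsbig (fun l => compression (jG l) (aelt m t1 t2))) => [|x xs].
  by rewrite /compression cE // sE.
by have [h1 /hP h2] := hs x xs; split.
Qed.

End Concrete.

Theorem proposition8p1 (R : realType) (m : nat) (hm : (2 < m)%N)
  (a b i d1 d2 : nat) (hi : (i <= a)%N)
  (VK : rep R m) (hVK : irrepK VK (mu m a b))
  (VG : weight m -> rep R m)
  (hVG : forall l : weight m, dominant l -> irrepG (VG l) l)
  (jG : forall l : weight m, 'M[cplx R]_(rdim (VG l), rdim VK))
  (hjG : forall l : weight m, Pplus VK VG l -> unitary_K_intertwiner (jG l))
  (lambda : weight m)
  (hlambda : lambda = nu m a b i + lambda1 m *+ d1 + lambda2 m *+ d2)
  (hP : Pplus VK VG lambda)
  (vmu : 'cV[cplx R]_(rdim VK)) (hvmu : weight_vector (mu m a b) vmu)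
  (hvmu1 : vmu^t* *m vmu = 1%:M)
  (j : 'M[cplx R]_(rdim (Wrep R m a b i d1 d2), rdim VK))
  (hj : K_intertwiner j) (hjw : j *m vmu = wvec R m a b i d1 d2)
  (jnu : 'M[cplx R]_(rdim (Urep R m a b i), rdim VK))
  (hjnu : K_intertwiner jnu) (hjnuu : jnu *m vmu = uvec R m a b i) :
  (forall t1 t2 : R,
     compression j (aelt m t1 t2) =
     (psi1 t1 t2 ^+ d1 * psi2 t1 t2 ^+ d2) *: compression jnu (aelt m t1 t2)) /\
  (exists c : weight m -> cplx R, forall t1 t2 : R,
     compression j (aelt m t1 t2) =
     \sum_(l \in [set l : weight m | preceq l lambda /\ Pplus VK VG l])
        c l *: compression (jG l) (aelt m t1 t2)).
Proof.
have [_ iK _] := hVK.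
have vmu0 : vmu != 0.
  apply/eqP => h; have := hvmu1; rewrite h mulmx0 => /matrixP/(_ 0 0)/eqP.
  by rewrite !mxE eqxx eq_sym oner_eq0.
split.
  by move=> t1 t2; rewrite (factor_Wrep hVK vmu0 hj hjw hjnu hjnuu) compression_Wrep.
rewrite hlambda; exact: (expand_compression hVK hVG hjG hvmu vmu0 hm (cyc_Wrep R m a b i d1 d2) hj hjw).
Qed.
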